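(* Let $p,q$ be random polynomials of degree $d$ in two variables sampled independently from the Kostlan ensemble. Let $N_d$ denote the number of limit cycles (in the whole plane $\mathbb{R}^2$) of the vector field $F(x,y)=\binom{p(x,y)}{q(x,y)}$. There exists a constant $c_0>0$ such that $$\mathbb{E}\,N_d \ge c_0\cdot d\qquad\text{for all } d.$$
   Context: A random polynomial $p$ of degree $d$ is sampled from the Kostlan (Kostlan-Shub-Smale) ensemble if $$p(x,y)=\sum_{0\le j+k\le d} a_{j,k}\sqrt{\frac{d!}{(d-j-k)!\,j!\,k!}}\;x^j y^k,$$ where the $a_{j,k}\sim N(0,1)$ are i.i.d. standard real Gaussians. A limit cycle of a planar vector field $F$ is an isolated (nonconstant) periodic orbit of the system $(\dot x,\dot y)=F(x,y)$.
   Formalization: The bound is stated for all d except d = 1: for d = 1 the field is affine, its periodic orbits are never isolated, so N_1 = 0 and the inequality fails for every c_0 > 0. *)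

(* Defs.v *)
From HB Require Import structures.
From mathcomp Require Import all_boot all_order all_algebra.
From mathcomp Require Import all_classical all_reals all_analysis.

Set Implicit Arguments.
Unset Strict Implicit.
Unset Printing Implicit Defensive.

Import Order.TTheory GRing.Theory Num.Theory.
Import numFieldNormedType.Exports.

Local Open Scope classical_set_scope.
Local Open Scope ring_scope.

(* The exponents (j, k) of the monomials x^j y^k with j + k <= d. *)
Definition kidx (d : nat) : finType :=
  {jk : 'I_d.+1 * 'I_d.+1 | (jk.1 + jk.2 <= d)%N}.

Definition kostlan_weight (R : realType) (d : nat) (i : kidx d) : R :=
  let j : nat := (val i).1 in let k : nat := (val i).2 in
  Num.sqrt ((d`!)%:R / ((d - j - k)`! * j`! * k`!)%:R).

Definition kostlan_poly (R : realType) (d : nat) (a : kidx d -> R)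
    (z : R * R) : R :=
  \sum_(i : kidx d) a i * kostlan_weight R i
    * z.1 ^+ (val i).1 * z.2 ^+ (val i).2.

(* Taking some of the [B i] to be [setT] gives the product rule for every
   subfamily. *)
Definition mutually_independent (d : measure_display) (T : measurableType d)
    (R : realType) (P : probability T R) (I : finType)
    (X : I -> {RV P >-> R}) : Prop :=
  forall B : I -> set R, (forall i, measurable (B i)) ->
    P (\bigcap_i (X i @^-1` B i)) = (\prod_i P (X i @^-1` B i))%E.

Definition standard_normal (d : measure_display) (T : measurableType d)
    (R : realType) (P : probability T R) (X : {RV P >-> R}) : Prop :=
  forall B : set R, measurable B -> distribution P X B = normal_prob 0 1 B.

(* [a] and [b] are the coefficient families of two independent Kostlan
   polynomials: all the coefficients together are i.i.d. standard Gaussians. *)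
Definition independent_kostlan (disp : measure_display)
    (T : measurableType disp) (R : realType) (P : probability T R) (d : nat)
    (a b : kidx d -> {RV P >-> R}) : Prop :=
  let c (i : kidx d + kidx d) : {RV P >-> R} :=
    match i with inl k => a k | inr k => b k end in
  mutually_independent c /\ forall i, standard_normal (c i).

Definition solution (R : realType) (F : R * R -> R * R) (g : R -> R * R) :
    Prop :=
  forall t : R, is_derive t (1 : R) (fst \o g) (F (g t)).1 /\
                is_derive t (1 : R) (snd \o g) (F (g t)).2.

Definition periodic_orbit (R : realType) (F : R * R -> R * R)
    (C : set (R * R)) : Prop :=
  exists g : R -> R * R, [/\ solution F g,
    exists2 T : R, 0 < T & periodic g T,
    exists t s : R, g t <> g s
    & C = range g].

Definition limit_cycle (R : realType) (F : R * R -> R * R)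
    (C : set (R * R)) : Prop :=
  periodic_orbit F C /\
  (* [C] is compact, so [U] may be thought of as a thin tube around it. *)
  exists U : set (R * R), [/\ open U, C `<=` U
    & forall C', periodic_orbit F C' -> C' `<=` U -> C' = C].

(* The number of limit cycles, [+oo] if there are infinitely many. *)
Definition num_limit_cycles (R : realType) (F : R * R -> R * R) : \bar R :=
  @counting _ R [set C | limit_cycle F C].

(* Main.v *)
(* Rotating R^3 so that the direction of (x0, y0, 1) goes to the third axis
   preserves the law of a Kostlan polynomial.  In the rotated coordinates the
   field (p, q) on a disc of radius of order 1 / sqrt d around (x0, y0) is, up to
   a positive factor, a random quadratic field plus a noise of bounded size.
   The quadratic field (quad1, quad2) has the unit circle as a hyperbolic limit
   cycle, which persists under C^1-small perturbations.  Shifting the Gaussian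
   coefficients by a large multiple of (quad1, quad2) makes the noise relatively
   small and costs a factor independent of d (Cameron-Martin), so with
   probability at least c1 > 0 the field has a limit cycle in the disc.  The unit
   square contains of the order of d points with disjoint discs, and
   expectations add up. *)

Require Import Defs.
From mathcomp Require Import all_boot all_order all_algebra.
From mathcomp Require Import all_classical all_reals all_analysis.
From mathcomp Require Import measurable_realfun ring lra zify.

Import Order.TTheory GRing.Theory Num.Theory.
Import numFieldNormedType.Exports.

Local Open Scope classical_set_scope.
Local Open Scope ring_scope.

Set Implicit Arguments.
Unset Strict Implicit.
Unset Printing Implicit Defensive.

(** Persistence of the cycle is proved without a return map. In a thin ring, orbits are graphs over
    the angle, solutions of a scalar periodic equation whose right-hand side decreases in the radial
    variable at every angle. Existence of a periodic graph is then a contraction argument, and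
    uniqueness holds because the difference of two solutions would grow exponentially backward in
    time. Only the quotient of the radial by the angular component enters, so the positive factor,
    which varies like a d-th power, cancels; for the perturbation, a bound and a radial Lipschitz
    constant suffice. Rotating R^3 acts on the plane as a projective map, which sends rays to rays;
    the vector (p, q) itself is not rotated. Along a ray the perturbation is thus a change of radius
    plus the noise. A Kostlan weight of degree m is at most d^(m/2), so at scale 1 / sqrt d the
    noise is dominated by a geometric series. In degrees at most 2 the weights are also comparable
    to d^(m/2) from below, so the shift has norm bounded independently of d. *)

Lemma continuous_pairfun (T U V : topologicalType) (f : T -> U) (g : T -> V) :
  continuous f -> continuous g -> continuous (fun t => (f t, g t)).
Proof. by move=> cf cg t; apply: cvg_pair; [exact: cf|exact: cg]. Qed.

(** * Continuity and derivative rules for functions given pointwise *)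

Section continuity.
Context {R : realType} {T : topologicalType}.
Implicit Types f g : T -> R.

Lemma continuousMfun f g : continuous f -> continuous g ->
  continuous (fun t => f t * g t).
Proof. by move=> cf cg x; exact: (@continuousM R T f g x (cf x) (cg x)). Qed.

Lemma continuousDfun f g : continuous f -> continuous g ->
  continuous (fun t => f t + g t).
Proof. by move=> cf cg x; exact: (@continuousD R R T f g x (cf x) (cg x)). Qed.

Lemma continuousNfun f : continuous f -> continuous (fun t => - f t).
Proof. by move=> cf x; exact: (@continuousN R R T f x (cf x)). Qed.

Lemma continuousBfun f g : continuous f -> continuous g ->
  continuous (fun t => f t - g t).
Proof. by move=> cf cg; exact: continuousDfun (continuousNfun cg). Qed.

Lemma continuousVfun f : continuous f -> (forall t, f t != 0) ->
  continuous (fun t => (f t)^-1).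
Proof. by move=> cf f0 x; exact: (@continuousV R T f x (f0 x) (cf x)). Qed.

Lemma continuous_cstfun (c : R) : continuous ((fun=> c) : T -> R).
Proof. by move=> x; exact: cst_continuous. Qed.

Lemma continuousXfun f n : continuous f -> continuous (fun t => f t ^+ n).
Proof.
move=> cf; elim: n => [|n IH].
  by rewrite (_ : (fun _ => _) = fun=> 1)//; exact: continuous_cstfun.
rewrite (_ : (fun _ => _) = fun t => f t * f t ^+ n); first exact: continuousMfun.
by apply/funext => t; rewrite exprS.
Qed.

Lemma continuous_sumfun (I : finType) (F : I -> T -> R) :
  (forall i, continuous (F i)) -> continuous (fun t => \sum_i F i t).
Proof.
move=> cF; elim: (index_enum I) => [|i r IH].
  rewrite (_ : (fun _ => _) = fun=> 0); first exact: continuous_cstfun.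
  by apply/funext => t; rewrite big_nil.
rewrite (_ : (fun _ => _) = fun t => F i t + \sum_(j <- r) F j t).
  exact: continuousDfun.
by apply/funext => t; rewrite big_cons.
Qed.

End continuity.

Section calculus.
Context {R : realType}.
Implicit Types (f g : R -> R) (x a b : R).

Lemma is_deriveDfun f g x a b : is_derive x (1 : R) f a ->
  is_derive x (1 : R) g b -> is_derive x (1 : R) (fun t => f t + g t) (a + b).
Proof. by move=> fa gb; exact: (is_deriveD fa gb). Qed.

Lemma is_deriveBfun f g x a b : is_derive x (1 : R) f a ->
  is_derive x (1 : R) g b -> is_derive x (1 : R) (fun t => f t - g t) (a - b).
Proof. by move=> fa gb; exact: (is_deriveB fa gb). Qed.

Lemma is_deriveNfun f x a : is_derive x (1 : R) f a ->
  is_derive x (1 : R) (fun t => - f t) (- a).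
Proof. by move=> fa; exact: (is_deriveN fa). Qed.

Lemma is_deriveMfun f g x a b : is_derive x (1 : R) f a ->
  is_derive x (1 : R) g b ->
  is_derive x (1 : R) (fun t => f t * g t) (a * g x + f x * b).
Proof.
move=> fa gb; have H := @is_deriveM R R f g x 1 a b fa gb.
by apply: (is_derive_eq H); rewrite /GRing.scale /= addrC [_ * a]mulrC.
Qed.

Lemma is_deriveVfun f x a : f x != 0 -> is_derive x (1 : R) f a ->
  is_derive x (1 : R) (fun t => (f t)^-1) (- a / f x ^+ 2).
Proof.
move=> f0 fa; have H := @is_deriveV R f x a 1 f0 fa.
by apply: (is_derive_eq H); rewrite /GRing.scale /= !mulNr mulrC.
Qed.

Lemma is_derive_compfun f g x a b : is_derive (g x) (1 : R) f a ->
  is_derive x (1 : R) g b ->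
  is_derive x (1 : R) (fun t => f (g t)) (a * b).
Proof. by move=> fa gb; exact: (is_derive1_comp fa gb). Qed.

Lemma is_derive_cstfun (c x : R) : is_derive x (1 : R) (fun=> c : R) 0.
Proof. exact: (@is_derive_cst R R R c x 1). Qed.

Lemma is_derive_idfun (x : R) : is_derive x (1 : R) (fun t : R => t) 1.
Proof. exact: (@is_derive_id R R x 1). Qed.

Lemma is_derive_continuous f x a : is_derive x (1 : R) f a ->
  {for x, continuous f}.
Proof.
move=> fa; apply: differentiable_continuous.
by apply/derivable1_diffP; case: fa.
Qed.

Lemma derive_ge0_ndecr f f' : (forall x, is_derive x (1 : R) f (f' x)) ->
  (forall x, 0 <= f' x) -> forall a b, a <= b -> f a <= f b.
Proof.
move=> df f0 a b ab.
have [|c _ e] := MVT_segment ab (fun x _ => df x).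
  by apply: continuous_subspaceT => x; exact: is_derive_continuous (df x).
by rewrite -subr_ge0 e mulr_ge0// subr_ge0.
Qed.

(** An integral with a fixed left end is a primitive only to the right of that end. A second one,
    for the reflected function, covers the left. Both start at -1, so that they overlap on ]-1, 1[,
    where they differ by a constant; this gives the derivative at the gluing point 0. *)
Lemma continuous_antiderivative f : continuous f ->
  exists F : R -> R, forall x, is_derive x (1 : R) F (f x).
Proof.
have right g : continuous g ->
    exists G : R -> R, forall x, -1 < x -> is_derive x (1 : R) G (g x).
  move=> cg.
  exists (fun x => (\int[lebesgue_measure]_(t in [set` `[(-1), x]]) g t)%R).
  move=> x x0.
  have [||dG G'] := @continuous_FTC1_closed R g (-1) x (x + 1) _ _ x0 (cg x).
  - by rewrite ltrDl.
  - apply: continuous_compact_integrable; first exact: segment_compact.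
    exact: continuous_subspaceT.
  - by rewrite -G' derive1E; exact: derivableP.
move=> cf.
have [G1 dG1] := right f cf.
have [|G2 dG2] := right (fun x => f (- x)).
  by move=> x; apply: continuous_comp; [exact: opp_continuous|exact: cf].
have dG2' (x : R) : x < 1 -> is_derive x (1 : R) (fun t => - G2 (- t)) (f x).
  move=> x1; have x1' : -1 < - x by rewrite ltrN2.
  have H := is_deriveNfun (is_derive_compfun (dG2 _ x1')
              (is_deriveNfun (is_derive_id x 1))).
  by apply: (is_derive_eq H); rewrite opprK mulrN1 opprK.
pose F (x : R) : R := if 0 <= x then G1 x - G1 0 else - G2 (- x) + G2 0.
have glue (x : R) : -1 < x -> x < 1 -> G1 x - G1 0 = - G2 (- x) + G2 0.
  move=> xl xr.
  pose h (t : R) : R := G1 t - - G2 (- t).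
  suff hx : h x = h 0 by move: hx; rewrite /h oppr0; lra.
  have dh (t : R) : -1 < t -> t < 1 -> is_derive t (1 : R) h 0.
    move=> tl tr; apply: is_derive_eq.
      exact: is_deriveBfun (dG1 _ tl) (dG2' _ tr).
    by rewrite subrr.
  have aux (a b : R) : -1 < a -> b < 1 -> a <= b -> h a = h b.
    move=> a1 b1 ab.
    have [||c _ e] := @MVT_segment _ h (fun=> 0) a b ab.
    - move=> t; rewrite in_itv/= => /andP[at0 tb].
      by apply: dh; [apply: lt_trans at0|apply: lt_trans b1].
    - apply: continuous_in_subspaceT => t; rewrite inE/= in_itv/=.
      move=> /andP[at0 tb]; apply: is_derive_continuous.
      by apply: dh; [apply: lt_le_trans at0|apply: le_lt_trans b1].
    - by move: e; rewrite mul0r => /subr0_eq.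
  have [x0|/ltW x0] := leP x 0; first by apply: aux.
  by apply/esym/aux.
exists F => x; have [x0|x0] := ltP x 0.
- apply: (@near_eq_is_derive _ _ _ (fun t => - G2 (- t) + G2 0)).
    near=> t; rewrite /F ifN // -ltNge.
    by near: t; exact: lt_nbhsl.
  apply: is_derive_eq; last exact: addr0.
  exact: (is_deriveDfun (dG2' x (lt_trans x0 ltr01)) (is_derive_cstfun _ x)).
- apply: (@near_eq_is_derive _ _ _ (fun t => G1 t - G1 0)).
    near=> t; rewrite /F; case: ifPn => //; rewrite -ltNge => t0.
    apply: glue; last by apply: lt_trans t0 _.
    by near: t; apply: lt_nbhsr; apply: lt_le_trans x0; rewrite ltrN10.
  apply: is_derive_eq; last exact: subr0.
  have x1 : -1 < x by apply: lt_le_trans x0; rewrite ltrN10.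
  exact: (is_deriveBfun (dG1 x x1) (is_derive_cstfun _ x)).
Unshelve. all: by end_near. Qed.

End calculus.

(** * Periodic solutions of a contracting equation *)

Section periodic_ode.
Context {R : realType}.
Implicit Types (L M T : R) (y g : R -> R).

Lemma linear_ode_periodic L T g : 0 < L -> 0 < T -> continuous g ->
  periodic g T -> exists2 y : R -> R, periodic y T &
    forall x : R, is_derive x (1 : R) y (- L * y x + g x).
Proof.
move=> L0 T0 cg gT.
have dexp (c x : R) : is_derive x (1 : R) (fun t => expR (c * t)) (c * expR (c * x)).
  have H := is_derive_compfun (is_derive_expR (c * x))
    (is_deriveMfun (is_derive_cstfun c x) (is_derive_idfun x)).
  by apply: (is_derive_eq H); rewrite mul0r add0r mulr1 mulrC.
have [A dA] : exists A : R -> R, forall x, is_derive x (1 : R) A (expR (L * x) * g x).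
  apply: continuous_antiderivative; apply: continuousMfun => // x.
  exact: is_derive_continuous (dexp L x).
set q := expR (- L * T).
have q1 : q < 1 by rewrite expR_lt1 mulNr oppr_lt0 mulr_gt0.
(* The constant of integration for which the variation-of-constants solution satisfies y T = y 0. *)
pose C := (q * A T - A 0) / (1 - q).
pose y (x : R) := expR (- L * x) * (C + A x).
have dy (x : R) : is_derive x (1 : R) y (- L * y x + g x).
  have H := is_deriveMfun (dexp (- L) x)
    (is_deriveDfun (is_derive_cstfun C x) (dA x)).
  apply: (is_derive_eq H); rewrite /y.
  have e : expR (- L * x) * expR (L * x) = 1 by rewrite mulNr mulrC expRxMexpNx_1.
  by rewrite -[X in _ = _ + X]mul1r -e; ring.
exists y => // x.
(* The difference y (t + T) - y t solves u' = - L u, so [h] is constant; it vanishes at 0 by the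
   choice of [C]. *)
pose h (t : R) := (y (t + T) - y t) * expR (L * t).
have dh (t : R) : is_derive t (1 : R) h 0.
  have dT : is_derive t (1 : R) (fun t => y (t + T)) (- L * y (t + T) + g t).
    have H := @is_derive_compfun _ y (fun t => t + T) t _ _ (dy (t + T))
      (is_deriveDfun (is_derive_idfun t) (is_derive_cstfun T t)).
    by apply: (is_derive_eq H); rewrite addr0 mulr1 gT.
  have H := is_deriveMfun (is_deriveBfun dT (dy t)) (dexp L t).
  by apply: (is_derive_eq H); ring.
have : h x = 0.
  rewrite (is_derive_0_is_cst x 0 dh) /h add0r mulr0 expR0 mulr1 /y -/q.
  rewrite mulr0 expR0 /C; field.
  by rewrite subr_eq0 gt_eqF.
by rewrite /h => /eqP; rewrite mulf_eq0 expR_eq0 orbF subr_eq0 => /eqP.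
Qed.

(** A maximum principle: (L y - M) expR (L t) is nonincreasing, while over one period it is
    multiplied by expR (L T) > 1. So L y - M cannot be positive anywhere. *)
Lemma linear_ode_periodic_le L M T y g : 0 < L -> 0 < T -> periodic y T ->
  (forall x : R, is_derive x (1 : R) y (- L * y x + g x)) ->
  (forall x, g x <= M) -> forall x, L * y x <= M.
Proof.
move=> L0 T0 yT dy gM x; rewrite leNgt; apply/negP => Mx.
pose h (t : R) := - ((L * y t - M) * expR (L * t)).
have dexp (t : R) : is_derive t (1 : R) (fun t => expR (L * t)) (L * expR (L * t)).
  have H := is_derive_compfun (is_derive_expR (L * t))
    (is_deriveMfun (is_derive_cstfun L t) (is_derive_idfun t)).
  by apply: (is_derive_eq H); rewrite mul0r add0r mulr1 mulrC.
have dh (t : R) : is_derive t (1 : R) h (L * (M - g t) * expR (L * t)).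
  have H := is_deriveNfun (is_deriveMfun (is_deriveBfun
    (is_deriveMfun (is_derive_cstfun L t) (dy t)) (is_derive_cstfun M t))
    (dexp t)).
  by apply: (is_derive_eq H); ring.
have h0 t : 0 <= L * (M - g t) * expR (L * t).
  by rewrite mulr_ge0 ?expR_ge0// mulr_ge0 ?subr_ge0// ltW.
have xT : x <= x + T by rewrite lerDl ltW.
have := derive_ge0_ndecr dh h0 xT.
rewrite /h lerN2 yT mulrDr expRD ler_pM2l ?subr_gt0//.
rewrite -ler_pdivlMl ?expR_gt0// mulVf ?gt_eqF ?expR_gt0//.
by rewrite leNgt expR_gt1 mulr_gt0.
Qed.

Lemma uniform_limit_continuous (u : nat -> R -> R) (v : R -> R) (e : nat -> R) :
  (forall n, continuous (u n)) -> (forall n x, `|u n x - v x| <= e n) ->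
  (forall d, 0 < d -> exists n, e n < d) -> continuous v.
Proof.
move=> cu uv e0 x; apply/cvgrPdist_lt => d d0.
have d3 : 0 < d / 3 by rewrite divr_gt0.
have [n en] := e0 _ d3.
have := cu n x => /cvgrPdist_lt/(_ _ d3) cun.
near=> t.
have H : `|u n x - u n t| < d / 3 by near: t; exact: cun.
have -> : v x - v t = - (u n x - v x) + (u n x - u n t) + (u n t - v t) by ring.
apply: le_lt_trans (ler_normD _ _) _.
have H1 := le_lt_trans (uv n t) en.
have := ler_normD (- (u n x - v x)) (u n x - u n t).
rewrite normrN.
have H2 := le_lt_trans (uv n x) en.
by move: H H1 H2; lra.
Unshelve. all: by end_near. Qed.

(** In s, the difference quotients of f lie in [-L, -l]. Together with the bound on f 0 this gives f
    <= 0 at s0 and f >= 0 at - s0, so the strip |s| <= s0 traps solutions. *)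
Variables (f : R -> R -> R) (T s0 l L : R).
Hypothesis T0 : 0 < T.
Hypothesis s0_gt0 : 0 < s0.
Hypothesis l0 : 0 < l.
Hypothesis lL : l <= L.
Hypothesis fT : forall s x, f s (x + T) = f s x.
Hypothesis fc : forall s : R -> R, continuous s -> (forall x, `|s x| <= s0) ->
  continuous (fun x => f (s x) x).
Hypothesis f_le : forall s1 s2 x, - s0 <= s2 -> s2 <= s1 -> s1 <= s0 ->
  f s1 x - f s2 x <= - l * (s1 - s2).
Hypothesis f_ge : forall s1 s2 x, - s0 <= s2 -> s2 <= s1 -> s1 <= s0 ->
  - L * (s1 - s2) <= f s1 x - f s2 x.
Hypothesis f0 : forall x, `|f 0 x| <= l * s0.

Let L0 : 0 < L. Proof. exact: lt_le_trans lL. Qed.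

Let adm (s : R -> R) := [/\ continuous s, periodic s T & forall x, `|s x| <= s0].

(* The Picard step of s' = f s, with L s added to both sides to make it a
   contraction of ratio 1 - l / L in the sup norm. *)
Let step (s y : R -> R) := adm y /\
  forall x : R, is_derive x (1 : R) y (- L * y x + (L * s x + f (s x) x)).

(** The map s -> L s + f s x is nondecreasing because f loses at most L per unit of s. On the strip
    it therefore stays between - L s0 and L s0, and the maximum principle keeps y in the strip. *)
Let step_ex s : adm s -> exists y, step s y.
Proof.
have s0N : - s0 <= 0 by rewrite oppr_le0 ltW.
move=> [cs sT sb].
have cg : continuous (fun x => L * s x + f (s x) x).
  apply: continuousDfun; last exact: fc.
  by apply: continuousMfun => //; exact: continuous_cstfun.
have gT : periodic (fun x => L * s x + f (s x) x) T.
  by move=> x; rewrite sT fT.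
have [y yT dy] := linear_ode_periodic L0 T0 cg gT.
exists y; split=> //; split => //.
  by move=> x; exact: is_derive_continuous (dy x).
move=> x; rewrite ler_norml; apply/andP; split; last first.
  rewrite -(ler_pM2l L0); apply: (linear_ode_periodic_le L0 T0 yT dy) => t.
  have := sb t; rewrite ler_norml => /andP[sl sr].
  have := f_ge t sl sr (lexx _).
  have := f_le t s0N (ltW s0_gt0) (lexx _).
  have := f0 t; rewrite ler_norml => /andP[_ +].
  lra.
pose yn t := - y t; pose gn t := - (L * s t + f (s t) t).
have pn : periodic yn T by move=> t; rewrite /yn yT.
have dn (t : R) : is_derive t (1 : R) yn (- L * yn t + gn t).
  by apply: (is_derive_eq (is_deriveNfun (dy t))); rewrite /yn /gn; ring.
have gnM t : gn t <= L * s0.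
  have := sb t; rewrite ler_norml => /andP[sl sr].
  have := f_ge t (lexx _) sl sr.
  have := f_le t (lexx _) s0N (ltW s0_gt0).
  have := f0 t; rewrite ler_norml => /andP[+ _].
  rewrite /gn; lra.
have := linear_ode_periodic_le L0 T0 pn dn gnM x.
by rewrite ler_pM2l// lerNl.
Qed.

Let k := (L - l) / L.

(** The map s -> L s + f s x has difference quotients in [0, L - l]. Since y1 - y2 solves the linear
    equation driven by the difference of the two sources, the maximum principle gives the ratio (L -
    l) / L. *)
Let step_contr s1 s2 y1 y2 (D : R) : adm s1 -> adm s2 -> step s1 y1 -> step s2 y2 ->
  (forall x, `|s1 x - s2 x| <= D) -> forall x, `|y1 x - y2 x| <= k * D.
Proof.
have half a1 a2 z1 z2 : adm a1 -> adm a2 -> step a1 z1 -> step a2 z2 ->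
    (forall x, `|a1 x - a2 x| <= D) -> forall x, z1 x - z2 x <= k * D.
  move=> [_ _ b1] [_ _ b2] [[_ p1 _] d1] [[_ p2 _] d2] aD x.
  rewrite /k mulrAC ler_pdivlMr// mulrC.
  apply: (@linear_ode_periodic_le L _ T (fun t => z1 t - z2 t) (fun t =>
    (L * a1 t + f (a1 t) t) - (L * a2 t + f (a2 t) t))) => //.
  - by move=> t; rewrite p1 p2.
  - by move=> t; apply: (is_derive_eq (is_deriveBfun (d1 t) (d2 t))); ring.
  - move=> t; have := b1 t; rewrite ler_norml => /andP[l1 r1].
    have := b2 t; rewrite ler_norml => /andP[l2 r2].
    have := aD t; rewrite ler_norml => /andP[al ar].
    have D0 : 0 <= D by exact: le_trans (aD t).
    have [a12|/ltW a12] := leP (a1 t) (a2 t).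
      have := f_ge t l1 a12 r2.
      have : 0 <= (L - l) * D by rewrite mulr_ge0// subr_ge0.
      lra.
    have := f_le t l2 a12 r1.
    have : (L - l) * (a1 t - a2 t) <= (L - l) * D by rewrite ler_wpM2l// subr_ge0.
    lra.
move=> a1 a2 h1 h2 D12 x; rewrite ler_norml; apply/andP; split.
  rewrite lerNl opprB; apply: (half _ _ _ _ a2 a1 h2 h1) => t.
  by rewrite distrC.
exact: (half _ _ _ _ a1 a2 h1 h2).
Qed.

Lemma periodic_ode_solution : exists s : R -> R,
  [/\ periodic s T, forall x, `|s x| <= s0 &
      forall x : R, is_derive x (1 : R) s (f (s x) x)].
Proof.
have k0 : 0 <= k by rewrite /k divr_ge0 ?subr_ge0// ltW.
have k1 : k < 1 by rewrite /k ltr_pdivrMr// mul1r ltrBlDr ltrDl.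
have /choice[F hF] s : exists y, adm s -> step s y.
  have [/step_ex[y hy]|ns] := pselect (adm s); first by exists y.
  by exists s.
pose u n := iter n F (fun=> 0).
have au n : adm (u n).
  elim: n => [|n IH]; last by have [] := hF _ IH.
  split=> [|//|x /=]; first exact: cst_continuous.
  by rewrite normr0 ltW.
have uD m n x : `|u (m + n)%N x - u n x| <= 2 * s0 * k ^+ n.
  elim: n x => [|n IH] x.
    rewrite expr0 mulr1 addn0; apply: le_trans (ler_normB _ _) _.
    have [_ _ /(_ x)] := au m; have [_ _ /(_ x)] := au 0%N.
    lra.
  rewrite addnS exprS mulrCA.
  exact: (step_contr (au _) (au _) (hF _ (au _)) (hF _ (au _)) IH).
have uM m n x : u m x - 2 * s0 * k ^+ m <= u n x + 2 * s0 * k ^+ n.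
  have e0 j : 0 <= 2 * s0 * k ^+ j by rewrite mulr_ge0 ?exprn_ge0// mulr_ge0// ltW.
  have := e0 m; have := e0 n.
  have [mn|/ltnW mn] := leqP m n.
    by have := uD (n - m)%N m x; rewrite subnK// ler_norml => /andP[]; lra.
  by have := uD (m - n)%N n x; rewrite subnK// ler_norml => /andP[]; lra.
(* By [uM] every lower bound u n x - 2 s0 k^n is below every upper bound u m x + 2 s0 k^m, so the
   supremum of the former is the limit, with an explicit rate. *)
pose S x := [set u n x - 2 * s0 * k ^+ n | n in [set: nat]].
pose v x := sup (S x).
have Sne x : S x !=set0 by exists (u 0%N x - 2 * s0 * k ^+ 0), 0%N.
have uv n x : `|u n x - v x| <= 2 * s0 * k ^+ n.
  rewrite ler_norml; apply/andP; split.
    suff : v x <= u n x + 2 * s0 * k ^+ n by lra.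
    apply: ge_sup => // _ [m _ <-]; exact: uM.
  suff : u n x - 2 * s0 * k ^+ n <= v x by lra.
  apply: ub_le_sup; last by exists n.
  by exists (u 0%N x + 2 * s0 * k ^+ 0) => _ [m _ <-]; exact: uM.
have ek (d : R) : 0 < d -> exists n, 2 * s0 * k ^+ n < d.
  move=> d0; have c0 : 0 < 2 * s0 by rewrite mulr_gt0.
  have : (fun n => k ^+ n) @ \oo --> (0 : R) by apply: cvg_expr; rewrite ger0_norm.
  move=> /cvgr_lt/(_ _ (divr_gt0 d0 c0))[n _ /(_ n (leqnn n))/= H].
  by exists n; rewrite mulrC -ltr_pdivlMr.
have zero (a : R) : (forall n, a <= 2 * s0 * k ^+ n) -> a <= 0.
  move=> H; rewrite leNgt; apply/negP => /ek[n].
  by rewrite ltNge H.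
have cv : continuous v.
  by apply: (uniform_limit_continuous _ uv ek) => n; have [] := au n.
have vT : periodic v T.
  move=> x; rewrite /v; congr sup; apply: eq_imagel => n _ /=.
  by have [_ ->] := au n.
have vb x : `|v x| <= s0.
  rewrite -subr_le0; apply: zero => n.
  have -> : v x = u n x - (u n x - v x) by ring.
  have := ler_normB (u n x) (u n x - v x).
  by have [_ _ /(_ x)] := au n; have := uv n x; lra.
have av : adm v by [].
have [[cFv _ _] dFv] := hF _ av.
suff Fv x : F v x = v x.
  exists v; split=> // x; have := dFv x; rewrite Fv => H.
  have -> : v = F v by apply/funext => z; rewrite Fv.
  by apply: (is_derive_eq H); rewrite Fv; ring.
(* The factor 2 pays for two errors of size 2 s0 k^n: from F v to F (u n), and from u n.+1 to v. *)
suff : `|F v x - v x| / 2 <= 0.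
  by rewrite pmulr_lle0 ?invr_gt0// normr_le0 subr_eq0 => /eqP.
apply: zero => n.
set e := 2 * s0 * k ^+ n.
have e0 : 0 <= e by rewrite mulr_ge0 ?exprn_ge0// mulr_ge0// ltW.
have ke : k * e <= e by rewrite ler_piMl// ltW.
have H1 : `|F v x - F (u n) x| <= e.
  apply: le_trans ke; apply: (step_contr av (au n) (hF _ av) (hF _ (au n))).
  by move=> t; rewrite distrC; exact: uv.
have H2 : `|F (u n) x - v x| <= e.
  by apply: le_trans ke; rewrite /e mulrCA -exprS; exact: (uv n.+1 x).
rewrite ler_pdivrMr// mulr_natr mulr2n -(subrKA (F (u n) x)).
by apply: le_trans (ler_normD _ _) _; rewrite lerD.
Qed.

End periodic_ode.

(** * Polar coordinates *)

Section polar.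
Context {R : realType}.
Implicit Types (x y t c : R).

Lemma unit_circle_angle x y : x ^+ 2 + y ^+ 2 = 1 ->
  exists t, x = cos t /\ y = sin t.
Proof.
move=> xy; have x1 : -1 <= x <= 1.
  by apply/andP; split; nra.
have cx : cos (acos x) = x by rewrite acosK// in_itv.
have sx : sin (acos x) = `|y|.
  by rewrite sin_acos// -xy [_ + y ^+ 2]addrC addrK sqrtr_sqr.
have [y0|/ltW y0] := leP 0 y; first by exists (acos x); rewrite cx sx ger0_norm.
by exists (- acos x); rewrite cosN sinN cx sx ler0_norm// opprK.
Qed.

Lemma nonzero_polar x y : 0 < x ^+ 2 + y ^+ 2 ->
  exists r t, [/\ 0 < r, x = r * cos t & y = r * sin t].
Proof.
move=> xy0; set r := Num.sqrt (x ^+ 2 + y ^+ 2).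
have r0 : 0 < r by rewrite sqrtr_gt0.
have r2 : r ^+ 2 = x ^+ 2 + y ^+ 2 by rewrite sqr_sqrtr// ltW.
have [|t [xt yt]] := @unit_circle_angle (x / r) (y / r).
  by rewrite !expr_div_n -mulrDl r2 divff// gt_eqF.
by exists r, t; split => //; rewrite -?xt -?yt mulrC divfK// gt_eqF.
Qed.

(** The angle h is defined by integrating the angular velocity w. Let p and o be the components of
    (g1, g2) along and across the direction h. Both solve u' = q u, with q the logarithmic rate of
    the modulus, so o stays 0 and p stays positive. *)
Lemma polar_lift (g1 g2 a1 a2 : R -> R) :
  (forall t, is_derive t (1 : R) g1 (a1 t)) ->
  (forall t, is_derive t (1 : R) g2 (a2 t)) ->
  continuous a1 -> continuous a2 ->
  (forall t, 0 < g1 t ^+ 2 + g2 t ^+ 2) ->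
  exists r h : R -> R, [/\ forall t, 0 < r t,
    forall t, g1 t = r t * cos (h t) /\ g2 t = r t * sin (h t),
    forall t, is_derive t (1 : R) r (a1 t * cos (h t) + a2 t * sin (h t)) &
    forall t, is_derive t (1 : R) h
      ((a2 t * cos (h t) - a1 t * sin (h t)) / r t)].
Proof.
move=> d1 d2 ca1 ca2 g0.
have cg1 : continuous g1 by move=> t; exact: is_derive_continuous (d1 t).
have cg2 : continuous g2 by move=> t; exact: is_derive_continuous (d2 t).
have n0 t : g1 t ^+ 2 + g2 t ^+ 2 != 0 by rewrite gt_eqF.
have cn : continuous (fun t => (g1 t ^+ 2 + g2 t ^+ 2)^-1).
  by apply: continuousVfun => //; apply: continuousDfun; exact: continuousXfun.
pose w t := (g1 t * a2 t - g2 t * a1 t) * (g1 t ^+ 2 + g2 t ^+ 2)^-1.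
pose q t := (g1 t * a1 t + g2 t * a2 t) * (g1 t ^+ 2 + g2 t ^+ 2)^-1.
have cw : continuous w.
  by apply: continuousMfun cn; apply: continuousBfun; exact: continuousMfun.
have cq : continuous q.
  by apply: continuousMfun cn; apply: continuousDfun; exact: continuousMfun.
have [H dH] := continuous_antiderivative cw.
have [B dB] := continuous_antiderivative cq.
have [r0 [t0 [r00 x0 y0]]] := nonzero_polar (g0 0).
pose h t := H t - H 0 + t0.
have dh t : is_derive t (1 : R) h (w t).
  apply: (is_derive_eq (is_deriveDfun (is_deriveBfun (dH t)
    (is_derive_cstfun (H 0) t)) (is_derive_cstfun t0 t))).
  by rewrite subr0 addr0.
pose p t := g1 t * cos (h t) + g2 t * sin (h t).
pose o t := g2 t * cos (h t) - g1 t * sin (h t).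
have dc t : is_derive t (1 : R) (fun t => cos (h t)) (- sin (h t) * w t).
  exact: is_derive_compfun (is_derive_cos _) (dh t).
have ds t : is_derive t (1 : R) (fun t => sin (h t)) (cos (h t) * w t).
  exact: is_derive_compfun (is_derive_sin _) (dh t).
have a1E t : a1 t = q t * g1 t - w t * g2 t.
  by rewrite /q /w; field.
have a2E t : a2 t = q t * g2 t + w t * g1 t.
  by rewrite /q /w; field.
have dp t : is_derive t (1 : R) p (a1 t * cos (h t) + a2 t * sin (h t) + w t * o t).
  apply: (is_derive_eq (is_deriveDfun (is_deriveMfun (d1 t) (dc t))
    (is_deriveMfun (d2 t) (ds t)))).
  by rewrite /o; ring.
have do_ t : is_derive t (1 : R) o (a2 t * cos (h t) - a1 t * sin (h t) - w t * p t).
  apply: (is_derive_eq (is_deriveBfun (is_deriveMfun (d2 t) (dc t))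
    (is_deriveMfun (d1 t) (ds t)))).
  by rewrite /p; ring.
have de t : is_derive t (1 : R) (fun t => expR (- B t)) (- q t * expR (- B t)).
  apply: (is_derive_eq (is_derive_compfun (is_derive_expR _) (is_deriveNfun (dB t)))).
  by rewrite mulrC.
have cst u (du : R -> R) : (forall t, is_derive t (1 : R) u (du t)) ->
    (forall t, du t = q t * u t) -> forall t, u t = u 0 * expR (B t - B 0).
  move=> d duE t.
  have : u t * expR (- B t) = u 0 * expR (- B 0).
    apply: (@is_derive_0_is_cst _ (fun s => u s * expR (- B s)) t 0) => x.
    apply: (is_derive_eq (is_deriveMfun (d x) (de x))).
    by rewrite duE; ring.
  rewrite expRD mulrCA => /(congr1 (fun z => z * expR (B t))).
  by rewrite -mulrA -expRD addNr expR0 mulr1 => ->; ring.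
have h0 : h 0 = t0 by rewrite /h subrr add0r.
have o0 : o 0 = 0 by rewrite /o h0 x0 y0; ring.
have p0 : p 0 = r0.
  rewrite /p h0 x0 y0 -[RHS]mulr1 -(cos2Dsin2 t0); ring.
have oE t : o t = 0.
  rewrite (cst _ _ do_) ?o0 ?mul0r// => {}t.
  by rewrite a1E a2E /o /p; ring.
have pE t : p t = r0 * expR (B t - B 0).
  rewrite (cst _ _ dp) ?p0// => {}t.
  by rewrite a1E a2E /o /p; ring.
have p_gt0 t : 0 < p t by rewrite pE mulr_gt0 ?expR_gt0.
have g1E t : g1 t = p t * cos (h t).
  transitivity (p t * cos (h t) - o t * sin (h t)); last by rewrite oE mul0r subr0.
  by rewrite -[LHS]mulr1 -(cos2Dsin2 (h t)) /p /o; ring.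
have g2E t : g2 t = p t * sin (h t).
  transitivity (p t * sin (h t) + o t * cos (h t)); last by rewrite oE mul0r addr0.
  by rewrite -[LHS]mulr1 -(cos2Dsin2 (h t)) /p /o; ring.
exists p, h; split => // t.
- by apply: (is_derive_eq (dp t)); rewrite oE mulr0 addr0.
- apply: (is_derive_eq (dh t)).
  have : a2 t * cos (h t) - a1 t * sin (h t) = w t * p t.
    rewrite a1E a2E g1E g2E -[w t * p t]mulr1 -(cos2Dsin2 (h t)); ring.
  by move=> ->; rewrite mulfK// gt_eqF.
Qed.

Lemma continuous_surj (f : R -> R) : continuous f ->
  (forall v, exists a b, f a <= v <= f b) -> forall v, exists x, f x = v.
Proof.
move=> cf H v; have [a [b /andP[av vb]]] := H v.
have within a' b' : {within `[a', b'], continuous f} by exact: continuous_subspaceT.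
have [ab|/ltW ba] := leP a b.
  have [|c _ cv] := @IVT _ f a b v ab (within _ _); last by exists c.
  by rewrite minEle maxEle (le_trans av vb) av.
have [|c _ cv] := @IVT _ f b a v ba (within _ _); last by exists c.
by rewrite minEle maxEle; case: ifPn => [ba'|_]; rewrite ?av ?vb// (le_trans ba' av) (le_trans vb ba').
Qed.

Lemma derive_ge_pos_surj (f f' : R -> R) c : 0 < c ->
  (forall x, is_derive x (1 : R) f (f' x)) -> (forall x, c <= f' x) ->
  forall v, exists x, f x = v.
Proof.
move=> c0 df fc; apply: continuous_surj.
  by move=> x; exact: is_derive_continuous (df x).
pose k x := f x - c * x.
have dk x : is_derive x (1 : R) k (f' x - c).
  apply: (is_derive_eq (is_deriveBfun (df x)
    (is_deriveMfun (is_derive_cstfun c x) (is_derive_idfun x)))).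
  by rewrite mul0r add0r mulr1.
have k0 x : 0 <= f' x - c by rewrite subr_ge0.
move=> v; pose x := `|v - f 0| / c.
have x0 : 0 <= x by rewrite divr_ge0// ltW.
have cx : c * x = `|v - f 0| by rewrite mulrC divfK// gt_eqF.
have := derive_ge0_ndecr dk k0 x0; rewrite /k mulr0 subr0 cx.
have Nx0 : - x <= 0 by rewrite oppr_le0.
have := derive_ge0_ndecr dk k0 Nx0; rewrite /k mulr0 subr0 mulrN cx.
have := ler_norm (v - f 0); have := ler_norm (- (v - f 0)); rewrite normrN.
by move=> *; exists (- x), x; apply/andP; split; lra.
Qed.

Lemma shift_surj (f : R -> R) p c : continuous f -> 0 < c ->
  (forall x, f (x + p) = f x + c) -> forall v, exists x, f x = v.
Proof.
move=> cf c0 fp; apply: continuous_surj => // v.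
have fn n : f (p *+ n) = f 0 + c *+ n.
  by elim: n => [|n IH]; rewrite ?mulr0n ?addr0// !mulrSr fp IH addrA.
have fNn n : f (- p *+ n) = f 0 - c *+ n.
  elim: n => [|n IH]; first by rewrite !mulr0n subr0.
  have := fp (- p *+ n.+1); rewrite {1}mulrSr addrNK IH => /eqP.
  by rewrite -subr_eq => /eqP <-; rewrite mulrSr; ring.
pose n := Num.bound (`|v - f 0| / c).
have nb : `|v - f 0| < c *+ n.
  rewrite -mulr_natl -ltr_pdivrMr//; apply: archi_boundP.
  by rewrite divr_ge0// ltW.
exists (- p *+ n), (p *+ n); rewrite fn fNn.
have H1 := ler_norm (v - f 0); have H2 := ler_norm (- (v - f 0)).
rewrite normrN in H2.
by apply/andP; split; lra.
Qed.

Lemma derive_pos_inverse (f f' : R -> R) :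
  (forall x, is_derive x (1 : R) f (f' x)) -> (forall x, 0 < f' x) ->
  (forall v, exists x, f x = v) ->
  exists g : R -> R, [/\ cancel f g, cancel g f &
    forall v, is_derive v (1 : R) g (f' (g v))^-1].
Proof.
move=> df f0 fs.
have inc x y : x < y -> f x < f y.
  move=> xy; have [|c _ e] := MVT xy (fun x _ => df x).
    by apply: continuous_subspaceT => z; exact: is_derive_continuous (df z).
  by rewrite -subr_gt0 e mulr_gt0// subr_gt0.
have finj : injective f.
  move=> x y fxy; case: (ltgtP x y) => // /inc; by rewrite fxy ltxx.
have [g gK] := choice fs.
have fK : cancel f g by move=> x; apply: finj; rewrite gK.
exists g; split => // v.
have near1 : {near g v, cancel f g} by near=> x; exact: fK.
have near2 : {near g v, continuous f}.
  by near=> x; exact: is_derive_continuous (df x).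
have := is_derive_inverse near1 near2 (df (g v)); rewrite gK; apply.
by rewrite gt_eqF.
Unshelve. all: by end_near. Qed.

End polar.

(** * Limit cycles in a thin ring *)

Section planar_field.
Context {R : realType}.
Variable F : R * R -> R * R.

Definition polar (r t : R) : R * R := (r * cos t, r * sin t).

Definition radial (r t : R) : R :=
  (F (polar r t)).1 * cos t + (F (polar r t)).2 * sin t.

Definition angular (r t : R) : R :=
  (F (polar r t)).2 * cos t - (F (polar r t)).1 * sin t.

Variables (m dm : R -> R) (s1 l L c : R).
Let T : R := pi *+ 2.

Definition ring_radius (s t : R) : R := 1 + s * m t.

(* The slope ds/dt of the orbits in the coordinates (s, t). *)
Definition ring_slope (s t : R) : R :=
  (ring_radius s t * radial (ring_radius s t) t / angular (ring_radius s t) t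
   - s * dm t) / m t.

Hypothesis cF1 : continuous (fun z => (F z).1).
Hypothesis cF2 : continuous (fun z => (F z).2).
Hypothesis m_bounds : forall t, 1 / 3 <= m t <= 3.
Hypothesis mT : periodic m T.
Hypothesis dmT : periodic dm T.
Hypothesis der_m : forall t : R, is_derive t (1 : R) m (dm t).
Hypothesis dm_cont : continuous dm.
Hypothesis s1_gt0 : 0 < s1.
Hypothesis s1_small : s1 <= 1 / 6.
Hypothesis l_gt0 : 0 < l.
Hypothesis lL : l <= L.
Hypothesis c_gt0 : 0 < c.
Hypothesis ang_ge : forall s t, `|s| <= s1 -> c <= angular (ring_radius s t) t.
Hypothesis slope_le : forall s2 s3 t, - s1 <= s3 -> s3 <= s2 -> s2 <= s1 ->
  ring_slope s2 t - ring_slope s3 t <= - l * (s2 - s3).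
Hypothesis slope_ge : forall s2 s3 t, - s1 <= s3 -> s3 <= s2 -> s2 <= s1 ->
  - L * (s2 - s3) <= ring_slope s2 t - ring_slope s3 t.
(** The factor 1 / 10 leaves room: a solution with |s| <= s1 / 10 has |r - 1| <= 3 s1 / 10 because m
    <= 3, so its curve lies strictly inside the annulus of half-width s1 / 3. *)
Hypothesis slope0 : forall t, `|ring_slope 0 t| <= l * (s1 / 10).

Let m_gt0 t : 0 < m t.
Proof. by have /andP[+ _] := m_bounds t; apply: lt_le_trans; rewrite divr_gt0. Qed.

Let m_neq0 t : m t != 0. Proof. by rewrite gt_eqF. Qed.

Let cm : continuous m. Proof. by move=> t; exact: is_derive_continuous (der_m t). Qed.

Let rad_bounds s t : `|s| <= s1 -> 1 / 2 <= ring_radius s t <= 3 / 2.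
Proof.
rewrite ler_norml => /andP[sl sr]; have /andP[ml mr] := m_bounds t.
have sl' : - (1 / 6) <= s by apply: le_trans sl; rewrite lerN2.
have := ler_wpM2r (ltW (m_gt0 t)) sl'.
have := ler_wpM2r (ltW (m_gt0 t)) (le_trans sr s1_small).
by rewrite /ring_radius => H1 H2; apply/andP; split; lra.
Qed.

Let rad_gt0 s t : `|s| <= s1 -> 0 < ring_radius s t.
Proof. by move=> H; have /andP[+ _] := rad_bounds t H; apply: lt_le_trans; rewrite divr_gt0. Qed.

Let ang_gt0 s t : `|s| <= s1 -> 0 < angular (ring_radius s t) t.
Proof. by move=> /(ang_ge t); exact: lt_le_trans. Qed.

Let ang_neq0 s t : `|s| <= s1 -> angular (ring_radius s t) t != 0.
Proof. by move=> /(ang_gt0 t)/gt_eqF ->. Qed.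

Let polarT r t : polar r (t + T) = polar r t.
Proof. by rewrite /polar cosD2pi sinD2pi. Qed.

Let radT s t : ring_radius s (t + T) = ring_radius s t.
Proof. by rewrite /ring_radius mT. Qed.

Let radialT r t : radial r (t + T) = radial r t.
Proof. by rewrite /radial polarT cosD2pi sinD2pi. Qed.

Let angularT r t : angular r (t + T) = angular r t.
Proof. by rewrite /angular polarT cosD2pi sinD2pi. Qed.

Let slopeT s t : ring_slope s (t + T) = ring_slope s t.
Proof. by rewrite /ring_slope radT radialT angularT mT dmT. Qed.

Let continuous_polar (r : R -> R) : continuous r -> continuous (fun t => polar (r t) t).
Proof.
move=> cr; apply: continuous_pairfun; apply: (continuousMfun cr).
  exact: continuous_cos.
exact: continuous_sin.
Qed.

Let continuous_F1 (r : R -> R) : continuous r ->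
  continuous (fun t => (F (polar (r t) t)).1).
Proof.
move=> cr t; apply: (@continuous_comp _ _ _ (fun t => polar (r t) t) (fun z => (F z).1)).
  exact: continuous_polar.
exact: cF1.
Qed.

Let continuous_F2 (r : R -> R) : continuous r ->
  continuous (fun t => (F (polar (r t) t)).2).
Proof.
move=> cr t; apply: (@continuous_comp _ _ _ (fun t => polar (r t) t) (fun z => (F z).2)).
  exact: continuous_polar.
exact: cF2.
Qed.

Let continuous_radial (r : R -> R) : continuous r ->
  continuous (fun t => radial (r t) t).
Proof.
move=> cr; apply: continuousDfun; apply: continuousMfun.
- exact: continuous_F1.
- exact: continuous_cos.
- exact: continuous_F2.
- exact: continuous_sin.
Qed.

Let continuous_angular (r : R -> R) : continuous r ->
  continuous (fun t => angular (r t) t).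
Proof.
move=> cr; apply: continuousBfun; apply: continuousMfun.
- exact: continuous_F2.
- exact: continuous_cos.
- exact: continuous_F1.
- exact: continuous_sin.
Qed.

Let continuous_rad (s : R -> R) : continuous s ->
  continuous (fun t => ring_radius (s t) t).
Proof.
move=> cs; apply: continuousDfun; first exact: continuous_cstfun.
exact: continuousMfun.
Qed.

Let continuous_slope (s : R -> R) : continuous s -> (forall t, `|s t| <= s1 / 10) ->
  continuous (fun t => ring_slope (s t) t).
Proof.
move=> cs sb; have cr := continuous_rad cs.
have sb' t : `|s t| <= s1 by apply: le_trans (sb t) _; move: s1_gt0; lra.
apply: continuousMfun; last exact: continuousVfun.
apply: continuousBfun; last exact: continuousMfun.
apply: continuousMfun.
  by apply: continuousMfun => //; exact: continuous_radial.
exact: (continuousVfun (continuous_angular cr) (fun t => ang_neq0 t (sb' t))).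
Qed.

(* In the annulus [U] of half-width s1/3 every radius is some
   [ring_radius s t] with |s| <= s1, since m >= 1/3. *)
Let U : set (R * R) := [set z | (1 - s1 / 3) ^+ 2 < z.1 ^+ 2 + z.2 ^+ 2 /\
                               z.1 ^+ 2 + z.2 ^+ 2 < (1 + s1 / 3) ^+ 2].

Let open_U : open U.
Proof.
pose n (z : R * R) := z.1 ^+ 2 + z.2 ^+ 2.
have cn : continuous n.
  apply: continuousDfun; apply: continuousXfun => z.
    exact: cvg_fst.
  exact: cvg_snd.
rewrite (_ : U = n @^-1` (`](1 - s1 / 3) ^+ 2, (1 + s1 / 3) ^+ 2[)%classic).
  by apply: open_comp => // z _; exact: cn.
apply/seteqP; split => z; rewrite /= in_itv/= /n.
  by move=> [-> ->].
by move=> /andP[].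
Qed.

Let U_radius r t : 0 < r -> U (polar r t) -> `|(r - 1) / m t| <= s1.
Proof.
move=> r0; rewrite /U /polar/= !exprMn -mulrDr cos2Dsin2 mulr1 => -[lr rr].
have l1 : 1 - s1 / 3 < r.
  by rewrite -(@ltr_pXn2r _ 2)// ?nnegrE ?ltW//; move: s1_small; lra.
have r1 : r < 1 + s1 / 3.
  by rewrite -(@ltr_pXn2r _ 2)// ?nnegrE ?ltW//; move: s1_gt0; lra.
rewrite normrM normfV (gtr0_norm (m_gt0 t)) ler_pdivrMr//.
have /andP[ml _] := m_bounds t.
apply: (@le_trans _ _ (s1 * (1 / 3))); last by rewrite ler_pM2l.
by rewrite ler_norml; apply/andP; split; lra.
Qed.

Section periodic_slope_solution.
Variable s : R -> R.
Hypothesis sT : periodic s T.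
Hypothesis s_small : forall t, `|s t| <= s1 / 10.
Hypothesis ds : forall t : R, is_derive t (1 : R) s (ring_slope (s t) t).

Let s_le t : `|s t| <= s1.
Proof. by apply: le_trans (s_small t) _; move: s1_gt0; lra. Qed.

Let cs : continuous s. Proof. by move=> t; exact: is_derive_continuous (ds t). Qed.

Let rho t := ring_radius (s t) t.
Let Z t := polar (rho t) t.

Let drho (t : R) : is_derive t (1 : R) rho (rho t * radial (rho t) t / angular (rho t) t).
Proof.
apply: (is_derive_eq (is_deriveDfun (is_derive_cstfun 1 t)
  (is_deriveMfun (ds t) (der_m t)))).
by rewrite /ring_slope -/(rho t) add0r mulrVK ?unitfE// subrK.
Qed.

(** The angle of g increases at a definite speed, so g is a graph S over the angle. The squared
    difference D^2 between S and s decays at rate k; being bounded for all negative times as well,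
    it must be 0. *)
Let solution_stays g : solution F g -> (forall t, U (g t)) -> range g = range Z.
Proof.
move=> sg Ug.
have d1 t : is_derive t (1 : R) (fst \o g) (F (g t)).1 by have [] := sg t.
have d2 t : is_derive t (1 : R) (snd \o g) (F (g t)).2 by have [] := sg t.
have cg : continuous g.
  rewrite (_ : g = fun t => ((fst \o g) t, (snd \o g) t)); last first.
    by apply/funext => u /=; case: (g u).
  apply: continuous_pairfun => t.
    exact: (is_derive_continuous (d1 t)).
  exact: (is_derive_continuous (d2 t)).
have ca1 : continuous (fun t => (F (g t)).1).
  by move=> t; apply: (@continuous_comp _ _ _ g (fun z => (F z).1)); [exact: cg|exact: cF1].
have ca2 : continuous (fun t => (F (g t)).2).
  by move=> t; apply: (@continuous_comp _ _ _ g (fun z => (F z).2)); [exact: cg|exact: cF2].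
have n0 t : 0 < (fst \o g) t ^+ 2 + (snd \o g) t ^+ 2.
  by have [+ _] := Ug t; apply: le_lt_trans; exact: sqr_ge0.
have [r [h [r0 gE dr dh]]] := polar_lift d1 d2 ca1 ca2 n0.
have gP t : g t = polar (r t) (h t).
  by have [] := gE t; rewrite /polar /=; case: (g t) => a b /= -> ->.
pose S t := (r t - 1) / m (h t).
have S1 t : `|S t| <= s1 by apply: U_radius => //; rewrite -gP.
have rS t : ring_radius (S t) (h t) = r t.
  by rewrite /ring_radius /S divfK// addrC subrK.
pose w t := angular (r t) (h t) / r t.
have wE t : ((F (g t)).2 * cos (h t) - (F (g t)).1 * sin (h t)) / r t = w t.
  by rewrite gP.
have rE t : (F (g t)).1 * cos (h t) + (F (g t)).2 * sin (h t) = radial (r t) (h t).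
  by rewrite gP.
(* The speed of the angle is angular / r, with angular >= c and r <= 3 / 2. *)
pose c' := c / 2.
have c'0 : 0 < c' by rewrite divr_gt0.
have wc t : c' <= w t.
  rewrite /w ler_pdivlMr//; have := ang_ge (h t) (S1 t); rewrite rS.
  apply: le_trans; have := rad_bounds (h t) (S1 t); rewrite rS => /andP[_].
  rewrite /c'; move: c_gt0; nra.
have h_surj : forall v, exists t, h t = v.
  apply: (derive_ge_pos_surj c'0 dh) => t; by rewrite wE.
have dS (t : R) : is_derive t (1 : R) S (w t * ring_slope (S t) (h t)).
  have dmh := is_derive_compfun (der_m (h t)) (dh t).
  have H := is_deriveMfun (is_deriveBfun (dr t) (is_derive_cstfun 1 t))
    (is_deriveVfun (m_neq0 (h t)) dmh).
  apply: (is_derive_eq H).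
  rewrite subr0 rE wE /ring_slope rS.
  have a0 : angular (r t) (h t) != 0 by rewrite -rS; exact: ang_neq0.
  have r0' : r t != 0 by rewrite gt_eqF.
  by rewrite /w /S; field; rewrite m_neq0 a0 r0'.
pose D t := S t - s (h t).
have dD (t : R) : is_derive t (1 : R) D
    (w t * (ring_slope (S t) (h t) - ring_slope (s (h t)) (h t))).
  have H := is_deriveBfun (dS t) (is_derive_compfun (ds (h t)) (dh t)).
  by apply: (is_derive_eq H); rewrite wE mulrBr [_ * w t]mulrC.
have DD t : D t * (w t * (ring_slope (S t) (h t) - ring_slope (s (h t)) (h t)))
    <= - (c' * l) * D t ^+ 2.
  have := S1 t; have := s_le (h t); rewrite !ler_norml => /andP[sl sr] /andP[Sl Sr].
  have cw : c' * l * D t ^+ 2 <= w t * l * D t ^+ 2.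
    by rewrite ler_wpM2r ?sqr_ge0// ler_wpM2r ?wc// ltW.
  have w0 : 0 < w t by exact: lt_le_trans (wc t).
  suff : w t * (D t * (ring_slope (S t) (h t) - ring_slope (s (h t)) (h t)))
       <= w t * (- l * D t ^+ 2) by lra.
  rewrite ler_pM2l//.
  have [Ss|/ltW Ss] := leP (s (h t)) (S t).
    have H := slope_le (h t) sl Ss Sr.
    have D0 : 0 <= D t by rewrite subr_ge0.
    by have := ler_wpM2l D0 H; rewrite /D; lra.
  have H := slope_le (h t) Sl Ss sr.
  have D0 : 0 <= - D t by rewrite oppr_ge0 subr_le0.
  by have := ler_wpM2l D0 H; rewrite /D; lra.
pose k := 2 * (c' * l).
have k0 : 0 < k by rewrite !mulr_gt0.
pose E t := - (D t * D t * expR (k * t)).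
have dE (t : R) : is_derive t (1 : R) E (- ((2 * (D t * (w t * (ring_slope (S t) (h t) -
    ring_slope (s (h t)) (h t)))) + k * D t ^+ 2) * expR (k * t))).
  have H := is_deriveNfun (is_deriveMfun (is_deriveMfun (dD t) (dD t))
    (is_derive_compfun (is_derive_expR (k * t))
      (is_deriveMfun (is_derive_cstfun k t) (is_derive_idfun t)))).
  by apply: (is_derive_eq H); ring.
have E0 t : 0 <= - ((2 * (D t * (w t * (ring_slope (S t) (h t) -
    ring_slope (s (h t)) (h t)))) + k * D t ^+ 2) * expR (k * t)).
  rewrite oppr_ge0 mulr_le0_ge0 ?expR_ge0//.
  by have := DD t; rewrite /k; lra.
have Einc := derive_ge0_ndecr dE E0.
have D1 t : D t * D t <= 1.
  have := S1 t; have := s_le (h t); rewrite !ler_norml => /andP[sl sr] /andP[Sl Sr].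
  by have := s1_small; rewrite /D; nra.
have D0 t : D t = 0.
  apply/eqP; apply/negPn/negP => Dn0.
  have a0 : 0 < D t * D t by rewrite -expr2 exprn_even_gt0.
  (* Going back by y multiplies D^2 by at least expR (k y) >= 1 + 1 / D^2, which exceeds the bound
     D^2 <= 1 at time t - y. *)
  pose y := 1 / (D t * D t) / k.
  have y0 : 0 < y by rewrite !divr_gt0.
  have ty : t - y <= t by rewrite lerBlDr lerDl ltW.
  have := Einc _ _ ty; rewrite /E lerN2 leNgt => /negP; apply.
  apply: (@le_lt_trans _ _ (1 * expR (k * (t - y)))).
    by rewrite ler_wpM2r ?expR_ge0.
  rewrite mul1r mulrBr expRD mulrC ltr_pM2r ?expR_gt0// expRN.
  rewrite invf_plt ?posrE ?expR_gt0//.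
  have ky : k * y = (D t * D t)^-1 by rewrite /y mulrC divfK ?gt_eqF// div1r.
  rewrite ky; apply: lt_le_trans (expR_ge1Dx _).
  by rewrite ltrDr.
have gZ t : g t = Z (h t).
  rewrite gP /Z /rho; congr polar; rewrite -rS; congr ring_radius.
  by apply/eqP; rewrite -subr_eq0 -/(D t) D0.
apply/seteqP; split => [_ [t _ <-]|_ [v _ <-]].
  by exists (h t); rewrite ?gZ.
by have [t <-] := h_surj v; exists t; rewrite ?gZ.
Qed.

Let Z_U t : U (Z t).
Proof.
rewrite /U /Z /polar/= !exprMn -mulrDr cos2Dsin2 mulr1.
have := s_small t; rewrite ler_norml => /andP[sl sr].
have /andP[ml mr] := m_bounds t.
have [rl rr] : 1 - s1 / 3 < rho t /\ rho t < 1 + s1 / 3.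
  by rewrite /rho /ring_radius; split; move: s1_gt0; nra.
by split; rewrite ltr_pXn2r// ?nnegrE; move: s1_small s1_gt0; lra.
Qed.

(** [Z] is parametrized by the angle. The time tau, a primitive of 1 / w, gains a fixed amount P per
    turn; its inverse h expresses the angle in terms of time, and Z (h t) is a solution of period
    P. *)
Let orbit_Z : periodic_orbit F (range Z).
Proof.
pose w t := angular (rho t) t / rho t.
have rho0 t : 0 < rho t by exact: rad_gt0.
have w0 t : 0 < w t by rewrite divr_gt0// ang_gt0.
have cw : continuous w.
  apply: continuousMfun; first by apply: continuous_angular; exact: continuous_rad.
  have rn0 t : rho t != 0 by rewrite gt_eqF.
  exact: (continuousVfun (continuous_rad cs) rn0).
have wn0 t : w t != 0 by rewrite gt_eqF.
have [tau dtau] := continuous_antiderivative (continuousVfun cw wn0).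
have rhoT t : rho (t + T) = rho t by rewrite /rho sT radT.
have wT t : w (t + T) = w t by rewrite /w rhoT angularT.
have iw0 t : 0 < (w t)^-1 by rewrite invr_gt0.
pose P := tau T - tau 0.
have tauT t : tau (t + T) = tau t + P.
  pose k u := tau (u + T) - tau u.
  have dk (u : R) : is_derive u (1 : R) k 0.
    have H := @is_derive_compfun _ tau (fun u => u + T) u _ _ (dtau (u + T))
      (is_deriveDfun (is_derive_idfun u) (is_derive_cstfun T u)).
    by apply: (is_derive_eq (is_deriveBfun H (dtau u))); rewrite wT addr0 mulr1 subrr.
  have := is_derive_0_is_cst t 0 dk.
  by rewrite /k /P add0r => e; rewrite -e; ring.
have T0 : 0 < T by rewrite /T pmulrn_rgt0// pi_gt0.
have P0 : 0 < P.
  have [|d _ e] := MVT T0 (fun x _ => dtau x).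
    by apply: continuous_subspaceT => z; exact: is_derive_continuous (dtau z).
  by rewrite /P e subr0 mulr_gt0.
have ctau : continuous tau by move=> t; exact: is_derive_continuous (dtau t).
have [h [hK tK dh]] := derive_pos_inverse dtau iw0 (shift_surj ctau P0 tauT).
have dh' (t : R) : is_derive t (1 : R) h (w (h t)).
  by apply: (is_derive_eq (dh t)); rewrite invrK.
have hP t : h (t + P) = h t + T by rewrite -{1}(tK t) -tauT hK.
exists (fun t => Z (h t)); split.
- move=> t; have drh := is_derive_compfun (drho (h t)) (dh' t).
  have dch := is_derive_compfun (is_derive_cos (h t)) (dh' t).
  have dsh := is_derive_compfun (is_derive_sin (h t)) (dh' t).
  have a0 : angular (rho (h t)) (h t) != 0 by exact: ang_neq0.
  have r0 : rho (h t) != 0 by rewrite gt_eqF.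
  have E : rho (h t) * radial (rho (h t)) (h t) / angular (rho (h t)) (h t) * w (h t)
      = radial (rho (h t)) (h t).
    by rewrite /w; field; rewrite a0 r0.
  have E2 : rho (h t) * w (h t) = angular (rho (h t)) (h t) by rewrite mulrC /w divfK.
  split.
    apply: (is_derive_eq (is_deriveMfun drh dch)).
    rewrite E mulrCA E2 -[RHS]mulr1 -(cos2Dsin2 (h t)) /radial /angular -/(Z (h t)).
    by ring.
  apply: (is_derive_eq (is_deriveMfun drh dsh)).
  rewrite E mulrCA E2 -[RHS]mulr1 -(cos2Dsin2 (h t)) /radial /angular -/(Z (h t)).
  by ring.
- exists P => // t; rewrite hP /Z rhoT polarT //.
(* At the angles 0 and pi the first coordinates have opposite signs. *)
- exists (tau 0), (tau pi); rewrite !hK /Z /polar cos0 cospi mulr1 mulrN1 => -[e _].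
  by move: (rho0 0) (rho0 pi); rewrite e; lra.
- apply/seteqP; split => [_ [t _ <-]|_ [t _ <-]]; last by exists (h t).
  by exists (tau t); rewrite /= ?hK.
Qed.

Lemma limit_cycle_of_slope_solution : limit_cycle F (range Z) /\
  forall z, range Z z -> z.1 ^+ 2 + z.2 ^+ 2 <= 4.
Proof.
split.
  split; first exact: orbit_Z.
  exists U; split; first exact: open_U.
    by move=> _ [t _ <-]; exact: Z_U.
  move=> C' [g [sg _ _ ->]] gU; apply: solution_stays => // t.
  by apply: gU; exists t.
move=> _ [t _ <-]; rewrite /Z /polar/= !exprMn -mulrDr cos2Dsin2 mulr1.
have /andP[r1 r2] := rad_bounds t (s_le t).
by rewrite -/(rho t) in r1 r2; nra.
Qed.

End periodic_slope_solution.

(** Nonemptiness and the bound on the size serve later to tell apart the cycles found around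
    different grid points. *)
Lemma planar_limit_cycle : exists C, [/\ limit_cycle F C, C !=set0 &
  forall z, C z -> z.1 ^+ 2 + z.2 ^+ 2 <= 4].
Proof.
have T0 : 0 < T by rewrite /T pmulrn_rgt0// pi_gt0.
have s0 : 0 < s1 / 10 by rewrite divr_gt0.
have le10 : s1 / 10 <= s1 by move: s1_gt0; lra.
have leN10 : - s1 <= - (s1 / 10) by rewrite lerN2.
have [||s [sT sb ds]] := @periodic_ode_solution _ ring_slope T (s1 / 10) l L
    T0 s0 l_gt0 lL slopeT continuous_slope _ _ slope0.
- by move=> s2 s3 t a b e; apply: slope_le => //; [exact: le_trans a|exact: le_trans le10].
- by move=> s2 s3 t a b e; apply: slope_ge => //; [exact: le_trans a|exact: le_trans le10].
have [lc bd] := limit_cycle_of_slope_solution sT sb ds.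
eexists; split; [exact: lc| |exact: bd].
by eexists; exists 0.
Qed.

End planar_field.

(** * A quadratic field with a hyperbolic limit cycle *)

Section slope_estimate.
Context {R : realType}.

Lemma ler_norm_div (x b a b' : R) : 0 < b' -> b' <= b -> `|x| <= a ->
  `|x / b| <= a / b'.
Proof.
move=> b'0 bb xa; have b0 : 0 < b by exact: lt_le_trans bb.
rewrite normrM normfV (gtr0_norm b0) ler_pM ?invr_ge0 ?(ltW b0)//.
by rewrite lef_pV2.
Qed.

Lemma ler_norm_prod (x y a b : R) : `|x| <= a -> `|y| <= b -> `|x * y| <= a * b.
Proof. by move=> xa yb; rewrite normrM ler_pM. Qed.

(** Here c and s stand for cos t and sin t, and A / B is dr/dt along an orbit of the quadratic field
    with radial and angular perturbations p and q. Without perturbation its derivative in r at r = 1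
    is - c / (2 - c): A has derivative - c / 2 there, A vanishes and B = 1 - c / 2. *)
Lemma quotient_slope_estimate (k c s r1 r2 p1 p2 q1 q2 : R) :
  0 < k -> k <= 1 / 100 -> `|c| <= 1 -> `|s| <= 1 ->
  `|r1 - 1| <= k -> `|r2 - 1| <= k -> r2 <= r1 ->
  `|p1| <= k -> `|p2| <= k -> `|q1| <= k -> `|q2| <= k ->
  `|p1 - p2| <= k * (r1 - r2) -> `|q1 - q2| <= k * (r1 - r2) ->
  let A r p := r * (p - c * (r ^+ 2 - 1) / 4) in
  let B r q := r * (1 - r * c / 2) + s * (r ^+ 2 - 1) / 4 + q in
  [/\ 1 / 4 <= B r1 q1, 1 / 4 <= B r2 q2 &
   `|A r1 p1 / B r1 q1 - A r2 p2 / B r2 q2 + c / (2 - c) * (r1 - r2)|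
     <= 212 * k * (r1 - r2)].
Proof.
move=> k0 k1 c1 s1 d1 d2 r12 hp1 hp2 hq1 hq2 hp hq A B.
set D := r1 - r2; have D0 : 0 <= D by rewrite subr_ge0.
have rb r : `|r - 1| <= k -> `|r| <= 101 / 100.
  by rewrite !ler_norml => /andP[a b]; apply/andP; split; lra.
have r2b r : `|r - 1| <= k -> `|r ^+ 2 - 1| <= 201 / 100 * k.
  move=> h; have -> : r ^+ 2 - 1 = (r + 1) * (r - 1) by ring.
  apply: ler_norm_prod => //; move: h.
  by rewrite !ler_norml => /andP[a b]; apply/andP; split; lra.
have Bb r q : `|r - 1| <= k -> `|q| <= k -> `|B r q - (1 - c / 2)| <= 5 * k.
  move=> h hq'.
  have -> : B r q - (1 - c / 2) = (r - 1) + (s / 4 - c / 2) * (r ^+ 2 - 1) + q.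
    by rewrite /B; field.
  have sc : `|s / 4 - c / 2| <= 1.
    by move: s1 c1; rewrite !ler_norml => /andP[? ?] /andP[? ?]; apply/andP; split; lra.
  have := ler_norm_prod sc (r2b _ h); rewrite mul1r.
  move: h hq'; rewrite !ler_norml => /andP[? ?] /andP[? ?] /andP[? ?].
  by apply/andP; split; lra.
have c2 : 1 / 2 <= 1 - c / 2 by move: c1; rewrite ler_norml => /andP[? ?]; lra.
have Bl r q : `|r - 1| <= k -> `|q| <= k -> 1 / 4 <= B r q.
  by move=> h h'; have := Bb _ _ h h'; rewrite ler_norml => /andP[? ?]; lra.
have B1 := Bl _ _ d1 hq1; have B2 := Bl _ _ d2 hq2; split=> //.
have Ab : `|A r2 p2| <= 3 * k.
  have cc : `|c / 4| <= 1 / 4 by move: c1; rewrite !ler_norml => /andP[? ?]; apply/andP; split; lra.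
  have := ler_norm_prod cc (r2b _ d2) => H.
  have H2 : `|p2 - c * (r2 ^+ 2 - 1) / 4| <= 2 * k.
    rewrite mulrAC; apply: le_trans (ler_normB _ _) _; lra.
  have := ler_norm_prod (rb _ d2) H2; rewrite /A; lra.
have hA : `|A r1 p1 - A r2 p2 + c / 2 * D| <= 12 * k * D.
  have -> : A r1 p1 - A r2 p2 + c / 2 * D =
     - (c / 4) * ((r1 ^+ 2 - 1) + (r1 - 1) + (r2 - 1) * r1 + (r2 ^+ 2 - 1)) * D
     + r1 * (p1 - p2) + p2 * D by rewrite /A /D; field.
  have cc : `|- (c / 4)| <= 1 / 4.
    by rewrite normrN; move: c1; rewrite !ler_norml => /andP[? ?]; apply/andP; split; lra.
  have H : `|(r1 ^+ 2 - 1) + (r1 - 1) + (r2 - 1) * r1 + (r2 ^+ 2 - 1)| <= 8 * k.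
    have := ler_norm_prod d2 (rb _ d1); have := r2b _ d1; have := r2b _ d2.
    move: d1; rewrite !ler_norml => /andP[? ?] /andP[? ?] /andP[? ?] /andP[? ?].
    by apply/andP; split; lra.
  have DD : `|D| <= D by rewrite ger0_norm.
  have := ler_norm_prod (ler_norm_prod cc H) DD.
  have := ler_norm_prod (rb _ d1) hp; have := ler_norm_prod hp2 DD.
  rewrite -/D; have kD : 0 <= k * D by rewrite mulr_ge0// ltW.
  rewrite !ler_norml => /andP[? ?] /andP[? ?] /andP[? ?].
  by apply/andP; split; lra.
have hB : `|B r1 q1 - B r2 q2| <= 3 * D.
  have -> : B r1 q1 - B r2 q2 = (1 + (s / 4 - c / 2) * (r1 + r2)) * D + (q1 - q2).
    by rewrite /B /D; field.
  have sc : `|s / 4 - c / 2| <= 3 / 4.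
    by move: s1 c1; rewrite !ler_norml => /andP[? ?] /andP[? ?]; apply/andP; split; lra.
  have rr : `|r1 + r2| <= 202 / 100.
    by apply: le_trans (ler_normD _ _) _; have := rb _ d1; have := rb _ d2; lra.
  have H : `|1 + (s / 4 - c / 2) * (r1 + r2)| <= 26 / 10.
    by apply: le_trans (ler_normD _ _) _; rewrite normr1; have := ler_norm_prod sc rr; lra.
  have DD : `|D| <= D by rewrite ger0_norm.
  apply: le_trans (ler_normD _ _) _; have := ler_norm_prod H DD.
  have kD : k * D <= 1 / 100 * D by rewrite ler_wpM2r.
  move: hq; rewrite -/D; lra.
have n1 : B r1 q1 != 0 by rewrite gt_eqF//; apply: lt_le_trans B1; rewrite divr_gt0.
have n2 : B r2 q2 != 0 by rewrite gt_eqF//; apply: lt_le_trans B2; rewrite divr_gt0.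
have n3 : 2 - c != 0 by rewrite gt_eqF//; lra.
set b0 := 1 - c / 2.
(* The three errors come from linearizing A, from replacing B by its value b0 on the unit circle,
   and from the variation of B. They are at most 48, 20 and 144 times k D, whence 212. *)
have -> : A r1 p1 / B r1 q1 - A r2 p2 / B r2 q2 + c / (2 - c) * D =
    (A r1 p1 - A r2 p2 + c / 2 * D) / B r1 q1
    + (c / 2 * D * (B r1 q1 - b0)) / (b0 * B r1 q1)
    - A r2 p2 * (B r1 q1 - B r2 q2) / (B r1 q1 * B r2 q2).
  have b00 : b0 = (2 - c) / 2 by rewrite /b0; field.
  by rewrite b00; field; rewrite n1 n2 n3.
have q4 : (0 : R) < 1 / 4 by rewrite divr_gt0.
have H1 := ler_norm_div q4 B1 hA.
have c2' : `|c / 2| <= 1 / 2 by move: c1; rewrite !ler_norml => /andP[? ?]; apply/andP; split; lra.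
have DD : `|D| <= D by rewrite ger0_norm.
have q8 : (0 : R) < 1 / 8 by rewrite divr_gt0.
have q16 : (0 : R) < 1 / 16 by rewrite divr_gt0.
have b8 : 1 / 8 <= b0 * B r1 q1.
  apply: (@le_trans _ _ (1 / 2 * (1 / 4))); first lra.
  by apply: ler_pM => //; rewrite divr_ge0.
have b16 : 1 / 16 <= B r1 q1 * B r2 q2.
  apply: (@le_trans _ _ (1 / 4 * (1 / 4))); first lra.
  by apply: ler_pM => //; rewrite divr_ge0.
have H2 := ler_norm_div q8 b8 (ler_norm_prod (ler_norm_prod c2' DD) (Bb _ _ d1 hq1)).
have H3 := ler_norm_div q16 b16 (ler_norm_prod Ab hB).
apply: le_trans (ler_normB _ _) _.
apply: le_trans (lerD (ler_normD _ _) (lexx _)) _.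
apply: le_trans (lerD (lerD H1 H2) H3) _.
rewrite -/b0; lra.
Qed.

(** One has - c / (2 - c) = - c / 2 - c^2 / 4 - c^3 / (4 (2 - c)). For c = cos t, the first two
    terms have mean - 1 / 8 over a turn, and the derivative of [width_exponent] cancels their
    oscillating part. What remains is at most - 1 / 8 + 1 / 12, attained at c = - 1. *)
Lemma mean_slope_bounds (c : R) : `|c| <= 1 ->
  - 3 <= c / 2 + (2 * c ^+ 2 - 1) / 8 - c / (2 - c) <= - (1 / 24).
Proof.
rewrite ler_norml => /andP[cl cr]; have c2 : 0 < 2 - c by lra.
have n : 2 - c != 0 by rewrite gt_eqF.
have -> : c / 2 + (2 * c ^+ 2 - 1) / 8 - c / (2 - c) =
    - (1 / 8) - c ^+ 3 / 4 / (2 - c) by field.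
apply/andP; split.
  suff : c ^+ 3 / 4 / (2 - c) <= 1 by lra.
  rewrite ler_pdivrMr// mul1r.
  have : c ^+ 3 <= 1.
    have -> : c ^+ 3 = c * c ^+ 2 by ring.
    have : 0 <= c ^+ 2 by rewrite sqr_ge0.
    nra.
  lra.
suff : - (1 / 12) <= c ^+ 3 / 4 / (2 - c) by lra.
rewrite ler_pdivlMr//.
(* The product is 3 c^3 - c + 2, the inequality c^3 / 4 >= - (2 - c) / 12 with denominators
   cleared. *)
have : 0 <= (c + 1) * (3 * c ^+ 2 - 3 * c + 2).
  by rewrite mulr_ge0; [by []|lra|nra].
have -> : c ^+ 3 = c * c * c by ring.
lra.
Qed.

End slope_estimate.

Section perturbed_quadratic_field.
Context {R : realType}.

(* The unit circle is invariant under (quad1, quad2) since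
   x quad1 + y quad2 = - x (x^2 + y^2 - 1) / 4. *)
Definition quad1 (x y : R) : R := - y * (1 - x / 2) - (x ^+ 2 + y ^+ 2 - 1) / 4.
Definition quad2 (x y : R) : R := x * (1 - x / 2).

(* The width of the ring is modulated so that the slope ds/dt contracts
   pointwise, and not only on average over a turn. *)
Definition width_exponent (t : R) : R := (2 * sin t + sin t * cos t / 2) / 4.
Definition width (t : R) : R := expR (- width_exponent t).
Definition dwidth (t : R) : R :=
  - (cos t / 2 + (2 * cos t ^+ 2 - 1) / 8) * width t.

Lemma width_bounds t : 1 / 3 <= width t <= 3.
Proof.
have e : `|width_exponent t| <= 5 / 8.
  have := sin_max t; have := cos_max t => hc hs.
  have := ler_norm_prod hs hc; move: hs hc; rewrite /width_exponent !ler_norml.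
  by move=> /andP[? ?] /andP[? ?] /andP[? ?]; apply/andP; split; lra.
move: e; rewrite ler_norml => /andP[e1 e2]; apply/andP; split.
  by have := expR_ge1Dx (- width_exponent t); rewrite /width; lra.
rewrite /width expRN -[3]invrK lef_pV2 ?posrE ?expR_gt0 ?invr_gt0//.
by have := expR_ge1Dx (width_exponent t); lra.
Qed.

Lemma widthT : periodic width (pi *+ 2).
Proof. by move=> t; rewrite /width /width_exponent cosD2pi sinD2pi. Qed.

Lemma dwidthT : periodic dwidth (pi *+ 2).
Proof. by move=> t; rewrite /dwidth widthT cosD2pi. Qed.

Lemma is_derive_width (t : R) : is_derive t (1 : R) width (dwidth t).
Proof.
have ds := is_derive_sin t; have dc := is_derive_cos t.
have H := @is_derive_compfun _ expR (fun t => - width_exponent t) t _ _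
  (is_derive_expR (- width_exponent t))
  (is_deriveNfun (is_deriveMfun (is_deriveDfun
    (is_deriveMfun (is_derive_cstfun 2 t) ds)
    (is_deriveMfun (is_deriveMfun ds dc) (is_derive_cstfun (2^-1) t)))
    (is_derive_cstfun (4^-1) t))).
apply: (is_derive_eq H); rewrite /dwidth -/(width t).
have s2 : sin t * - sin t = cos t ^+ 2 - 1 by rewrite mulrN -expr2 sin2cos2; ring.
rewrite s2 mulrC; congr (_ * _).
by field.
Qed.

Lemma continuous_dwidth : continuous dwidth.
Proof.
have cw : continuous width by move=> t; exact: is_derive_continuous (is_derive_width t).
apply: continuousMfun => //; apply: continuousNfun.
have cc : continuous (@cos R) by exact: continuous_cos.
apply: continuousDfun; apply: continuousMfun => //; try exact: continuous_cstfun.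
apply: continuousBfun; last exact: continuous_cstfun.
by apply: continuousMfun; [exact: continuous_cstfun|exact: continuousXfun].
Qed.

(** The bounds are along rays only. The factor phi cancels in the slope, so c may be arbitrarily
    small without affecting eps; this matters because c will be of order 2^-d. *)
Definition quadratic_cycle_persists (eps : R) : Prop :=
  forall (F : R * R -> R * R) (phi E1 E2 : R -> R -> R) (c : R), 0 < c ->
  continuous (fun z => (F z).1) -> continuous (fun z => (F z).2) ->
  (forall r t, `|r - 1| <= 1 / 2 -> [/\ c <= phi r t,
     (F (polar r t)).1 = phi r t * (quad1 (r * cos t) (r * sin t) + E1 r t) &
     (F (polar r t)).2 = phi r t * (quad2 (r * cos t) (r * sin t) + E2 r t)]) ->
  (forall r t, `|r - 1| <= 1 / 2 -> `|E1 r t| <= eps /\ `|E2 r t| <= eps) ->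
  (forall r1 r2 t, `|r1 - 1| <= 1 / 2 -> `|r2 - 1| <= 1 / 2 -> r2 <= r1 ->
     `|E1 r1 t - E1 r2 t| <= eps * (r1 - r2) /\
     `|E2 r1 t - E2 r2 t| <= eps * (r1 - r2)) ->
  exists C, [/\ limit_cycle F C, C !=set0 &
    forall z, C z -> z.1 ^+ 2 + z.2 ^+ 2 <= 4].

Lemma perturbed_quadratic_limit_cycle :
  exists2 eps : R, 0 < eps & quadratic_cycle_persists eps.
Proof.
(* The error 212 k may consume half of the contraction rate 1 / 24. Since [width] is at most 3, s1 =
   k / 3 gives |r - 1| <= k. *)
have [k [k0 k1 k212]] : exists k : R, [/\ 0 < k, k <= 1 / 100 & 212 * k <= 1 / 48].
  by exists (1 / 100 / 200); split; lra.
pose s1 := k / 3.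
have s10 : 0 < s1 by rewrite divr_gt0.
(* The factor 2 bounds a combination of E1 and E2 by cosine and sine. At s = 0 the slope is at most
   2 eps divided by 1 / 4 (for B) and by 1 / 3 (for [width]), that is 24 eps. *)
have [eps [eps0 ek es]] : exists eps : R, [/\ 0 < eps, 2 * eps <= k &
    24 * eps <= 1 / 48 * (s1 / 10)].
  by exists (s1 / 100 / 200); split; rewrite ?divr_gt0//; rewrite /s1; move: k0; lra.
exists eps => // F phi E1 E2 c c0 cF1 cF2 hF hE hL.
have n1 (x y a b e : R) : `|a| <= 1 -> `|b| <= 1 -> `|x| <= e -> `|y| <= e ->
    `|a * x + b * y| <= 2 * e.
  move=> ha hb hx hy; apply: le_trans (ler_normD _ _) _.
  have := ler_norm_prod ha hx; have := ler_norm_prod hb hy; lra.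
have hc t : `|cos t : R| <= 1 by exact: cos_max.
have hs t : `|sin t : R| <= 1 by exact: sin_max.
have hsN t : `|- sin t : R| <= 1 by rewrite normrN.
pose p r t := cos t * E1 r t + sin t * E2 r t.
pose q r t := - sin t * E1 r t + cos t * E2 r t.
pose rad := ring_radius width.
have rad1 s t : `|s| <= s1 -> `|rad s t - 1| <= k.
  move=> hs1; rewrite /rad /ring_radius addrC addKr.
  have /andP[w1 w2] := width_bounds t.
  have hw : `|width t| <= 3 by rewrite ger0_norm// (le_trans _ w1)// divr_ge0.
  by have := ler_norm_prod hs1 hw; rewrite /s1 divfK.
have khalf r : `|r - 1| <= k -> `|r - 1| <= 1 / 2.
  by move=> h; apply: (le_trans h); apply: (le_trans k1); lra.
have hp r t : `|r - 1| <= k -> `|p r t| <= k.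
  by move=> /khalf/(hE _ t)[? ?]; apply: le_trans ek; exact: n1.
have hq r t : `|r - 1| <= k -> `|q r t| <= k.
  by move=> /khalf/(hE _ t)[? ?]; apply: le_trans ek; exact: n1.
pose A (c r p : R) := r * (p - c * (r ^+ 2 - 1) / 4).
pose B (c s r q : R) := r * (1 - r * c / 2) + s * (r ^+ 2 - 1) / 4 + q.
have radE r t : `|r - 1| <= k ->
    radial F r t = phi r t * (p r t - cos t * (r ^+ 2 - 1) / 4).
  move=> /khalf/(hF _ t)[_ e1 e2]; rewrite /radial e1 e2 /quad1 /quad2 /p.
  have -> : r ^+ 2 - 1 = (r * cos t) ^+ 2 + (r * sin t) ^+ 2 - 1.
    by rewrite !exprMn -mulrDr cos2Dsin2 mulr1.
  by field.
have angE r t : `|r - 1| <= k ->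
    angular F r t = phi r t * B (cos t) (sin t) r (q r t).
  move=> /khalf/(hF _ t)[_ e1 e2]; rewrite /angular e1 e2 /quad1 /quad2 /q /B.
  have -> : r * (1 - r * cos t / 2) =
      r * (1 - r * cos t / 2) * (cos t ^+ 2 + sin t ^+ 2) by rewrite cos2Dsin2 mulr1.
  have -> : r ^+ 2 - 1 = (r * cos t) ^+ 2 + (r * sin t) ^+ 2 - 1.
    by rewrite !exprMn -mulrDr cos2Dsin2 mulr1.
  by field.
have phi0 r t : `|r - 1| <= k -> 0 < phi r t.
  by move=> /khalf/(hF _ t)[+ _ _]; exact: lt_le_trans.
have est s2 s3 t : - s1 <= s3 -> s3 <= s2 -> s2 <= s1 ->
   let r1 := rad s2 t in let r2 := rad s3 t in
  [/\ 1 / 4 <= B (cos t) (sin t) r1 (q r1 t), 1 / 4 <= B (cos t) (sin t) r2 (q r2 t) &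
   `|A (cos t) r1 (p r1 t) / B (cos t) (sin t) r1 (q r1 t)
     - A (cos t) r2 (p r2 t) / B (cos t) (sin t) r2 (q r2 t)
     + cos t / (2 - cos t) * (r1 - r2)|
     <= 212 * k * (r1 - r2)].
  move=> a1 a2 a3 r1 r2.
  have b2 : `|s2| <= s1 by rewrite ler_norml a3 (le_trans a1).
  have b3 : `|s3| <= s1 by rewrite ler_norml a1 (le_trans a2).
  have R1 := rad1 _ t b2; have R2 := rad1 _ t b3.
  have r21 : r2 <= r1.
    have /andP[w1 _] := width_bounds t.
    by rewrite /r1 /r2 /rad /ring_radius lerD2l ler_wpM2r// (le_trans _ w1)// divr_ge0.
  have [l1 l2] := hL _ _ t (khalf _ R1) (khalf _ R2) r21.
  have ekD : 2 * (eps * (r1 - r2)) <= k * (r1 - r2).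
    by rewrite mulrA ler_wpM2r// subr_ge0.
  apply: quotient_slope_estimate => //; rewrite ?hp ?hq//.
  - apply: le_trans ekD; rewrite /p.
    have -> : cos t * E1 r1 t + sin t * E2 r1 t - (cos t * E1 r2 t + sin t * E2 r2 t)
      = cos t * (E1 r1 t - E1 r2 t) + sin t * (E2 r1 t - E2 r2 t) by ring.
    exact: n1.
  - apply: le_trans ekD; rewrite /q.
    have -> : - sin t * E1 r1 t + cos t * E2 r1 t - (- sin t * E1 r2 t + cos t * E2 r2 t)
      = - sin t * (E1 r1 t - E1 r2 t) + cos t * (E2 r1 t - E2 r2 t) by ring.
    exact: n1.
have Bge s t : `|s| <= s1 -> 1 / 4 <= B (cos t) (sin t) (rad s t) (q (rad s t) t).
  by rewrite ler_norml => /andP[a1 a2]; have [] := est s s t a1 (lexx _) a2.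
have w0 t : width t != 0 by rewrite gt_eqF// expR_gt0.
have slopeE s t : `|s| <= s1 -> ring_slope F width dwidth s t =
    (A (cos t) (rad s t) (p (rad s t) t) / B (cos t) (sin t) (rad s t) (q (rad s t) t))
      / width t + s * (cos t / 2 + (2 * cos t ^+ 2 - 1) / 8).
  move=> hs1; have r1 := rad1 _ t hs1.
  rewrite /ring_slope -/rad radE// angE// /dwidth /A.
  have B0 : B (cos t) (sin t) (rad s t) (q (rad s t) t) != 0.
    by rewrite gt_eqF//; apply: lt_le_trans (Bge _ t hs1); rewrite divr_gt0.
  have P0 : phi (rad s t) t != 0 by rewrite gt_eqF ?phi0.
  by field; rewrite w0 B0 P0.
have diff s2 s3 t : - s1 <= s3 -> s3 <= s2 -> s2 <= s1 ->
    `|ring_slope F width dwidth s2 t - ring_slope F width dwidth s3 t -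
      (cos t / 2 + (2 * cos t ^+ 2 - 1) / 8 - cos t / (2 - cos t)) * (s2 - s3)|
      <= 212 * k * (s2 - s3).
  move=> a1 a2 a3; have [_ _] := est s2 s3 t a1 a2 a3.
  have b2 : `|s2| <= s1 by rewrite ler_norml a3 (le_trans a1).
  have b3 : `|s3| <= s1 by rewrite ler_norml a1 (le_trans a2).
  rewrite (slopeE _ t b2) (slopeE _ t b3).
  have -> : rad s2 t - rad s3 t = (s2 - s3) * width t.
    by rewrite /rad /ring_radius; ring.
  set u2 := A _ _ _ / B _ _ _ _; set u3 := A _ _ _ / B _ _ _ _.
  have W0 : 0 < width t by exact: expR_gt0.
  move=> H.
  have -> : u2 / width t + s2 * (cos t / 2 + (2 * cos t ^+ 2 - 1) / 8) -
     (u3 / width t + s3 * (cos t / 2 + (2 * cos t ^+ 2 - 1) / 8)) -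
     (cos t / 2 + (2 * cos t ^+ 2 - 1) / 8 - cos t / (2 - cos t)) * (s2 - s3) =
     (u2 - u3 + cos t / (2 - cos t) * ((s2 - s3) * width t)) / width t.
    have c2 : 2 - cos t != 0 by rewrite gt_eqF//; have := cos_le1 t; lra.
    by field; rewrite w0 c2.
  apply: le_trans (ler_norm_div W0 (lexx _) H) _.
  by rewrite le_eqVlt; apply/orP; left; apply/eqP; field.
(* The rates are 1 / 24 - 1 / 48 and 3 + 1; c / 4 combines phi >= c with B >= 1 / 4. *)
apply: (@planar_limit_cycle _ F width dwidth s1 (1 / 48) 4 (c / 4)) => //.
- exact: width_bounds.
- exact: widthT.
- exact: dwidthT.
- exact: is_derive_width.
- exact: continuous_dwidth.
- by rewrite /s1; move: k1; lra.
- by lra.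
- by rewrite divr_gt0.
- move=> s t hs1; have r1 := rad1 _ t hs1; rewrite angE//.
  have [h _ _] := hF _ t (khalf _ r1).
  have h2 := Bge s t hs1.
  have -> : c / 4 = c * (1 / 4) by rewrite mul1r.
  by apply: ler_pM => //; rewrite ?divr_ge0// ltW.
- move=> s2 s3 t a1 a2 a3; have := diff _ _ t a1 a2 a3.
  have /andP[_ ml] := mean_slope_bounds (hc t).
  have D0 : 0 <= s2 - s3 by rewrite subr_ge0.
  have := ler_wpM2r D0 ml.
  rewrite ler_norml => H /andP[_ H2].
  have : 212 * k * (s2 - s3) <= 1 / 48 * (s2 - s3) by rewrite ler_wpM2r.
  lra.
- move=> s2 s3 t a1 a2 a3; have := diff _ _ t a1 a2 a3.
  have /andP[ml _] := mean_slope_bounds (hc t).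
  have D0 : 0 <= s2 - s3 by rewrite subr_ge0.
  have := ler_wpM2r D0 ml.
  rewrite ler_norml => H /andP[H2 _].
  have : 212 * k * (s2 - s3) <= 1 * (s2 - s3) by rewrite ler_wpM2r//; move: k212; lra.
  lra.
- move=> t; have z0 : `|0 : R| <= s1 by rewrite normr0 ltW.
  rewrite slopeE// mul0r addr0.
  have r0 : rad 0 t = 1 by rewrite /rad /ring_radius mul0r addr0.
  have := Bge 0 t z0; rewrite r0 => B1.
  have -> : A (cos t) 1 (p 1 t) = p 1 t by rewrite /A expr1n subrr mulr0 mul0r subr0 mul1r.
  have p1 : `|p 1 t| <= 2 * eps.
    have : `|1 - 1 : R| <= 1 / 2 by rewrite subrr normr0 divr_ge0.
    by move=> /(hE _ t)[? ?]; exact: n1.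
  have q4 : (0 : R) < 1 / 4 by rewrite divr_gt0.
  have q3 : (0 : R) < 1 / 3 by rewrite divr_gt0.
  have /andP[w1 _] := width_bounds t.
  apply: le_trans (ler_norm_div q3 w1 (ler_norm_div q4 B1 p1)) _.
  by move: es; lra.
Qed.

End perturbed_quadratic_field.

(** * Affine changes of coordinates *)

Section affine_conjugation.
Context {R : realType}.
Variables (F : R * R -> R * R) (z0 : R * R) (k : R).
Hypothesis k0 : 0 < k.

Definition rescale (u : R * R) : R * R := (z0.1 + k * u.1, z0.2 + k * u.2).

Let unscale (z : R * R) : R * R := (k^-1 * (z.1 - z0.1), k^-1 * (z.2 - z0.2)).

Let kn0 : k != 0. Proof. by rewrite gt_eqF. Qed.

Let rescaleK : cancel rescale unscale.
Proof. by move=> [a b]; rewrite /rescale /unscale/= ![_ + k * _]addrC !addrK !mulKf. Qed.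

Let unscaleK : cancel unscale rescale.
Proof. by move=> [a b]; rewrite /rescale /unscale/= !mulVKf// ![_ + (_ - _)]addrC !subrK. Qed.

Let G u := F (rescale u).

Let dlin (c t : R) : is_derive t (1 : R) (fun t => c * t) c.
Proof.
apply: (is_derive_eq (is_deriveMfun (is_derive_cstfun c t) (is_derive_idfun t))).
by rewrite mul0r add0r mulr1.
Qed.

(** F composed with [rescale] is not divided by k, so time has to be slowed down by the factor k. *)
Let solution_rescale h : solution G h -> solution F (fun t => rescale (h (k^-1 * t))).
Proof.
move=> sh t; have [d1 d2] := sh (k^-1 * t).
have d1' := @is_derive_compfun _ (fst \o h) (fun t => k^-1 * t) t _ _ d1 (dlin k^-1 t).
have d2' := @is_derive_compfun _ (snd \o h) (fun t => k^-1 * t) t _ _ d2 (dlin k^-1 t).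
split.
  apply: (is_derive_eq (is_deriveDfun (is_derive_cstfun z0.1 t)
    (is_deriveMfun (is_derive_cstfun k t) d1'))).
  by rewrite mul0r !add0r mulrC mulfVK.
apply: (is_derive_eq (is_deriveDfun (is_derive_cstfun z0.2 t)
  (is_deriveMfun (is_derive_cstfun k t) d2'))).
by rewrite mul0r !add0r mulrC mulfVK.
Qed.

Let solution_unscale g : solution F g -> solution G (fun t => unscale (g (k * t))).
Proof.
move=> sg t; have [d1 d2] := sg (k * t).
have d1' := @is_derive_compfun _ (fst \o g) (fun t => k * t) t _ _ d1 (dlin k t).
have d2' := @is_derive_compfun _ (snd \o g) (fun t => k * t) t _ _ d2 (dlin k t).
rewrite /G unscaleK; split.
  apply: (is_derive_eq (is_deriveMfun (is_derive_cstfun k^-1 t)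
    (is_deriveBfun d1' (is_derive_cstfun z0.1 t)))).
  by rewrite mul0r add0r subr0 mulrC mulfK.
apply: (is_derive_eq (is_deriveMfun (is_derive_cstfun k^-1 t)
  (is_deriveBfun d2' (is_derive_cstfun z0.2 t)))).
by rewrite mul0r add0r subr0 mulrC mulfK.
Qed.

Let periodic_orbit_rescale C : periodic_orbit G C -> periodic_orbit F (rescale @` C).
Proof.
move=> [h [sh [T T0 hT] [t [s hts]] ->]].
exists (fun t => rescale (h (k^-1 * t))); split.
- exact: solution_rescale.
- exists (k * T); first by rewrite mulr_gt0.
  by move=> u; rewrite mulrDr mulKf// hT.
- exists (k * t), (k * s); rewrite !mulKf// => /(can_inj rescaleK); exact: hts.
- apply/seteqP; split => [_ [_ [u _ <-] <-]|_ [u _ <-]].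
    by exists (k * u) => //; rewrite mulKf.
  by exists (h (k^-1 * u)) => //; exists (k^-1 * u).
Qed.

Let periodic_orbit_unscale C : periodic_orbit F C -> periodic_orbit G (unscale @` C).
Proof.
move=> [g [sg [T T0 gT] [t [s gts]] ->]].
exists (fun t => unscale (g (k * t))); split.
- exact: solution_unscale.
- exists (k^-1 * T); first by rewrite mulr_gt0 ?invr_gt0.
  by move=> u; rewrite mulrDr mulVKf// gT.
- exists (k^-1 * t), (k^-1 * s); rewrite !mulVKf// => /(can_inj unscaleK); exact: gts.
- apply/seteqP; split => [_ [_ [u _ <-] <-]|_ [u _ <-]].
    by exists (k^-1 * u) => //; rewrite mulVKf.
  by exists (g (k * u)) => //; exists (k * u).
Qed.

Lemma limit_cycle_rescale C :
  limit_cycle (fun u => F (rescale u)) C -> limit_cycle F (rescale @` C).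
Proof.
move=> [pC [U [oU CU UC]]]; split; first exact: periodic_orbit_rescale.
exists (unscale @^-1` U); split.
- have c1 : continuous (fst : R * R -> R) by move=> z; exact: cvg_fst.
  have c2 : continuous (snd : R * R -> R) by move=> z; exact: cvg_snd.
  have cU : continuous unscale.
    by apply: continuous_pairfun; apply: continuousMfun;
      [exact: continuous_cstfun | apply: continuousBfun; [|exact: continuous_cstfun]
      |exact: continuous_cstfun | apply: continuousBfun; [|exact: continuous_cstfun]].
  by apply: open_comp => // z _; exact: cU.
- by move=> _ [u Cu <-]; rewrite /preimage/= rescaleK; exact: CU.
- move=> C' pC' C'U.
  have <- : unscale @` C' = C.
    apply: UC; first exact: periodic_orbit_unscale.
    by move=> _ [z Cz <-]; exact: C'U.
  apply/seteqP; split => [z Cz|_ [_ [z Cz <-] <-]]; last by rewrite unscaleK.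
  by exists (unscale z); [exists z|rewrite unscaleK].
Qed.

End affine_conjugation.

(** * Shifting a Gaussian family *)

Section integral_against_law.
Context d d' (T : measurableType d) (T' : measurableType d') (R : realType).
Variables (mu : {measure set T -> \bar R}) (nu : {measure set T' -> \bar R}).
Variables (Y : T -> T') (g : T -> R) (phi : T' -> R).
Hypothesis mY : measurable_fun setT Y.
Hypothesis mg : measurable_fun setT g.
Hypothesis mphi : measurable_fun setT phi.
Hypothesis g0 : forall w, 0 <= g w.
Hypothesis phi0 : forall y, 0 <= phi y.
Hypothesis law : forall B, measurable B ->
  (\int[mu]_w (g w * \1_B (Y w))%:E = nu B)%E.

Import HBNNSimple.
Local Open Scope ereal_scope.

(** From indicators to nonnegative functions through increasing simple functions. The weight g
    allows two uses: as the normal density against Lebesgue measure, and as the product of the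
    factors of all other coordinates. *)
Lemma ge0_integral_law :
  \int[mu]_w (g w * phi (Y w))%:E = \int[nu]_y (phi y)%:E.
Proof.
have mphi' : measurable_fun setT (EFin \o phi) by exact/measurable_EFinP.
pose h := nnsfun_approx measurableT mphi'.
have ch y : EFin \o h ^~ y @ \oo --> (phi y)%:E.
  by apply: (@cvg_nnsfun_approx _ _ _ _ measurableT _ mphi') => // z _; rewrite lee_fin.
have nd y : {homo (fun n => h n y) : n m / (n <= m)%N >-> (n <= m)%R}.
  by move=> m n mn; exact/lefP/nd_nnsfun_approx.
have -> : \int[nu]_y (phi y)%:E = limn (fun n => \int[nu]_y (h n y)%:E).
  rewrite -monotone_convergence//.
  - by apply: eq_integral => y _; apply/esym/cvg_lim => //; exact: ch.
  - by move=> n; exact/measurable_EFinP.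
  - by move=> n y _; rewrite lee_fin.
  - by move=> y _ m n mn; rewrite lee_fin nd.
have -> : \int[mu]_w (g w * phi (Y w))%:E =
    limn (fun n => \int[mu]_w (g w * h n (Y w))%:E).
  rewrite -monotone_convergence//.
  - apply: eq_integral => w _; apply/esym/cvg_lim => //.
    under eq_fun do rewrite EFinM.
    by rewrite EFinM; apply: cvgeZl => //; exact: ch.
  - move=> n; apply/measurable_EFinP; apply: measurable_funM => //.
    exact: measurableT_comp.
  - by move=> n w _; rewrite lee_fin mulr_ge0.
  - by move=> w _ m n mn; rewrite lee_fin ler_wpM2l// nd.
congr (limn _); apply/funext => n.
have mind r : measurable_fun setT (fun w => \1_(h n @^-1` [set r]) (Y w) : R).
  by apply: measurableT_comp => //; exact: measurable_indic.
transitivity (\int[mu]_w (\sum_(y \in range (h n))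
    (y * (g w * \1_(h n @^-1` [set y]) (Y w)))%:E)).
  apply: eq_integral => w _; rewrite {1}(fimfunE (h n) (Y w)).
  rewrite mulr_fsumr -?fsumEFin//.
  by apply: eq_fsbigr => y _; rewrite mulrCA.
rewrite ge0_integral_fsum//; last 2 first.
- move=> r; apply/measurable_EFinP.
  by apply: measurable_funM => //; exact: measurable_funM.
- move=> r w _; rewrite lee_fin mulrCA mulr_ge0//.
  by have := @nnfun_muleindic_ge0 _ _ _ (h n) r (Y w); rewrite lee_fin.
transitivity (\int[nu]_y (\sum_(r \in range (h n))
    (r * \1_(h n @^-1` [set r]) y)%:E)); last first.
  by apply: eq_integral => y _; rewrite {1}(fimfunE (h n) y) -fsumEFin.
rewrite ge0_integral_fsum//; last 2 first.
- by move=> r; apply/measurable_EFinP; apply: measurable_funM.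
- by move=> r y _; exact: nnfun_muleindic_ge0.
apply: eq_fsbigr => r /[!inE] -[y _ <-].
under eq_integral do rewrite EFinM.
rewrite ge0_integralZl_EFin//; last 2 first.
- by move=> w _; rewrite lee_fin mulr_ge0.
- by apply/measurable_EFinP; exact: measurable_funM.
under [RHS]eq_integral do rewrite EFinM.
rewrite ge0_integralZl_EFin//; last by apply/measurable_EFinP.
by rewrite law// integral_indic// setIT.
Qed.

End integral_against_law.

Section normal_mgf.
Context {R : realType}.
Local Notation mu := (@lebesgue_measure R).

Lemma integral_expR_normal_prob (h : R) :
  (\int[normal_prob 0 1]_x (expR (h * x))%:E = (expR (h ^+ 2 / 2))%:E)%E.
Proof.
have mpdf : measurable_fun [set: R] (normal_pdf 0 1 : R -> R).
  exact: measurable_normal_pdf.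
have mexp : measurable_fun [set: R] (fun x : R => expR (h * x)).
  by apply: measurableT_comp => //; exact: measurable_funM.
have law (B : set R) : measurable B ->
    (\int[mu]_x (normal_pdf 0 1 x * \1_B x)%:E = normal_prob 0 1 B)%E.
  move=> mB; rewrite /normal_prob [RHS]integral_mkcond; apply: eq_integral => x _.
  by rewrite EFinM epatch_indic.
rewrite -(@ge0_integral_law _ _ _ _ R mu (normal_prob 0 1) id (normal_pdf 0 1)
  (fun x => expR (h * x)) (@measurable_id _ _ _) mpdf mexp (normal_pdf_ge0 _ _)
  (fun=> expR_ge0 _) law).
(* Completing the square turns the integrand into a multiple of the normal density centred at h. *)
transitivity (\int[mu]_x ((expR (h ^+ 2 / 2))%:E * (normal_pdf h 1 x)%:E))%E.
  apply: eq_integral => x _; rewrite -EFinM; congr EFin.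
  rewrite !normal_pdfE ?oner_neq0// mulrCA -mulrA; congr (_ * _).
  rewrite /normal_fun -!expRD; congr expR.
  by rewrite /= subr0 expr1n mulr2n; field.
rewrite ge0_integralZl_EFin ?expR_ge0//.
- by rewrite integral_normal_pdf mule1.
- by move=> x _; rewrite lee_fin normal_pdf_ge0.
- by apply/measurable_EFinP; exact: measurable_normal_pdf.
Qed.

Lemma fin_num_normal_prob (m s : R) (B : set R) : measurable B ->
  normal_prob m s B \is a fin_num.
Proof.
move=> mB; rewrite ge0_fin_numE//.
exact: le_lt_trans (probability_le1 (normal_prob m s) mB) (ltry _).
Qed.

End normal_mgf.

Section gaussian_family.
Context (disp : measure_display) (T : measurableType disp) (R : realType).
Variables (P : probability T R) (I : finType) (X : I -> {RV P >-> R}).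
Hypothesis indep : mutually_independent X.
Hypothesis normal : forall i, standard_normal (X i).

(** Independence is given for events only. This product interpolates between an indicator of a joint
    event, for s empty, and the exponential of a linear form, when s lists all of I. *)
Let mixed (h : I -> R) (B : I -> set R) (s : seq I) (w : T) : R :=
  (\prod_i (if i \in s then expR (h i * X i w) else \1_(B i) (X i w)))%R.

Let m_mixed h B s : (forall i, measurable (B i)) ->
  measurable_fun setT (mixed h B s).
Proof.
move=> mB; have mf i : measurable_fun setT
    (fun w => if i \in s then expR (h i * X i w) else \1_(B i) (X i w))%R.
  case: (i \in s); first by apply: measurableT_comp => //; exact: measurable_funM.
  by apply: measurableT_comp => //; exact: measurable_indic.
rewrite /mixed; apply: (@measurable_prod _ _ R setT _ _ (fun i w =>
  if i \in s then expR (h i * X i w) else \1_(B i) (X i w))%R) => i _.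
exact: mf.
Qed.

Let mixed_ge0 h B s w : (0 <= mixed h B s w)%R.
Proof.
by apply: prodr_ge0 => i _; case: ifP => _; rewrite ?expR_ge0// indicE.
Qed.

Let mass h (B : I -> set R) (s : seq I) (i : I) : R :=
  if i \in s then expR (h i ^+ 2 / 2) else fine (normal_prob 0 1 (B i)).

Let mass_ge0 h B s i : 0 <= mass h B s i.
Proof. by rewrite /mass; case: ifP => _; rewrite ?expR_ge0// fine_ge0. Qed.

(** Induction moves one coordinate j at a time. The hypothesis for all sets B j identifies the law
    of X j weighted by the other factors as a multiple of the normal law, against which the
    exponential can then be integrated. *)
Let integral_mixed h B s : (forall i, measurable (B i)) -> uniq s ->
  (\int[P]_w (mixed h B s w)%:E = (\prod_i mass h B s i)%:E)%E.
Proof.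
elim: s B => [|j s IH] B mB.
  move=> _.
  have mXB i : measurable (X i @^-1` B i) by exact: measurable_funPTI.
  transitivity (\int[P]_w (\1_(\bigcap_i (X i @^-1` B i)) w)%:E)%E.
    apply: eq_integral => w _; congr EFin; rewrite /mixed.
    rewrite (eq_bigr (fun i => (X i w \in B i)%:R)); last first.
      by move=> i _; rewrite indicE.
    rewrite indicE; case: (boolP (w \in _)) => [/set_mem H|H].
      by rewrite big1// => i _; rewrite mem_set//; exact: H.
    have [i Hi] : exists i, X i w \notin B i.
      apply: contrapT => nex; move/negP: H; apply; rewrite inE => i _ /=.
      by apply: contrapT => Hi; apply: nex; exists i; rewrite notin_setE.
    by rewrite (bigD1 i)//= (negbTE Hi) mul0r.
  rewrite integral_indic//; last first.
    by apply: fin_bigcap_measurable => // i _; exact: mXB.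
  rewrite setIT (big_morph EFin EFinM (erefl 1%E)).
  transitivity (\prod_i P (X i @^-1` B i))%E; first exact: indep.
  apply: eq_bigr => i _; rewrite /mass in_nil.
  have -> : P (X i @^-1` B i) = normal_prob 0 1 (B i) by rewrite -(normal i (mB i)).
  by rewrite fineK// fin_num_normal_prob.
move=> /= /andP[js us].
pose upd (Bj : set R) i := if i == j then Bj else B i.
have mupd Bj : measurable Bj -> forall i, measurable (upd Bj i).
  by move=> mBj i; rewrite /upd; case: ifP.
pose k := \prod_(i | i != j) mass h B (j :: s) i.
have k0 : 0 <= k by apply: prodr_ge0.
have kE Bj : \prod_(i | i != j) mass h (upd Bj) s i = k.
  by apply: eq_bigr => i ij; rewrite /mass in_cons (negbTE ij) /upd (negbTE ij).
have mixE Bj w : mixed h (upd Bj) s w = mixed h (upd setT) s w * \1_Bj (X j w).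
  rewrite /mixed (bigD1 j)//= [in RHS](bigD1 j)//= (negbTE js) /upd eqxx.
  rewrite indicT mul1r mulrC; congr (_ * _).
  by apply: eq_bigr => i ij; rewrite (negbTE ij).
pose nu := mscale (NngNum k0) (normal_prob (0 : R) 1).
have law (Bj : set R) : measurable Bj ->
    (\int[P]_w (mixed h (upd setT) s w * \1_Bj (X j w))%:E = nu Bj)%E.
  move=> mBj; under eq_integral do rewrite -mixE.
  rewrite (IH _ (mupd _ mBj) us) (bigD1 j)//= kE /mass (negbTE js) /upd eqxx.
  rewrite EFinM fineK; last exact: fin_num_normal_prob.
  by rewrite muleC.
transitivity (\int[P]_w (mixed h (upd setT) s w * expR (h j * X j w))%:E)%E.
  apply: eq_integral => w _; congr EFin.
  rewrite /mixed (bigD1 j)//= [in RHS](bigD1 j)//= in_cons eqxx (negbTE js) /upd eqxx.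
  rewrite indicT mul1r mulrC; congr (_ * _).
  by apply: eq_bigr => i ij; rewrite in_cons (negbTE ij).
have mexp : measurable_fun [set: R] (fun x : R => expR (h j * x)).
  by apply: measurableT_comp => //; exact: measurable_funM.
rewrite (@ge0_integral_law _ _ _ _ R P nu (X j) _ (fun x => expR (h j * x)))//.
- rewrite ge0_integral_mscale//; last exact/measurable_EFinP.
  rewrite integral_expR_normal_prob -EFinM; congr EFin.
  by rewrite [RHS](bigD1 j)//= mulrC /mass in_cons eqxx.
- move=> _ C mC; rewrite setTI; have := @measurable_funPTI _ _ _ _ (X j) C; apply; exact: mC.
- by apply: m_mixed; exact: mupd.
Qed.

Lemma gaussian_mgf (h : I -> R) :
  (\int[P]_w (expR (\sum_i h i * X i w))%:E =
   (expR ((\sum_i h i ^+ 2) / 2))%:E)%E.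
Proof.
have := @integral_mixed h (fun=> setT) (enum I) (fun=> measurableT) (enum_uniq I).
rewrite /mixed /mass => H.
under eq_integral do rewrite expR_sum.
transitivity (\int[P]_w (\prod_i
    (if i \in enum I then expR (h i * X i w) else \1_setT (X i w)))%:E)%E.
  by apply: eq_integral => w _; congr EFin; apply: eq_bigr => i _; rewrite mem_enum.
rewrite H; congr EFin; rewrite mulr_suml expR_sum.
by apply: eq_bigr => i _; rewrite mem_enum.
Qed.

End gaussian_family.

Section gaussian_shift.
Context (disp : measure_display) (T : measurableType disp) (R : realType).
Variables (P : probability T R) (I : finType) (X : I -> {RV P >-> R}).
Hypothesis indep : mutually_independent X.
Hypothesis normal : forall i, standard_normal (X i).

Let mlin (h : I -> R) (c : R) : measurable_fun setT (fun w => \sum_i h i * X i w + c).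
Proof.
apply: measurable_funD => //.
apply: (@measurable_sum _ _ R setT _ _ (fun i w => h i * X i w)) => i.
by apply: measurable_funM => //; exact: measurable_funPT.
Qed.

Lemma integral_expR_affine (h : I -> R) (c : R) :
  (\int[P]_w (expR (\sum_i h i * X i w + c))%:E =
   (expR ((\sum_i h i ^+ 2) / 2 + c))%:E)%E.
Proof.
under eq_integral do rewrite expRD mulrC EFinM.
rewrite ge0_integralZl_EFin ?expR_ge0//.
- by rewrite gaussian_mgf// -EFinM mulrC -expRD.
- apply/measurable_EFinP; apply: measurableT_comp => //.
  rewrite (_ : (fun w => _) = (fun w => \sum_i h i * X i w + 0)); first exact: mlin.
  by apply/funext => w; rewrite addr0.
Qed.

Variables (J : finType) (b : J -> I -> R) (tau : J -> R) (S : R) (v : I -> R).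
Hypothesis b1 : forall j, \sum_i b j i ^+ 2 = 1.
Hypothesis tau0 : forall j, 0 <= tau j.
Hypothesis S0 : 0 < S.
Hypothesis tauS : \sum_j tau j <= S.

(** Under the law of X + v each of the inner sums is a standard normal variable. Its mean absolute
    value is at most 2 expR (1 / 2) <= 4, so by Markov's inequality the threshold 8 S fails with
    probability at most 1 / 2. *)
Definition shift_event : set T :=
  [set w | \sum_j tau j * `|\sum_i b j i * (X i w - v i)| <= 8 * S].

Let dev j w := \sum_i b j i * X i w + - (\sum_i b j i * v i).

Let devE j w : \sum_i b j i * (X i w - v i) = dev j w.
Proof.
rewrite /dev -sumrN -big_split/=; apply: eq_bigr => i _; ring.
Qed.

Let shift_eventE : shift_event =
  [set w | \sum_j tau j * `|dev j w| <= 8 * S].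
Proof.
have e w : \sum_j tau j * `|\sum_i b j i * (X i w - v i)| = \sum_j tau j * `|dev j w|.
  by apply: eq_bigr => j _; rewrite devE.
by apply/seteqP; split => w; rewrite /shift_event/= e.
Qed.

Lemma measurable_shift_event : measurable shift_event.
Proof.
rewrite shift_eventE.
pose N w := \sum_j tau j * `|dev j w|.
have mN : measurable_fun setT N.
  apply: (@measurable_sum _ _ R setT _ _ (fun j w => tau j * `|dev j w|)) => j.
  by apply: measurable_funM => //; apply: measurableT_comp => //; exact: mlin.
rewrite (_ : [set _ | _] = N @^-1` `]-oo, 8 * S]%classic).
  by rewrite -[X in measurable X]setTI; exact: mN.
by apply/seteqP; split => w; rewrite /= in_itv/=.
Qed.

Let V := \sum_i v i ^+ 2.
(* The density of the law of X + v with respect to that of X. *)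
Let dens w := expR (\sum_i v i * X i w + - (V / 2)).
(** The square of [dens] has mean expR V, so the values of [dens] above A contribute at most 1 / 4
    to its integral. *)
Let A := 4 * expR V.

Let A0 : 0 < A. Proof. by rewrite mulr_gt0// expR_gt0. Qed.

(* If [dens w <= A] fails, then [dens w <= dens w ^+ 2 / A]; outside the event,
   Markov's inequality and |x| <= exp x + exp (- x) apply.  All the terms on the
   right but the first are moment generating functions. *)
Let pointwise w : dens w <= A * \1_shift_event w +
  (\sum_j (tau j / (8 * S)) * (dens w * expR (dev j w) + dens w * expR (- dev j w))
   + A^-1 * dens w ^+ 2).
Proof.
have d0 : 0 < dens w by exact: expR_gt0.
have S8 : 0 < 8 * S by rewrite mulr_gt0.
have nexp j : `|dev j w| <= expR (dev j w) + expR (- dev j w).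
  have := expR_ge1Dx (dev j w); have := expR_ge1Dx (- dev j w).
  have := expR_gt0 (dev j w); have := expR_gt0 (- dev j w).
  by rewrite ler_norml => *; apply/andP; split; lra.
have N0 : dens w / (8 * S) * (\sum_j tau j * `|dev j w|) <=
  \sum_j (tau j / (8 * S)) * (dens w * expR (dev j w) + dens w * expR (- dev j w)).
  rewrite mulr_sumr; apply: ler_sum => j _.
  rewrite -mulrDr [leLHS](_ : _ = tau j / (8 * S) * (dens w * `|dev j w|)); last by ring.
  by rewrite ler_wpM2l ?divr_ge0// ?(ltW S8)// ler_wpM2l// ltW.
have A20 : 0 <= A^-1 * dens w ^+ 2 by rewrite mulr_ge0 ?invr_ge0 ?sqr_ge0// ltW.
have sum0 : 0 <= \sum_j (tau j / (8 * S)) * (dens w * expR (dev j w) + dens w * expR (- dev j w)).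
  apply: sumr_ge0 => j _; rewrite mulr_ge0 ?divr_ge0// ?(ltW S8)//.
  by rewrite addr_ge0// mulr_ge0 ?expR_ge0// ltW.
rewrite indicE shift_eventE; case: (boolP (w \in _)) => [_|/negP wE]; last first.
  have {wE} : 8 * S < \sum_j tau j * `|dev j w|.
    by rewrite ltNge; apply/negP => H; apply: wE; rewrite inE.
  move=> wE; rewrite mulr0 add0r -[leLHS]addr0; apply: lerD => //.
  apply: le_trans N0; rewrite -[leLHS]mulr1 -mulrA ler_pM2l//.
  by rewrite ler_pdivlMl// mulr1 ltW.
rewrite mulr1; have [dA|/ltW dA] := leP (dens w) A; first by lra.
have : dens w <= A^-1 * dens w ^+ 2.
  by rewrite expr2 mulrA ler_peMl ?(ltW d0)// ler_pdivlMl// mulr1.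
by have := A0; lra.
Qed.

(** Integrating [pointwise] gives 1 <= A P + 1 / 2 + 1 / 4, that is P >= 1 / (4 A). *)
Lemma shift_event_prob : ((16 * expR V)^-1%:E <= P shift_event)%E.
Proof.
have S8 : 0 < 8 * S by rewrite mulr_gt0.
have mE := measurable_shift_event.
have md : measurable_fun setT dens by apply: measurableT_comp => //; exact: mlin.
have mdev j : measurable_fun setT (dev j) by exact: mlin.
have me j : measurable_fun setT (fun w => expR (dev j w)) by exact: measurableT_comp.
have me' j : measurable_fun setT (fun w => expR (- dev j w)).
  by apply: measurableT_comp => //; exact: measurableT_comp.
have mt j : measurable_fun setT (fun w => tau j / (8 * S) *
    (dens w * expR (dev j w) + dens w * expR (- dev j w))).
  by apply: measurable_funM => //; apply: measurable_funD; exact: measurable_funM.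
have d0 w : 0 <= dens w by exact: expR_ge0.
have t0 j w : 0 <= tau j / (8 * S) *
    (dens w * expR (dev j w) + dens w * expR (- dev j w)).
  rewrite mulr_ge0 ?divr_ge0// ?(ltW S8)//.
  by rewrite addr_ge0// mulr_ge0 ?expR_ge0.
have I1 : (\int[P]_w (dens w)%:E = 1)%E.
  by rewrite integral_expR_affine -/V subrr expR0.
have I2 : (\int[P]_w (A^-1 * dens w ^+ 2)%:E = (1 / 4)%:E)%E.
  under eq_integral do rewrite EFinM.
  rewrite ge0_integralZl_EFin ?invr_ge0 ?(ltW A0)//; last 2 first.
  - by move=> w _; rewrite lee_fin sqr_ge0.
  - by apply/measurable_EFinP; exact: measurable_funX.
  transitivity (A^-1%:E * \int[P]_w (expR (\sum_i (2 * v i) * X i w + - V))%:E)%E.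
    congr (_ * _)%E; apply: eq_integral => w _; congr EFin.
    rewrite /dens -expRM_natl; congr expR; rewrite mulrDr mulr_sumr.
    by congr (_ + _); [apply: eq_bigr => i _; ring|field].
  rewrite integral_expR_affine -EFinM; congr EFin.
  have -> : (\sum_i (2 * v i) ^+ 2) / 2 - V = V.
    rewrite (eq_bigr (fun i => 4 * v i ^+ 2)); last by move=> i _; ring.
    by rewrite -mulr_sumr -/V; field.
  by rewrite /A; field; rewrite gt_eqF// expR_gt0.
(* For e = 1 and e = - 1. The cross term of |v + e b|^2 / 2 cancels the centring of [dev], leaving
   |b|^2 / 2 = 1 / 2. *)
have I3 j e : e ^+ 2 = 1 -> (\int[P]_w (dens w * expR (e * dev j w))%:E = (expR (1 / 2))%:E)%E.
  move=> e1.
  transitivity (\int[P]_w (expR (\sum_i (v i + e * b j i) * X i w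
      + (- (V / 2) - e * \sum_i b j i * v i)))%:E)%E.
    apply: eq_integral => w _; congr EFin; rewrite /dens -expRD /dev; congr expR.
    have -> : \sum_i (v i + e * b j i) * X i w =
        \sum_i v i * X i w + e * \sum_i b j i * X i w.
      rewrite mulr_sumr -big_split/=; apply: eq_bigr => i _; ring.
    ring.
  rewrite integral_expR_affine; congr (expR _)%:E.
  have -> : \sum_i (v i + e * b j i) ^+ 2 =
      V + e ^+ 2 * \sum_i b j i ^+ 2 + 2 * e * \sum_i b j i * v i.
    rewrite /V !mulr_sumr -!big_split/=; apply: eq_bigr => i _; ring.
  by rewrite b1 e1; field.
have e2 : expR (1 / 2 : R) <= 2.
  have := expR_ge1Dx (- (1 / 2) : R); have := expR_gt0 (1 / 2 : R).
  by have := expRxMexpNx_1 (1 / 2 : R); nra.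
have I4 j : (\int[P]_w (tau j / (8 * S) *
    (dens w * expR (dev j w) + dens w * expR (- dev j w)))%:E =
    (tau j / (8 * S) * (expR (1 / 2) + expR (1 / 2)))%:E)%E.
  under eq_integral do rewrite EFinM.
  rewrite ge0_integralZl_EFin ?divr_ge0 ?(ltW S8)//; last 2 first.
  - by move=> w _; rewrite lee_fin addr_ge0// mulr_ge0 ?expR_ge0.
  - by apply/measurable_EFinP; apply: measurable_funD; exact: measurable_funM.
  rewrite [RHS]EFinM; congr (_ * _)%E.
  under eq_integral do rewrite EFinD.
  rewrite ge0_integralD//; last 4 first.
  - by move=> w _; rewrite lee_fin mulr_ge0 ?expR_ge0.
  - by apply/measurable_EFinP; exact: measurable_funM.
  - by move=> w _; rewrite lee_fin mulr_ge0 ?expR_ge0.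
  - by apply/measurable_EFinP; exact: measurable_funM.
  rewrite EFinD; congr (_ + _)%E.
  - by rewrite -(I3 j 1) ?expr1n//; apply: eq_integral => w _; rewrite mul1r.
  - by rewrite -(I3 j (- 1)) ?sqrrN ?expr1n//; apply: eq_integral => w _; rewrite mulN1r.
have I5 : (\int[P]_w (\sum_j tau j / (8 * S) *
    (dens w * expR (dev j w) + dens w * expR (- dev j w)))%:E <= (1 / 2)%:E)%E.
  under eq_integral do rewrite -sumEFin.
  rewrite ge0_integral_sum//; last 2 first.
  - by move=> j; apply/measurable_EFinP; exact: mt.
  - by move=> j w _; rewrite lee_fin.
  under eq_bigr do rewrite I4.
  rewrite sumEFin lee_fin -mulr_suml -mulr_suml.
  apply: (@le_trans _ _ (S / (8 * S) * (2 + 2))).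
    apply: ler_pM => //; rewrite ?addr_ge0 ?expR_ge0//.
    - by rewrite divr_ge0 ?sumr_ge0// ltW.
    - by rewrite ler_pM2r ?invr_gt0.
    - exact: lerD.
  by rewrite le_eqVlt; apply/orP; left; apply/eqP; field; rewrite gt_eqF.
have mind : measurable_fun setT (\1_shift_event : T -> R) by exact: measurable_indic.
have I6 : (\int[P]_w (A * \1_shift_event w)%:E = A%:E * P shift_event)%E.
  under eq_integral do rewrite EFinM.
  rewrite ge0_integralZl_EFin ?(ltW A0)//.
  - by rewrite integral_indic// setIT.
  - exact/measurable_EFinP.
have mS : measurable_fun setT (fun w => \sum_j tau j / (8 * S) *
    (dens w * expR (dev j w) + dens w * expR (- dev j w))).
  exact: (@measurable_sum _ _ R setT _ _ (fun j w => tau j / (8 * S) *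
    (dens w * expR (dev j w) + dens w * expR (- dev j w)))).
have mq : measurable_fun setT (fun w => A^-1 * dens w ^+ 2).
  by apply: measurable_funM => //; exact: measurable_funX.
have mA : measurable_fun setT (fun w => A * \1_shift_event w : R).
  exact: measurable_funM.
have main : (1 <= A%:E * P shift_event + (1 / 2 + 1 / 4)%:E)%E.
  rewrite -I1 -I6.
  apply: (@le_trans _ _ (\int[P]_w (A * \1_shift_event w +
     (\sum_j (tau j / (8 * S)) * (dens w * expR (dev j w) + dens w * expR (- dev j w))
     + A^-1 * dens w ^+ 2))%:E)%E).
    apply: ge0_le_integral => //.
    - by move=> w _; rewrite lee_fin.
    - exact/measurable_EFinP.
    - apply/measurable_EFinP; apply: measurable_funD => //.
      exact: measurable_funD.
    - by move=> w _; rewrite lee_fin.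
  under eq_integral do rewrite EFinD EFinD.
  rewrite ge0_integralD//; last 4 first.
  - by move=> w _; rewrite lee_fin mulr_ge0 ?(ltW A0)// indicE.
  - exact/measurable_EFinP.
  - by move=> w _; rewrite adde_ge0 ?lee_fin ?sumr_ge0// mulr_ge0 ?sqr_ge0 ?invr_ge0 ?(ltW A0).
  - by apply: emeasurable_funD; exact/measurable_EFinP.
  apply: leeD => //.
  rewrite ge0_integralD//; last 4 first.
  - by move=> w _; rewrite lee_fin sumr_ge0.
  - exact/measurable_EFinP.
  - by move=> w _; rewrite lee_fin mulr_ge0 ?sqr_ge0 ?invr_ge0 ?(ltW A0).
  - exact/measurable_EFinP.
  by rewrite I2 EFinD leeD2r.
have Pf : P shift_event \is a fin_num.
  by rewrite ge0_fin_numE//; exact: le_lt_trans (probability_le1 P mE) (ltry _).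
move: main; rewrite -(fineK Pf) -EFinM -EFinD !lee_fin => main.
rewrite -[leLHS]mul1r ler_pdivrMr ?mulr_gt0 ?expR_gt0//.
by move: main; rewrite /A; lra.
Qed.

End gaussian_shift.

(** * Rotation invariance of the Kostlan ensemble *)

Lemma sum_sqr_eq0 (R : realFieldType) (I : finType) (F : I -> R) :
  \sum_i F i ^+ 2 = 0 -> forall i, F i = 0.
Proof.
move=> H i; apply/eqP; rewrite -sqrf_eq0.
by move/psumr_eq0P: H => -> // j _; exact: sqr_ge0.
Qed.

Section kostlan_kernel.
Context {R : realType} (d : nat).

Lemma sum_kidx (F : nat -> nat -> R) :
  \sum_(i : kidx d) F (val i).1 (val i).2 =
  \sum_(j < d.+1) \sum_(k < d.+1 | (j + k <= d)%N) F j k.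
Proof.
rewrite pair_big_dep /=.
rewrite (@reindex_omap _ _ _ _ (kidx d) val insub)/=.
  by apply: eq_bigl => i; rewrite valK eqxx (valP i).
by move=> p Pp; rewrite insubT.
Qed.

Definition kostlan_mono (i : kidx d) (x y z : R) : R :=
  kostlan_weight R i * x ^+ (val i).1 * y ^+ (val i).2
    * z ^+ (d - (val i).1 - (val i).2).

Lemma kostlan_weight_sqr (i : kidx d) : kostlan_weight R i ^+ 2 =
  (d`!)%:R / ((d - (val i).1 - (val i).2)`! * (val i).1`! * (val i).2`!)%:R.
Proof. by rewrite sqr_sqrtr// divr_ge0. Qed.

Lemma kostlan_weight_gt0 (i : kidx d) : 0 < kostlan_weight R i.
Proof. by rewrite sqrtr_gt0 divr_gt0// ltr0n ?muln_gt0 ?fact_gt0. Qed.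

(** This is the covariance of the ensemble. Depending only on the inner product, it is what makes
    the law rotation invariant; it holds by the trinomial expansion, done as two binomial ones. *)
Lemma kostlan_kernel (x y z x' y' z' : R) :
  \sum_(i : kidx d) kostlan_mono i x y z * kostlan_mono i x' y' z' =
  (x * x' + y * y' + z * z') ^+ d.
Proof.
pose a := x * x'; pose b := y * y'; pose c := z * z'.
pose G j k : R := (d`!)%:R / ((d - j - k)`! * j`! * k`!)%:R * a ^+ j * b ^+ k
     * c ^+ (d - j - k).
transitivity (\sum_(i : kidx d) G (val i).1 (val i).2).
  apply: eq_bigr => i _; rewrite /kostlan_mono /G -kostlan_weight_sqr /a /b /c !exprMn.
  ring.
rewrite sum_kidx -/a -/b -/c /G.
(* In [exprDn] the summation index is the exponent of the second term, so this order makes j and k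
   the exponents of a and b. *)
have -> : a + b + c = (c + b) + a by ring.
rewrite exprDn; apply: eq_bigr => j _.
have jd : (j <= d)%N by rewrite -ltnS.
rewrite exprDn mulr_suml -sumrMnl.
rewrite (big_ord_widen d.+1 (fun k => c ^+ (d - j - k) * b ^+ k *+ 'C(d - j, k) * a ^+ j *+ 'C(d, j)));
  last by rewrite ltnS leq_subr.
apply: eq_big => k; first by rewrite ltnS leq_subRL.
move=> jk; have kd : (k <= d - j)%N by rewrite leq_subRL.
have e1 := bin_fact jd; have e2 := bin_fact kd.
have -> : (d`!)%:R / ((d - j - k)`! * j`! * k`!)%:R = ('C(d, j) * 'C(d - j, k))%:R :> R.
  have n0 : ((d - j - k)`! * j`! * k`!)%:R != 0 :> R.
    by rewrite pnatr_eq0 -lt0n !muln_gt0 !fact_gt0.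
  apply: (canLR (mulfK n0)); rewrite -natrM -e1 -e2; congr (_%:R).
  by ring.
rewrite mulrnAl -mulrnA -mulr_natr !natrM; ring.
Qed.

Lemma kostlan_poly_mono (a : kidx d -> R) (x y : R) :
  kostlan_poly a (x, y) = \sum_i a i * kostlan_mono i x y 1.
Proof.
by apply: eq_bigr => i _; rewrite /kostlan_mono expr1n mulr1 !mulrA.
Qed.

Let K := (d.+1 * d.+1)%N.

(* Along this curve distinct monomials have distinct degrees. *)
Let pt (t : 'I_K) : R * R := (t%:R, t%:R ^+ d.+1).

Let idx (i : kidx d) : nat := ((val i).1 + d.+1 * (val i).2)%N.

Let idx_inj : injective idx.
Proof.
move=> [[j k] /= jk] [[j' k'] /= jk']; rewrite /idx/= => e.
apply: val_inj => /=.
have red (a b : nat) : (a < d.+1)%N -> ((a + d.+1 * b) %% d.+1 = a)%N.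
  by move=> ad; rewrite addnC mulnC modnMDl modn_small.
have ej : j = j' :> nat by rewrite -(red j k)// e red.
have ek : k = k' :> nat by move: e; rewrite ej; nia.
by congr (_, _); exact: val_inj.
Qed.

Let idx_lt (i : kidx d) : (idx i < K)%N.
Proof.
case: i => [[j k] /= jk]; rewrite /idx /K/=.
have := ltn_ord j; have := ltn_ord k; nia.
Qed.

(** On the curve the combination is a univariate polynomial with fewer than K + 1 coefficients,
    vanishing at the K integers below K. *)
Let mono_free (c : kidx d -> R) :
  (forall t, \sum_i c i * kostlan_mono i (pt t).1 (pt t).2 1 = 0) -> forall i, c i = 0.
Proof.
move=> H.
pose p : {poly R} := \sum_i (c i * kostlan_weight R i) *: 'X^(idx i).
have p0 : p = 0.
  apply: (@roots_geq_poly_eq0 _ p [seq (nat_of_ord t)%:R | t <- enum 'I_K]).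
  - apply/allP => _ /mapP[t _ ->]; rewrite /root /p horner_sum; apply/eqP.
    rewrite -[RHS](H t); apply: eq_bigr => i _.
    rewrite hornerZ hornerXn /kostlan_mono /pt/= expr1n mulr1 /idx exprD exprM.
    ring.
  - rewrite map_inj_uniq ?enum_uniq// => s t /eqP.
    by rewrite eqr_nat => /eqP/val_inj.
  - rewrite size_map size_enum_ord.
    apply: (leq_trans (size_sum _ _ _)); apply/bigmax_leqP => i _.
    by apply: (leq_trans (size_scale_leq _ _)); rewrite size_polyXn idx_lt.
move=> i; have := congr1 (fun q : {poly R} => q`_(idx i)) p0.
rewrite /p coef_sum (bigD1 i)//= coefZ coefXn eqxx mulr1 coef0 big1 ?addr0.
  by move/eqP; rewrite mulf_eq0 (gt_eqF (kostlan_weight_gt0 i)) orbF => /eqP.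
move=> k ki; rewrite coefZ coefXn (inj_eq idx_inj) eq_sym (negbTE ki) mulr0 //.
Qed.

Definition dot3 (X Y : R * R * R) : R :=
  X.1.1 * Y.1.1 + X.1.2 * Y.1.2 + X.2 * Y.2.

Let e (i : kidx d) (X : R * R * R) : R := kostlan_mono i X.1.1 X.1.2 X.2.

(* The vectors of monomials at the points [Pt t] span, and by [kostlan_kernel]
   the rotated ones have the same Gram matrix. *)
Lemma kostlan_rotation (rho : R * R * R -> R * R * R) :
  (forall X Y, dot3 (rho X) (rho Y) = dot3 X Y) ->
  exists M : kidx d -> kidx d -> R,
   [/\ forall X i, \sum_j M i j * kostlan_mono j X.1.1 X.1.2 X.2 =
         kostlan_mono i (rho X).1.1 (rho X).1.2 (rho X).2,
       forall i k, \sum_j M i j * M k j = (i == k)%:R &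
       forall j k, \sum_i M i j * M i k = (j == k)%:R].
Proof.
move=> hrho.
have ker X Y : \sum_i e i X * e i Y = dot3 X Y ^+ d by exact: kostlan_kernel.
pose N := #|kidx d|.
pose Pt t : R * R * R := (pt t, 1).
pose E : 'M[R]_(K, N) := \matrix_(t, i) e (enum_val i) (Pt t).
pose E' : 'M[R]_(K, N) := \matrix_(t, i) e (enum_val i) (rho (Pt t)).
have sumN (F : kidx d -> R) : \sum_(i < N) F (enum_val i) = \sum_i F i.
  by rewrite -big_enum_val.
have EE : E *m E^T = E' *m E'^T.
  apply/matrixP => s t; rewrite !mxE.
  under eq_bigr do rewrite !mxE; rewrite (sumN (fun i => e i (Pt s) * e i (Pt t))) ker.
  under eq_bigr do rewrite !mxE.
  by rewrite (sumN (fun i => e i (rho (Pt s)) * e i (rho (Pt t)))) ker hrho.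
(* By [mono_free] the columns of E are independent, so E has a left inverse. *)
have [L LE] : exists L : 'M[R]_(N, K), L *m E = 1%:M.
  apply/row_fullP; rewrite /row_full -mxrank_tr -/(row_free E^T).
  apply: inj_row_free => v vE; apply/rowP => i; rewrite [RHS]mxE -(enum_valK i).
  apply: (mono_free (c := fun i => v 0 (enum_rank i))) => t.
  transitivity ((v *m E^T) 0 t); last by rewrite vE mxE.
  rewrite mxE.
  rewrite -(sumN (fun k => v 0 (enum_rank k) * kostlan_mono k (pt t).1 (pt t).2 1)).
  by apply: eq_bigr => k _; rewrite !mxE enum_valK.
pose A := L *m E'.
have AA : A *m A^T = 1%:M.
  rewrite /A trmx_mul mulmxA -(mulmxA L E') -EE mulmxA LE mul1mx -trmx_mul LE.
  by rewrite trmx1.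
have AA' : A^T *m A = 1%:M by exact: mulmx1C.
pose u X : 'rV[R]_N := \row_i e (enum_val i) X.
have uu X Y : (u X *m (u Y)^T) 0 0 = dot3 X Y ^+ d.
  rewrite !mxE; under eq_bigr do rewrite !mxE.
  by rewrite (sumN (fun i => e i X * e i Y)) ker.
have Eu X : E *m (u X)^T = E' *m (u (rho X))^T.
  apply/colP => t; rewrite !mxE.
  under eq_bigr do rewrite !mxE; rewrite (sumN (fun i => e i (Pt t) * e i X)) ker.
  under eq_bigr do rewrite !mxE.
  by rewrite (sumN (fun i => e i (rho (Pt t)) * e i (rho X))) ker hrho.
(* The four inner products in the squared length of u X *m A - u (rho X) all equal that of u X with
   itself, so this length is 0. *)
have uA X : u X *m A = u (rho X).
  apply/eqP; rewrite -subr_eq0; apply/eqP.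
  pose v := u X *m A - u (rho X).
  have v0 : (v *m v^T) 0 0 = 0.
    have e0 : (u X *m A) *m (u X *m A)^T = u X *m (u X)^T.
      by rewrite trmx_mul mulmxA -(mulmxA (u X) A) AA mulmx1.
    have e1 : u X *m A *m (u (rho X))^T = u X *m (u X)^T.
      by rewrite /A -!mulmxA -Eu (mulmxA L) LE mul1mx.
    have e2 : u (rho X) *m (u X *m A)^T = u X *m (u X)^T.
      by rewrite -[LHS]trmxK trmx_mul trmxK e1 trmx_mul trmxK.
    have e3 : u (rho X) *m (u (rho X))^T = u X *m (u X)^T.
      by apply/matrixP => i j; rewrite !ord1 !uu hrho.
    rewrite /v [(_ - _)^T]linearB /= mulmxBl !mulmxBr e0 e1 e2 e3 !subrr.
    by rewrite mxE.
  apply/rowP => i; rewrite [RHS]mxE.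
  have := @sum_sqr_eq0 R _ (fun i => v 0 i); apply.
  by rewrite -[RHS]v0 !mxE; apply: eq_bigr => j _; rewrite !mxE.
exists (fun i j => A (enum_rank j) (enum_rank i)); split.
- move=> X i; have := congr1 (fun v : 'rV[R]_N => v 0 (enum_rank i)) (uA X).
  rewrite !mxE enum_rankK => H; transitivity (e i (rho X)) => //; rewrite -H.
  rewrite -(sumN (fun j => A (enum_rank j) (enum_rank i) * e j X)).
  by apply: eq_bigr => j _; rewrite !mxE enum_valK [RHS]mulrC.
- move=> i k; have := congr1 (fun B : 'M[R]_N => B (enum_rank i) (enum_rank k)) AA'.
  rewrite !mxE (inj_eq enum_rank_inj) => H; rewrite -[RHS]H.
  rewrite -(sumN (fun j => A (enum_rank j) (enum_rank i) * A (enum_rank j) (enum_rank k))).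
  by apply: eq_bigr => j _; rewrite !mxE enum_valK.
- move=> j k; have := congr1 (fun B : 'M[R]_N => B (enum_rank j) (enum_rank k)) AA.
  rewrite !mxE (inj_eq enum_rank_inj) => H; rewrite -[RHS]H.
  rewrite -(sumN (fun i => A (enum_rank j) (enum_rank i) * A (enum_rank k) (enum_rank i))).
  by apply: eq_bigr => i _; rewrite !mxE enum_valK.
Qed.

End kostlan_kernel.

(** * Size of the Kostlan weights *)

Section weights.
Context {R : realType} (d : nat).

Definition kdeg (i : kidx d) : nat := ((val i).1 + (val i).2)%N.

Lemma kdeg_le (i : kidx d) : (kdeg i <= d)%N. Proof. exact: (valP i). Qed.

Lemma kostlan_mono_affine (i : kidx d) (x y z : R) : z != 0 ->
  kostlan_mono i x y z =
  z ^+ d * (kostlan_weight R i * (x / z) ^+ (val i).1 * (y / z) ^+ (val i).2).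
Proof.
move=> z0; rewrite /kostlan_mono -subnDA -/(kdeg i).
have -> : z ^+ d = z ^+ (d - kdeg i) * (z ^+ (val i).1 * z ^+ (val i).2).
  by rewrite -!exprD subnK// kdeg_le.
rewrite !expr_div_n; field.
by rewrite !expf_neq0.
Qed.

Lemma ffact_le_exp (n k : nat) : (n ^_ k <= n ^ k)%N.
Proof.
elim: k => [|k IH]; first by rewrite ffactn0 expn0.
by rewrite ffactnSr expnSr leq_mul// leq_subr.
Qed.

Lemma kostlan_weight_ffact (i : kidx d) : kostlan_weight R i ^+ 2 =
  (d ^_ (kdeg i))%:R / ((val i).1`! * (val i).2`!)%:R.
Proof.
rewrite kostlan_weight_sqr -(ffact_fact (kdeg_le i)) -subnDA -/(kdeg i).
rewrite -!mulnA [in RHS]natrM !natrM; field.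
by rewrite !pnatr_eq0 -!lt0n !fact_gt0.
Qed.

(** The squared weight is a falling factorial of d over j! k!, hence at most d to the degree. This
    is why 1 / sqrt d is the natural length scale. *)
Lemma kostlan_weight_le (i : kidx d) :
  kostlan_weight R i <= Num.sqrt d%:R ^+ (kdeg i).
Proof.
rewrite -(@ler_pXn2r _ 2)// ?nnegrE ?exprn_ge0 ?sqrtr_ge0 ?(ltW (kostlan_weight_gt0 i))//.
rewrite kostlan_weight_ffact [leRHS]exprAC sqr_sqrtr// ler_pdivrMr ?ltr0n ?muln_gt0 ?fact_gt0//.
rewrite -natrX -natrM ler_nat; apply: (leq_trans (ffact_le_exp _ _)).
by rewrite leq_pmulr// muln_gt0 !fact_gt0.
Qed.

(** The factor 4 is reached by x^2 for d = 2: the squared weight d (d - 1) / 2 is then 1 while d^2 =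
    4. *)
Lemma kostlan_weight_ge (i : kidx d) : (2 <= d)%N -> (kdeg i <= 2)%N ->
  d%:R ^+ (kdeg i) <= 4 * kostlan_weight R i ^+ 2.
Proof.
move=> d2; rewrite kostlan_weight_ffact /kdeg.
case: i => [[[j hj] [k hk]] /= jk] n2.
have f0 : 0 < (j`! * k`!)%:R :> R by rewrite ltr0n muln_gt0 !fact_gt0.
rewrite mulrA ler_pdivlMr// -natrX -!natrM ler_nat.
move: n2 {f0 hj hk jk}; case: j => [|[|[|j]]]; case: k => [|[|[|k]]] //= _;
  rewrite ?addn0 ?add0n ?ffactn0 ?ffactn1 ?(ffactnS _ 1) ?ffactn1 ?expn0 ?expn1 ?factS ?fact0; nia.
Qed.

Lemma sum_kidx_low (F : nat -> nat -> R) : (2 <= d)%N ->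
  (forall j k, (2 < j + k)%N -> F j k = 0) ->
  \sum_(i : kidx d) F (val i).1 (val i).2 =
  F 0%N 0%N + F 0%N 1%N + F 0%N 2%N + F 1%N 0%N + F 1%N 1%N + F 2%N 0%N.
Proof.
move=> d2 F0; rewrite sum_kidx.
transitivity (\sum_(j < d.+1) \sum_(k < d.+1) F j k).
  apply: eq_bigr => j _; rewrite big_mkcond; apply: eq_bigr => k _.
  case: ifP => // /negbT; rewrite -ltnNge => jk; rewrite F0//.
  exact: leq_ltn_trans jk.
case: d d2 => [|[|e]]// _.
have row j : \sum_(k < e.+3) F j k = F j 0%N + F j 1%N + F j 2%N.
  rewrite 3!big_ord_recl big1 ?addr0 ?addrA//= => k _.
  by rewrite F0// /bump/= !add1n addnC.
under eq_bigr do rewrite row.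
rewrite 3!big_ord_recl big1 ?addr0; last first.
  by move=> j _; rewrite !F0 ?addr0// /bump/= !add1n.
rewrite /bump/= ?add1n (F0 1%N 2%N)// (F0 2%N 1%N)// (F0 2%N 2%N)//.
by rewrite !addr0 !addrA.
Qed.

Lemma sum_half_pow (n : nat) : \sum_(j < n) (1 / 2 : R) ^+ j <= 2.
Proof.
have -> : \sum_(j < n) (1 / 2 : R) ^+ j = 2 - 2 * (1 / 2) ^+ n.
  elim: n => [|n IH]; first by rewrite big_ord0 expr0 mulr1 subrr.
  by rewrite big_ord_recr/= IH exprS; field.
by rewrite lerBlDr lerDl mulr_ge0// exprn_ge0.
Qed.

Lemma sum_kidx_half_pow : \sum_(i : kidx d) (1 / 2 : R) ^+ (kdeg i) <= 4.
Proof.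
rewrite (sum_kidx _ (fun j k : nat => (1 / 2 : R) ^+ (j + k))).
apply: (@le_trans _ _ (\sum_(j < d.+1) (1 / 2) ^+ j * 2)).
  apply: ler_sum => j _.
  apply: (@le_trans _ _ (\sum_(k < d.+1) (1 / 2) ^+ (j + k))).
    rewrite [leLHS]big_mkcond; apply: ler_sum => k _.
    by case: ifP => // _; rewrite exprn_ge0// divr_ge0.
  under eq_bigr do rewrite exprD.
  by rewrite -mulr_sumr ler_wpM2l ?sum_half_pow// exprn_ge0// divr_ge0.
by rewrite -mulr_suml; have := sum_half_pow d.+1; lra.
Qed.

End weights.

Section frame.
Context {R : realType}.
Variables (x0 y0 : R).

Definition frame_s : R := Num.sqrt (1 + x0 ^+ 2).
Definition frame_n : R := Num.sqrt (1 + x0 ^+ 2 + y0 ^+ 2).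
Local Notation s := frame_s.
Local Notation n := frame_n.

(* An isometry of R^3 taking the direction of (x0, y0, 1) to the third axis. *)
Definition frame (X : R * R * R) : R * R * R :=
  ((X.1.1 - x0 * X.2) / s,
   (- x0 * y0 * X.1.1 + (1 + x0 ^+ 2) * X.1.2 - y0 * X.2) / (n * s),
   (x0 * X.1.1 + y0 * X.1.2 + X.2) / n).

Lemma frame_s_sqr : s ^+ 2 = 1 + x0 ^+ 2.
Proof. by rewrite sqr_sqrtr// addr_ge0// sqr_ge0. Qed.

Lemma frame_n_sqr : n ^+ 2 = 1 + x0 ^+ 2 + y0 ^+ 2.
Proof. by rewrite sqr_sqrtr// !addr_ge0// sqr_ge0. Qed.

Lemma frame_s_ge1 : 1 <= s.
Proof.
rewrite -(@ler_pXn2r _ 2)// ?nnegrE ?sqrtr_ge0// frame_s_sqr expr1n lerDl.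
exact: sqr_ge0.
Qed.

Lemma frame_n_ge1 : 1 <= n.
Proof.
rewrite -(@ler_pXn2r _ 2)// ?nnegrE ?sqrtr_ge0// frame_n_sqr expr1n -addrA lerDl.
by rewrite addr_ge0 ?sqr_ge0.
Qed.

Lemma frame_s_neq0 : s != 0.
Proof. by rewrite gt_eqF// (lt_le_trans _ frame_s_ge1). Qed.

Lemma frame_n_neq0 : n != 0.
Proof. by rewrite gt_eqF// (lt_le_trans _ frame_n_ge1). Qed.

Lemma dot3_frame X Y : dot3 (frame X) (frame Y) = dot3 X Y.
Proof.
case: X => [[x y] z]; case: Y => [[x' y'] z']; rewrite /dot3 /frame/=.
have s0 := frame_s_neq0; have n0 := frame_n_neq0.
have S0 : 1 + x0 ^+ 2 != 0 by rewrite -frame_s_sqr expf_neq0.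
have N0 : 1 + x0 ^+ 2 + y0 ^+ 2 != 0 by rewrite -frame_n_sqr expf_neq0.
have divs (a b : R) : a / s * (b / s) = a * b / (1 + x0 ^+ 2).
  by rewrite -frame_s_sqr; field.
have divn (a b : R) : a / n * (b / n) = a * b / (1 + x0 ^+ 2 + y0 ^+ 2).
  by rewrite -frame_n_sqr; field.
have divns (a b : R) : a / (n * s) * (b / (n * s)) =
    a * b / ((1 + x0 ^+ 2 + y0 ^+ 2) * (1 + x0 ^+ 2)).
  by rewrite -frame_n_sqr -frame_s_sqr; field; rewrite s0 n0.
rewrite divs divn divns; field; by rewrite S0 N0.
Qed.

End frame.

(** As m >= 1, the power m^n may replace the usual m^(n-1), which keeps the induction free of
    predecessors. *)
Lemma exprn_sub_le (R : realType) (x y m : R) (n : nat) :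
  0 <= x <= m -> 0 <= y <= m -> 1 <= m ->
  `|x ^+ n - y ^+ n| <= n%:R * m ^+ n * `|x - y|.
Proof.
move=> /andP[x0 xm] /andP[y0 ym] m1; elim: n => [|n IH].
  by rewrite !expr0 subrr normr0 !mul0r.
have -> : x ^+ n.+1 - y ^+ n.+1 = x * (x ^+ n - y ^+ n) + y ^+ n * (x - y).
  by rewrite !exprS; ring.
apply: le_trans (ler_normD _ _) _.
have H1 : `|x * (x ^+ n - y ^+ n)| <= m * (n%:R * m ^+ n * `|x - y|).
  by rewrite normrM ler_pM// ger0_norm.
have H2 : `|y ^+ n * (x - y)| <= m ^+ n.+1 * `|x - y|.
  rewrite normrM ler_wpM2r// normrX (ger0_norm y0) exprS.
  apply: (@le_trans _ _ (1 * m ^+ n)).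
    by rewrite mul1r lerXn2r// nnegrE (le_trans y0).
  by rewrite ler_wpM2r// exprn_ge0// (le_trans y0).
apply: le_trans (lerD H1 H2) _; rewrite -natr1 exprS le_eqVlt; apply/orP; left.
by apply/eqP; ring.
Qed.

Section quadratic_coefficients.
Context {R : realType}.

Definition low_coef (q00 q10 q01 q20 q11 q02 : R) (j k : nat) : R :=
  match j, k with
  | 0, 0 => q00 | 1, 0 => q10 | 0, 1 => q01
  | 2, 0 => q20 | 1, 1 => q11 | 0, 2 => q02
  | _, _ => 0%R
  end.

Lemma low_coef_high q00 q10 q01 q20 q11 q02 j k : (2 < j + k)%N ->
  low_coef q00 q10 q01 q20 q11 q02 j k = 0.
Proof. by case: j => [|[|[|j]]]; case: k => [|[|[|k]]]. Qed.

Definition low_quad (q00 q10 q01 q20 q11 q02 x y : R) : R :=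
  q00 + q10 * x + q01 * y + q20 * x ^+ 2 + q11 * (x * y) + q02 * y ^+ 2.

End quadratic_coefficients.

(** * The field in a small disc *)

Section local.
Context {R : realType} (d : nat).
Variables (x0 y0 ra : R).
Hypothesis d2 : (2 <= d)%N.
Hypothesis x01 : 0 <= x0 <= 1.
Hypothesis y01 : 0 <= y0 <= 1.
Hypothesis ra0 : 0 < ra.
Hypothesis ra1 : ra <= 1 / 24.

Let s := frame_s x0.
Let n := frame_n x0 y0.
Let D : R := Num.sqrt d%:R.
Let h := ra / D.

Let D1 : 1 <= D.
Proof.
by rewrite -sqrtr1 ler_sqrt// ler1n (leq_trans _ d2).
Qed.

Let D0 : 0 < D. Proof. exact: lt_le_trans D1. Qed.

Let h0 : 0 < h. Proof. by rewrite divr_gt0. Qed.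

Let h_ra : h <= ra.
Proof. by rewrite /h ler_pdivrMr// ler_peMr// ltW. Qed.

Let s1 : 1 <= s. Proof. exact: frame_s_ge1. Qed.
Let n1 : 1 <= n. Proof. exact: frame_n_ge1. Qed.
Let sn0 : s != 0. Proof. exact: frame_s_neq0. Qed.
Let nn0 : n != 0. Proof. exact: frame_n_neq0. Qed.
Let s2 : s ^+ 2 = 1 + x0 ^+ 2. Proof. exact: frame_s_sqr. Qed.
Let n2 : n ^+ 2 = 1 + x0 ^+ 2 + y0 ^+ 2. Proof. exact: frame_n_sqr. Qed.

(** In the rotated affine coordinates, the point at polar displacement (h r, t) from (x0, y0) lies
    on the ray of direction ([dir1] t, [dir2] t), at distance parameter h * [ray_radius] r t. The
    denominator 1 + h * [tilt] t * r comes from central projection. *)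
Definition tilt (t : R) : R := (x0 * cos t + y0 * sin t) / n ^+ 2.
Definition ray_radius (r t : R) : R := r / (1 + h * tilt t * r).
Definition dir1 (t : R) : R := cos t / (s * n).
Definition dir2 (t : R) : R :=
  (- x0 * y0 * cos t + (1 + x0 ^+ 2) * sin t) / (n ^+ 2 * s).

Lemma tilt_bound t : `|tilt t| <= 1.
Proof.
have np : 0 < n ^+ 2 by rewrite exprn_gt0// (lt_le_trans _ n1).
rewrite /tilt normrM normfV (gtr0_norm np) ler_pdivrMr// mul1r n2.
have hc := cos_max t; have hs := sin_max t.
move/andP: x01 => [a0 a1]; move/andP: y01 => [b0 b1].
apply: le_trans (ler_normD _ _) _; rewrite !normrM (ger0_norm a0) (ger0_norm b0).
have : x0 * `|cos t| <= x0 by rewrite ler_piMr.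
have : y0 * `|sin t| <= y0 by rewrite ler_piMr.
by nra.
Qed.

Lemma ray_denominator r t : 1 / 2 <= r <= 3 / 2 ->
  1 / 2 <= 1 + h * tilt t * r <= 3 / 2.
Proof.
move=> /andP[r0 r1].
have hb : `|h| <= 1 / 24 by rewrite gtr0_norm// (le_trans h_ra).
have rb : `|r| <= 3 / 2 by rewrite ger0_norm//; lra.
have := ler_norm_prod (ler_norm_prod hb (tilt_bound t)) rb.
by rewrite ler_norml => /andP[? ?]; apply/andP; split; lra.
Qed.

Lemma ray_radius_bounds r t : 1 / 2 <= r <= 3 / 2 -> 0 <= ray_radius r t <= 3.
Proof.
move=> hr; have /andP[u v] := ray_denominator t hr; move: hr => /andP[r0 r1].
have u0 : 0 < 1 + h * tilt t * r by lra.
apply/andP; split; first by rewrite divr_ge0 ?(ltW u0)//; lra.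
by rewrite /ray_radius ler_pdivrMr//; lra.
Qed.

Lemma ray_radius_lip r1 r2 t : 1 / 2 <= r1 <= 3 / 2 -> 1 / 2 <= r2 <= 3 / 2 ->
  `|ray_radius r1 t - ray_radius r2 t| <= 4 * `|r1 - r2|.
Proof.
move=> hr1 hr2; have /andP[u1 _] := ray_denominator t hr1.
have /andP[u2 _] := ray_denominator t hr2.
set e1 := 1 + h * tilt t * r1 in u1 *; set e2 := 1 + h * tilt t * r2 in u2 *.
have e10 : e1 != 0 by rewrite gt_eqF//; lra.
have e20 : e2 != 0 by rewrite gt_eqF//; lra.
have -> : ray_radius r1 t - ray_radius r2 t = (r1 - r2) / (e1 * e2).
  rewrite /ray_radius -/e1 -/e2.
  have -> : r1 / e1 - r2 / e2 = (r1 * e2 - r2 * e1) / (e1 * e2).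
    by field; rewrite e10 e20.
  by congr (_ / _); rewrite /e1 /e2; ring.
have q4 : (0 : R) < 1 / 4 by rewrite divr_gt0.
have e4 : 1 / 4 <= e1 * e2 by nra.
by apply: le_trans (ler_norm_div q4 e4 (lexx _)) _; lra.
Qed.

(* The reparametrization r -> ray_radius r t is C^1-close to the identity. *)
Lemma ray_shift r t : 1 / 2 <= r <= 3 / 2 -> `|ray_radius r t - r| <= 5 * ra.
Proof.
move=> hr; have /andP[u _] := ray_denominator t hr.
set e := 1 + h * tilt t * r in u *.
have e0 : e != 0 by rewrite gt_eqF//; lra.
have -> : ray_radius r t - r = (h * - tilt t * (r * r)) / e.
  rewrite /ray_radius -/e.
  have -> : r / e - r = (r - r * e) / e by field.
  by congr (_ / _); rewrite /e; ring.
have hb : `|h| <= ra by rewrite gtr0_norm.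
have tb : `|- tilt t| <= 1 by rewrite normrN tilt_bound.
have rb : `|r| <= 3 / 2 by move: hr => /andP[? ?]; rewrite ger0_norm//; lra.
have q2 : (0 : R) < 1 / 2 by rewrite divr_gt0.
apply: le_trans (ler_norm_div q2 u (ler_norm_prod (ler_norm_prod hb tb)
  (ler_norm_prod rb rb))) _.
by move: ra0; lra.
Qed.

Lemma ray_shift_lip r1 r2 t : 1 / 2 <= r1 <= 3 / 2 -> 1 / 2 <= r2 <= 3 / 2 ->
  `|(ray_radius r1 t - r1) - (ray_radius r2 t - r2)| <= 20 * ra * `|r1 - r2|.
Proof.
move=> hr1 hr2; have /andP[u1 _] := ray_denominator t hr1.
have /andP[u2 _] := ray_denominator t hr2.
set e1 := 1 + h * tilt t * r1 in u1 *; set e2 := 1 + h * tilt t * r2 in u2 *.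
have e10 : e1 != 0 by rewrite gt_eqF//; lra.
have e20 : e2 != 0 by rewrite gt_eqF//; lra.
have -> : (ray_radius r1 t - r1) - (ray_radius r2 t - r2) =
    (h * - tilt t * (r1 + r2 + h * tilt t * (r1 * r2)) * (r1 - r2)) / (e1 * e2).
  rewrite /ray_radius -/e1 -/e2.
  have -> : r1 / e1 - r1 - (r2 / e2 - r2) =
      (r1 * e2 - r2 * e1 - (r1 - r2) * (e1 * e2)) / (e1 * e2).
    by field; rewrite e10 e20.
  by congr (_ / _); rewrite /e1 /e2; ring.
have hb : `|h| <= ra by rewrite gtr0_norm.
have hb' : `|h| <= 1 / 24 by apply: le_trans hb _.
have tb : `|- tilt t| <= 1 by rewrite normrN tilt_bound.
have rb1 : `|r1| <= 3 / 2 by move: hr1 => /andP[? ?]; rewrite ger0_norm//; lra.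
have rb2 : `|r2| <= 3 / 2 by move: hr2 => /andP[? ?]; rewrite ger0_norm//; lra.
have q4 : (0 : R) < 1 / 4 by rewrite divr_gt0.
have e4 : 1 / 4 <= e1 * e2 by nra.
have big : `|r1 + r2 + h * tilt t * (r1 * r2)| <= 5.
  apply: le_trans (ler_normD _ _) _.
  have := ler_norm_prod (ler_norm_prod hb' (tilt_bound t)) (ler_norm_prod rb1 rb2).
  by have := ler_normD r1 r2; lra.
apply: le_trans (ler_norm_div q4 e4 (ler_norm_prod (ler_norm_prod
  (ler_norm_prod hb tb) big) (lexx _))) _.
by rewrite le_eqVlt; apply/orP; left; apply/eqP; field.
Qed.

Lemma dir1_bound t : `|dir1 t| <= 2.
Proof.
have sn1 : 1 <= s * n by rewrite -[1]mulr1 ler_pM.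
by apply: le_trans (ler_norm_div ltr01 sn1 (cos_max t)) _; lra.
Qed.

Lemma dir2_bound t : `|dir2 t| <= 2.
Proof.
have ns0 : 0 < n ^+ 2 * s by rewrite mulr_gt0 ?exprn_gt0// (lt_le_trans _ n1, lt_le_trans _ s1).
rewrite /dir2 normrM normfV (gtr0_norm ns0) ler_pdivrMr//.
have hc := cos_max t; have hs := sin_max t.
move/andP: x01 => [a0 a1]; move/andP: y01 => [b0 b1].
apply: (@le_trans _ _ (2 * n ^+ 2)); last first.
  by rewrite ler_wpM2l// ler_peMr// sqr_ge0.
have X1 : `|- x0 * y0| <= 1 by rewrite normrM normrN !ger0_norm// mulr_ile1.
have X2 : `|1 + x0 ^+ 2| <= 1 + x0 ^+ 2 by rewrite ger0_norm// addr_ge0// sqr_ge0.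
apply: le_trans (ler_normD _ _) _.
have := ler_norm_prod X1 hc; have := ler_norm_prod X2 hs; rewrite n2.
by have := sqr_ge0 x0; have := sqr_ge0 y0; lra.
Qed.

Lemma frame_ray r t : 1 + h * tilt t * r != 0 ->
  let Y := frame x0 y0 (x0 + h * (r * cos t), y0 + h * (r * sin t), 1) in
  [/\ Y.2 = n * (1 + h * tilt t * r), Y.1.1 / Y.2 = h * ray_radius r t * dir1 t &
      Y.1.2 / Y.2 = h * ray_radius r t * dir2 t].
Proof.
move=> e0 Y.
have Y2 : Y.2 = n * (1 + h * tilt t * r).
  rewrite /Y /frame/= -/n /tilt.
  have -> : n * (1 + h * ((x0 * cos t + y0 * sin t) / n ^+ 2) * r) =
    (n ^+ 2 + h * (x0 * cos t + y0 * sin t) * r) / n by field.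
  by rewrite n2; congr (_ / _); ring.
split => //; rewrite Y2 /ray_radius /Y /frame/= -/s -/n.
  by rewrite /dir1; field; rewrite e0 sn0 nn0.
by rewrite /dir2; field; rewrite e0 sn0 nn0.
Qed.

(** The polynomial with coefficients b in the rotated affine coordinates, evaluated on the image ray
    at the parameter h rho. *)
Definition ray_sum (b : kidx d -> R) (rho t : R) : R :=
  \sum_i b i * kostlan_weight R i * (h * rho) ^+ kdeg i
    * dir1 t ^+ (val i).1 * dir2 t ^+ (val i).2.

Lemma ray_sumD (b b' : kidx d -> R) rho t :
  ray_sum (fun i => b i + b' i) rho t = ray_sum b rho t + ray_sum b' rho t.
Proof. by rewrite /ray_sum -big_split; apply: eq_bigr => i _ /=; ring. Qed.

Lemma ray_sumZ c (b : kidx d -> R) rho t :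
  ray_sum (fun i => c * b i) rho t = c * ray_sum b rho t.
Proof. by rewrite /ray_sum mulr_sumr; apply: eq_bigr => i _; ring. Qed.

(** A coefficient of degree m is a sum of at most three terms of size at most 9, divided by h^m and
    by the weight. The squared weight is at least d^m / 4 and h^2 d = ra^2, so its square is at most
    4 * 27^2 / ra^(2 m), bounded by 54^2 / ra^4; there are six of them. *)
Lemma ray_sum_low (q00 q10 q01 q20 q11 q02 : R) :
  `|q00| <= 1 -> `|q10| <= 1 -> `|q01| <= 1 ->
  `|q20| <= 1 -> `|q11| <= 1 -> `|q02| <= 1 ->
  exists b : kidx d -> R, \sum_i b i ^+ 2 <= 6 * (54 * 54) / ra ^+ 4 /\
    forall rho t, ray_sum b rho t =
      low_quad q00 q10 q01 q20 q11 q02 (rho * cos t) (rho * sin t).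
Proof.
move=> h00 h10 h01 h20 h11 h02.
(* The inverse change of directions: cos t = A1 dir1 and sin t = A2 dir1 + A3 dir2. *)
pose A1 := s * n; pose A2 := x0 * y0 * n / s; pose A3 := n ^+ 2 / s.
pose G := low_coef q00 ((q10 * A1 + q01 * A2) / h) (q01 * A3 / h)
  ((q20 * A1 ^+ 2 + q11 * (A1 * A2) + q02 * A2 ^+ 2) / h ^+ 2)
  ((q11 * (A1 * A3) + 2 * q02 * (A2 * A3)) / h ^+ 2)
  (q02 * A3 ^+ 2 / h ^+ 2).
have hn0 : h != 0 by rewrite gt_eqF.
have wn0 (i : kidx d) : kostlan_weight R i != 0 by rewrite gt_eqF// kostlan_weight_gt0.
exists (fun i : kidx d => G (val i).1 (val i).2 / kostlan_weight R i); split; last first.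
  move=> rho t; rewrite /ray_sum.
  transitivity (\sum_(i : kidx d) (fun j k : nat => G j k * (h * rho) ^+ (j + k)%N
      * dir1 t ^+ j * dir2 t ^+ k) (val i).1 (val i).2).
    by apply: eq_bigr => i _; rewrite divfK.
  rewrite (@sum_kidx_low R d (fun j k : nat => G j k * (h * rho) ^+ (j + k)%N
      * dir1 t ^+ j * dir2 t ^+ k))//; last first.
    by move=> j k jk; rewrite /G low_coef_high// !mul0r.
  have ec : cos t = A1 * dir1 t by rewrite /A1 /dir1; field; rewrite sn0 nn0.
  have es : sin t = A2 * dir1 t + A3 * dir2 t.
    have -> : A2 * dir1 t + A3 * dir2 t = (1 + x0 ^+ 2) * sin t / s ^+ 2.
      by rewrite /A2 /A3 /dir1 /dir2; field; rewrite sn0 nn0.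
    by rewrite -s2 mulrAC divff ?mul1r// expf_neq0.
  rewrite /low_quad {1 2 3}ec {1 2 3}es /G /=; field; exact: hn0.
have [s3 n3] : s <= 3 / 2 /\ n <= 7 / 4.
  move/andP: x01 => [a0 a1]; move/andP: y01 => [b0 b1].
  have : x0 ^+ 2 <= 1 by rewrite exprn_ile1.
  have : y0 ^+ 2 <= 1 by rewrite exprn_ile1.
  by move: s1 n1 s2 n2 => *; split; nra.
have hA1 : `|A1| <= 3.
  by rewrite /A1 ger0_norm ?mulr_ge0 ?sqrtr_ge0//; move: s1 n1; nra.
have hA2 : `|A2| <= 3.
  move/andP: x01 => [a0 a1]; move/andP: y01 => [b0 b1].
  have X : `|x0 * y0 * n| <= 3.
    have xy : 0 <= x0 * y0 <= 1 by rewrite mulr_ge0//= mulr_ile1.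
    by move/andP: xy => [? ?]; rewrite ger0_norm ?mulr_ge0 ?sqrtr_ge0//; move: n1; nra.
  by apply: le_trans (ler_norm_div ltr01 s1 X) _; rewrite divr1.
have hA3 : `|A3| <= 3.
  have X : `|n ^+ 2| <= 3 by rewrite ger0_norm ?sqr_ge0// n2; move: x01 y01; nra.
  by apply: le_trans (ler_norm_div ltr01 s1 X) _; rewrite divr1.
have hG j k : `|G j k| <= 27 / h ^+ (j + k).
  have hsq : 0 < h ^+ 2 by rewrite exprn_gt0.
  have add3 (a b c : R) : `|a| <= 9 -> `|b| <= 9 -> `|c| <= 9 -> `|a + b + c| <= 27.
    by rewrite !ler_norml => /andP[? ?] /andP[? ?] /andP[? ?]; apply/andP; split; lra.
  have q3 (q a : R) : `|q| <= 1 -> `|a| <= 3 -> `|q * a| <= 9.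
    by move=> hq ha; have := ler_norm_prod hq ha; lra.
  have q9 (q a b : R) : `|q| <= 1 -> `|a| <= 3 -> `|b| <= 3 -> `|q * (a * b)| <= 9.
    by move=> hq ha hb; have := ler_norm_prod hq (ler_norm_prod ha hb); lra.
  have z9 : `|0 : R| <= 9 by rewrite normr0.
  have zero : 0 <= 27 / h ^+ (j + k) by rewrite divr_ge0// exprn_ge0// ltW.
  move: zero; case: j => [|[|[|j]]]; case: k => [|[|[|k]]];
    rewrite /G /low_coef ?addn0 ?add0n ?expr0 ?expr1 ?normr0 // => _.
  - by rewrite divr1; apply: le_trans h00 _; rewrite ler1n.
  - apply: ler_norm_div h0 (lexx _) _.
    by have := add3 _ _ _ (q3 _ _ h01 hA3) z9 z9; rewrite !addr0.
  - apply: ler_norm_div hsq (lexx _) _; rewrite expr2.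
    by have := add3 _ _ _ (q9 _ _ _ h02 hA3 hA3) z9 z9; rewrite !addr0.
  - apply: ler_norm_div h0 (lexx _) _.
    by have := add3 _ _ _ (q3 _ _ h10 hA1) (q3 _ _ h01 hA2) z9; rewrite !addr0.
  - apply: ler_norm_div hsq (lexx _) _.
    have -> : q11 * (A1 * A3) + 2 * q02 * (A2 * A3) =
      q11 * (A1 * A3) + q02 * (A2 * A3) + q02 * (A2 * A3) by ring.
    exact: add3 (q9 _ _ _ h11 hA1 hA3) (q9 _ _ _ h02 hA2 hA3) (q9 _ _ _ h02 hA2 hA3).
  - apply: ler_norm_div hsq (lexx _) _; rewrite !expr2.
    exact: add3 (q9 _ _ _ h20 hA1 hA1) (q9 _ _ _ h11 hA1 hA2) (q9 _ _ _ h02 hA2 hA2).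
pose C := 54 * 54 / ra ^+ 4.
have ra40 : 0 < ra ^+ 4 by rewrite exprn_gt0.
have C0 : 0 <= C by rewrite /C mulr_ge0 ?invr_ge0 ?(ltW ra40)// mulr_ge0.
pose F (j k : nat) : R := if (j + k <= 2)%N then C else 0.
apply: (@le_trans _ _ (\sum_(i : kidx d) F (val i).1 (val i).2)); last first.
  rewrite (@sum_kidx_low R d F)//; last by move=> j k; rewrite /F ltnNge => /negbTE ->.
  rewrite /F/= /C; lra.
apply: ler_sum => i _; rewrite /F -/(kdeg i); case: ifP => [i2|/negbT]; last first.
  by rewrite -ltnNge => i2; rewrite /G low_coef_high// mul0r expr0n.
have W := @kostlan_weight_ge R d i d2 i2.
have hd : h ^+ 2 * d%:R = ra ^+ 2.
  rewrite /h expr_div_n sqr_sqrtr// divfK// pnatr_eq0 -lt0n.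
  exact: leq_trans d2.
have G2 : G (val i).1 (val i).2 ^+ 2 <= (27 / h ^+ kdeg i) ^+ 2.
  by rewrite -real_normK ?num_real// lerXn2r ?nnegrE ?hG// divr_ge0// exprn_ge0// ltW.
have w20 : 0 < kostlan_weight R i ^+ 2 by rewrite exprn_gt0// kostlan_weight_gt0.
have dn0 : 0 < d%:R ^+ kdeg i :> R.
  by rewrite exprn_gt0// ltr0n (leq_trans _ d2).
rewrite expr_div_n ler_pdivrMr//; apply: le_trans G2 _.
rewrite expr_div_n ler_pdivrMr ?exprn_gt0//.
have raC : 54 * 54 <= C * ra ^+ 2 ^+ kdeg i.
  apply: (@le_trans _ _ (C * ra ^+ 4)); first by rewrite /C divfK ?gt_eqF.
  rewrite ler_wpM2l// -exprM; apply: ler_wiXn2l; rewrite ?(ltW ra0)//.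
    by apply: le_trans ra1 _; lra.
  by rewrite -[4%N]/(2 * 2)%N leq_mul2l.
have e : (ra ^+ 2) ^+ kdeg i = h ^+ kdeg i ^+ 2 * d%:R ^+ kdeg i.
  by rewrite -hd exprMn exprAC.
rewrite e in raC.
have : C * (h ^+ kdeg i ^+ 2 * d%:R ^+ kdeg i) <=
    C * (h ^+ kdeg i ^+ 2 * (4 * kostlan_weight R i ^+ 2)).
  by rewrite ler_wpM2l// ler_wpM2l// sqr_ge0.
move: raC; set X := h ^+ kdeg i ^+ 2; set Y := kostlan_weight R i ^+ 2; lra.
Qed.

(** A term of degree m is at most |b i| (6 ra)^m, since directions are bounded by 2 and rho by 3.
    With ra <= 1 / 24 this is (1 / 4)^m; the gap to (1 / 2)^m absorbs the factor m of the Lipschitz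
    bound. *)
Lemma ray_sum_noise (b : kidx d -> R) (A : R) :
  \sum_i (1 / 2) ^+ kdeg i * `|b i| <= A ->
  (forall rho t, 0 <= rho <= 3 -> `|ray_sum b rho t| <= A) /\
  (forall rho1 rho2 t, 0 <= rho1 <= 3 -> 0 <= rho2 <= 3 ->
    `|ray_sum b rho1 t - ray_sum b rho2 t| <= A * `|rho1 - rho2|).
Proof.
move=> hA.
have wb (i : kidx d) t : `|kostlan_weight R i * h ^+ kdeg i * dir1 t ^+ (val i).1
    * dir2 t ^+ (val i).2| <= (2 * ra) ^+ kdeg i.
  have -> : (2 * ra) ^+ kdeg i = D ^+ kdeg i * h ^+ kdeg i *
      2 ^+ (val i).1 * 2 ^+ (val i).2.
    have hD : D * h = ra by rewrite /h mulrC divfK ?gt_eqF.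
    by rewrite -exprMn hD -mulrA -exprD -/(kdeg i) -exprMn mulrC.
  have pw (x : R) m : `|x| <= 2 -> `|x ^+ m| <= 2 ^+ m.
    by move=> hx; rewrite normrX lerXn2r ?nnegrE.
  apply: ler_norm_prod (pw _ _ (dir2_bound t)).
  apply: ler_norm_prod (pw _ _ (dir1_bound t)).
  apply: ler_norm_prod; last by rewrite ger0_norm// exprn_ge0// ltW.
  by rewrite (gtr0_norm (kostlan_weight_gt0 i)) kostlan_weight_le.
have ra6 m : (2 * ra) ^+ m * 3 ^+ m <= (1 / 4) ^+ m.
  rewrite -exprMn lerXn2r ?nnegrE ?divr_ge0// ?mulr_ge0// ?(ltW ra0)//.
  by move: ra1; lra.
have q0 m : 0 <= (1 / 2 : R) ^+ m by rewrite exprn_ge0// divr_ge0.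
have half m : (1 / 4 : R) ^+ m <= (1 / 2) ^+ m.
  by rewrite lerXn2r ?nnegrE ?divr_ge0//; lra.
have nhalf m : m%:R * (1 / 4 : R) ^+ m <= (1 / 2) ^+ m.
  have -> : (1 / 4 : R) = (1 / 2) * (1 / 2) by field.
  rewrite exprMn mulrA -[leRHS]mul1r ler_wpM2r//.
  rewrite expr_div_n expr1n mul1r ler_pdivrMr ?exprn_gt0// mul1r -natrX ler_nat.
  exact/ltnW/ltn_expl.
have t0 (i : kidx d) : 0 <= (2 * ra) ^+ kdeg i by rewrite exprn_ge0// mulr_ge0// ltW.
split=> [rho t /andP[r0 r3]|rho1 rho2 t hr1 hr2].
  apply: le_trans hA; apply: le_trans (ler_norm_sum _ _ _) _.
  apply: ler_sum => i _.
  have -> : b i * kostlan_weight R i * (h * rho) ^+ kdeg i * dir1 t ^+ (val i).1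
      * dir2 t ^+ (val i).2 =
      b i * ((kostlan_weight R i * h ^+ kdeg i * dir1 t ^+ (val i).1
      * dir2 t ^+ (val i).2) * rho ^+ kdeg i) by rewrite exprMn; ring.
  rewrite normrM mulrC ler_wpM2r//; apply: le_trans (half _).
  apply: le_trans (ra6 _); apply: ler_norm_prod => //.
  by rewrite normrX lerXn2r ?nnegrE// ger0_norm.
apply: (@le_trans _ _ ((\sum_i (1 / 2) ^+ kdeg i * `|b i|) * `|rho1 - rho2|)); last first.
  by rewrite ler_wpM2r.
rewrite /ray_sum -sumrB mulr_suml; apply: le_trans (ler_norm_sum _ _ _) _.
apply: ler_sum => i _.
have -> : b i * kostlan_weight R i * (h * rho1) ^+ kdeg i * dir1 t ^+ (val i).1
    * dir2 t ^+ (val i).2 - b i * kostlan_weight R i * (h * rho2) ^+ kdeg i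
    * dir1 t ^+ (val i).1 * dir2 t ^+ (val i).2 =
    b i * ((kostlan_weight R i * h ^+ kdeg i * dir1 t ^+ (val i).1
    * dir2 t ^+ (val i).2) * (rho1 ^+ kdeg i - rho2 ^+ kdeg i)).
  by rewrite !exprMn; ring.
rewrite normrM [leRHS]mulrAC [leRHS]mulrC ler_wpM2l//.
have m3 : 1 <= 3 :> R by rewrite ler1n.
have E := exprn_sub_le (kdeg i) hr1 hr2 m3.
apply: le_trans (ler_norm_prod (wb i t) E) _.
rewrite mulrA ler_wpM2r//; apply: le_trans (nhalf _).
by rewrite mulrCA ler_wpM2l// ra6.
Qed.

End local.

(** * A cycle for coefficients close to the shift *)

Section local_cycle.
Context {R : realType} (d : nat).
Variables (x0 y0 ra : R).
Hypothesis d2 : (2 <= d)%N.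
Hypothesis x01 : 0 <= x0 <= 1.
Hypothesis y01 : 0 <= y0 <= 1.
Hypothesis ra0 : 0 < ra.
Hypothesis ra1 : ra <= 1 / 24.

Let h := ra / Num.sqrt d%:R.
Let n := frame_n x0 y0.
Let psi := ray_radius d x0 y0 ra.
Local Notation rsum := (ray_sum x0 y0 ra).

Variable M : kidx d -> kidx d -> R.
Hypothesis M_frame : forall X i,
  \sum_j M i j * kostlan_mono j X.1.1 X.1.2 X.2 =
  kostlan_mono i (frame x0 y0 X).1.1 (frame x0 y0 X).1.2 (frame x0 y0 X).2.
Hypothesis M_rows : forall i k, \sum_j M i j * M k j = (i == k)%:R.
Hypothesis M_cols : forall j k, \sum_i M i j * M i k = (j == k)%:R.

Let app (a : kidx d -> R) (i : kidx d) : R := \sum_j M i j * a j.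

Let appK (a b : kidx d -> R) : \sum_i app a i * app b i = \sum_i a i * b i.
Proof.
transitivity (\sum_i \sum_j \sum_k a j * b k * (M i j * M i k)).
  apply: eq_bigr => i _; rewrite /app mulr_suml; apply: eq_bigr => j _.
  by rewrite mulr_sumr; apply: eq_bigr => k _; ring.
rewrite exchange_big; apply: eq_bigr => j _.
rewrite exchange_big (bigD1 j)//= -mulr_sumr M_cols eqxx mulr1 big1 ?addr0//.
by move=> k kj; rewrite -mulr_sumr M_cols eq_sym (negbTE kj) mulr0.
Qed.

(** The orthogonal matrix M applied to both coefficients and monomials leaves the sum unchanged, and
    on monomials it acts as the rotation. Dehomogenizing extracts the d-th power of the third
    coordinate. *)
Lemma kostlan_on_ray (a : kidx d -> R) r t : 1 / 2 <= r <= 3 / 2 ->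
  kostlan_poly a (x0 + h * (r * cos t), y0 + h * (r * sin t)) =
  (n * (1 + h * tilt x0 y0 t * r)) ^+ d * rsum (app a) (psi r t) t.
Proof.
move=> hr; have /andP[e0 _] := ray_denominator d2 x01 y01 ra0 ra1 t hr.
have e0' : 1 + h * tilt x0 y0 t * r != 0.
  by rewrite gt_eqF//; apply: lt_le_trans e0; rewrite divr_gt0.
have [] := @frame_ray R d x0 y0 ra r t e0'.
set X := (_, _, 1); set Y := frame x0 y0 X => Y2 Y11 Y12.
have n0 : n != 0 by exact: frame_n_neq0.
have Yn0 : Y.2 != 0 by rewrite Y2 mulf_neq0.
rewrite kostlan_poly_mono -(appK a (fun i => kostlan_mono i X.1.1 X.1.2 X.2)).
rewrite -Y2 /ray_sum mulr_sumr; apply: eq_bigr => i _.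
have -> : app (fun i => kostlan_mono i X.1.1 X.1.2 X.2) i =
  kostlan_mono i Y.1.1 Y.1.2 Y.2 by exact: M_frame.
rewrite kostlan_mono_affine// Y11 Y12.
rewrite -/h -/psi; move: (h * psi r t) (Y.2 ^+ d) => q y.
by rewrite !exprMn /kdeg exprD; ring.
Qed.

(** With e = psi - r, this is the change of b r + g r^2 when r becomes psi, because psi^2 - r^2 = e
    (2 r + e). *)
Lemma quadratic_shift (b g e1 e2 r1 r2 : R) : `|b| <= 1 -> `|g| <= 1 ->
  1 / 2 <= r1 <= 3 / 2 -> 1 / 2 <= r2 <= 3 / 2 ->
  `|e1| <= 5 * ra -> `|e2| <= 5 * ra -> `|e1 - e2| <= 20 * ra * `|r1 - r2| ->
  `|b * e1 + g * (e1 * (2 * r1 + e1))| <= 25 * ra /\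
  `|(b * e1 + g * (e1 * (2 * r1 + e1))) - (b * e2 + g * (e2 * (2 * r2 + e2)))|
    <= 100 * ra * `|r1 - r2|.
Proof.
move=> hb hg hr1 hr2 he1 he2 he.
have R1 : `|r1| <= 3 / 2 by move: hr1 => /andP[? ?]; rewrite ger0_norm//; lra.
have R2 : `|r2| <= 3 / 2 by move: hr2 => /andP[? ?]; rewrite ger0_norm//; lra.
have q (e r : R) : `|e| <= 5 * ra -> `|r| <= 3 / 2 -> `|2 * r + e| <= 4.
  move=> h1 h2; apply: le_trans (ler_normD _ _) _; rewrite normrM ger0_norm//.
  by move: ra1; lra.
split.
  apply: le_trans (ler_normD _ _) _.
  have := ler_norm_prod hb he1.
  have := ler_norm_prod hg (ler_norm_prod he1 (q _ _ he1 R1)); lra.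
have -> : (b * e1 + g * (e1 * (2 * r1 + e1))) - (b * e2 + g * (e2 * (2 * r2 + e2)))
  = b * (e1 - e2) + g * (2 * e1 * (r1 - r2)) + g * ((e1 - e2) * (2 * r2 + (e1 + e2))).
  by ring.
have h10 : `|2 * e1| <= 10 * ra by rewrite normrM ger0_norm//; lra.
have q2 : `|2 * r2 + (e1 + e2)| <= 7 / 2.
  apply: le_trans (ler_normD _ _) _; rewrite normrM ger0_norm//.
  by have := ler_normD e1 e2; move: ra1; lra.
apply: le_trans (ler_normD _ _) _; apply: le_trans (lerD (ler_normD _ _) (lexx _)) _.
have := ler_norm_prod hb he.
have := ler_norm_prod hg (ler_norm_prod h10 (lexx `|r1 - r2|)).
have := ler_norm_prod hg (ler_norm_prod he q2).
have x0' : 0 <= ra * `|r1 - r2| by rewrite mulr_ge0 ?normr_ge0// ltW.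
have x1' : ra * (ra * `|r1 - r2|) <= 1 / 24 * (ra * `|r1 - r2|) by rewrite ler_wpM2r.
move: x0' x1'; set x := `|r1 - r2|.
by lra.
Qed.

Lemma continuous_kostlan_poly (a : kidx d -> R) : continuous (kostlan_poly a).
Proof.
have c1 : continuous (fst : R * R -> R) by move=> z; exact: cvg_fst.
have c2 : continuous (snd : R * R -> R) by move=> z; exact: cvg_snd.
pose f (i : kidx d) (z : R * R) : R := a i * kostlan_weight R i
    * z.1 ^+ (val i).1 * z.2 ^+ (val i).2.
have cf i : continuous (f i).
  apply: continuousMfun; last exact: continuousXfun.
  apply: continuousMfun; last exact: continuousXfun.
  exact: continuous_cstfun.
exact: (continuous_sumfun cf).
Qed.

(** Half of eps is for the change of radius, at most 100 ra, and half for the noise divided by L.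
    The noise is bounded by 64 and its Lipschitz constant in r by 64 * 4, whence 512. *)
Variables (eps L : R).
Hypothesis eps0 : 0 < eps.
Hypothesis ra_eps : 200 * ra <= eps.
Hypothesis L0 : 0 < L.
Hypothesis L_eps : 512 <= eps * L.
Hypothesis persist : quadratic_cycle_persists eps.

(** The deterministic part of the argument. The shifts do not depend on a1 and a2, and their norm
    bound involves only L and ra, not d or the base point. *)
Lemma kostlan_shift : exists v1 v2 : kidx d -> R,
  \sum_i v1 i ^+ 2 + \sum_i v2 i ^+ 2 <= 2 * (L ^+ 2 * (6 * (54 * 54) / ra ^+ 4)) /\
  forall a1 a2 : kidx d -> R,
    \sum_i (1 / 2) ^+ kdeg i * `|\sum_j M i j * (a1 j - v1 j)| <= 64 ->
    \sum_i (1 / 2) ^+ kdeg i * `|\sum_j M i j * (a2 j - v2 j)| <= 64 ->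
    exists C, [/\ limit_cycle (fun z => (kostlan_poly a1 z, kostlan_poly a2 z)) C,
      C !=set0 & forall z, C z -> (z.1 - x0) ^+ 2 + (z.2 - y0) ^+ 2 <= 4 * h ^+ 2].
Proof.
have n1 (a : R) : `|a| <= 1 -> `|- a| <= 1 by rewrite normrN.
have b0 : `|0 : R| <= 1 by rewrite normr0.
have b1 : `|1 : R| <= 1 by rewrite normr1.
have b2 : `|1 / 2 : R| <= 1 by rewrite ger0_norm//; lra.
have b4 : `|1 / 4 : R| <= 1 by rewrite ger0_norm//; lra.
(* The arguments here and below are the coefficients of [quad1] and [quad2] at 1, x, y, x^2, x y and
   y^2. *)
have [t1 [t1b t1E]] := @ray_sum_low R d x0 y0 ra d2 x01 y01 ra0 ra1
  (1 / 4) 0 (- 1) (- (1 / 4)) (1 / 2) (- (1 / 4)) b4 b0 (n1 _ b1) (n1 _ b4) b2 (n1 _ b4).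
have [t2 [t2b t2E]] := @ray_sum_low R d x0 y0 ra d2 x01 y01 ra0 ra1
  0 1 0 (- (1 / 2)) 0 0 b0 b1 b0 (n1 _ b2) b0 b0.
(* L times the transpose of M applied to t, so that the rotation turns the shift into L t. *)
pose v (t : kidx d -> R) (j : kidx d) := L * \sum_k t k * M k j.
have v_app t i : app (v t) i = L * t i.
  rewrite /app /v.
  transitivity (L * \sum_k t k * \sum_j M i j * M k j).
    under eq_bigr do rewrite mulrCA mulr_sumr.
    rewrite -mulr_sumr exchange_big; congr (_ * _); apply: eq_bigr => k _.
    by rewrite mulr_sumr; apply: eq_bigr => j _; ring.
  congr (_ * _); rewrite (bigD1 i)//= M_rows eqxx mulr1 big1 ?addr0// => k ki.
  by rewrite M_rows eq_sym (negbTE ki) mulr0.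
have v_norm t : \sum_i v t i ^+ 2 = L ^+ 2 * \sum_i t i ^+ 2.
  under eq_bigr do rewrite expr2.
  rewrite -appK mulr_sumr; apply: eq_bigr => i _.
  by rewrite v_app; ring.
exists (v t1), (v t2); split.
  rewrite !v_norm; have L20 : 0 <= L ^+ 2 by exact: sqr_ge0.
  by have := ler_wpM2l L20 t1b; have := ler_wpM2l L20 t2b; lra.
move=> a1 a2 hb1 hb2.
pose be (a : kidx d -> R) t i := \sum_j M i j * (a j - v t j).
have appE a t : app a = fun i => L * t i + be a t i.
  apply/funext => i; rewrite -v_app /be /app -big_split; apply: eq_bigr => j _ /=.
  by ring.
have [N1 N1'] := ray_sum_noise d2 x01 y01 ra0 ra1 hb1.
have [N2 N2'] := ray_sum_noise d2 x01 y01 ra0 ra1 hb2.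
have half (r : R) : `|r - 1| <= 1 / 2 -> 1 / 2 <= r <= 3 / 2.
  by rewrite ler_norml => /andP[? ?]; apply/andP; split; lra.
have psib r t : `|r - 1| <= 1 / 2 -> 0 <= psi r t <= 3.
  by move=> /half; exact: ray_radius_bounds.
pose E1 r t := (quad1 (psi r t * cos t) (psi r t * sin t) - quad1 (r * cos t) (r * sin t))
  + rsum (be a1 t1) (psi r t) t / L.
pose E2 r t := (quad2 (psi r t * cos t) (psi r t * sin t) - quad2 (r * cos t) (r * sin t))
  + rsum (be a2 t2) (psi r t) t / L.
pose phi r t := (n * (1 + h * tilt x0 y0 t * r)) ^+ d * L.
pose F z := (kostlan_poly a1 z, kostlan_poly a2 z).
have L_n0 : L != 0 by rewrite gt_eqF.
have h_gt0 : 0 < h.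
  by rewrite divr_gt0// sqrtr_gt0 ltr0n (leq_trans _ d2).
have q1E r t : quad1 (psi r t * cos t) (psi r t * sin t) - quad1 (r * cos t) (r * sin t) =
    - sin t * (psi r t - r) + (cos t * sin t / 2 - 1 / 4) *
      ((psi r t - r) * (2 * r + (psi r t - r))).
  have e (x : R) : quad1 (x * cos t) (x * sin t) =
      1 / 4 - x * sin t + (cos t * sin t / 2 - 1 / 4) * x ^+ 2.
    by rewrite /quad1 !exprMn -mulrDr cos2Dsin2 mulr1; field.
  by rewrite !e; ring.
have q2E r t : quad2 (psi r t * cos t) (psi r t * sin t) - quad2 (r * cos t) (r * sin t) =
    cos t * (psi r t - r) + - (cos t * cos t / 2) *
      ((psi r t - r) * (2 * r + (psi r t - r))).
  by rewrite /quad2; field.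
have hc t : `|cos t : R| <= 1 by exact: cos_max.
have hs t : `|sin t : R| <= 1 by exact: sin_max.
have g1 t : `|cos t * sin t / 2 - 1 / 4 : R| <= 1.
  have := ler_norm_prod (hc t) (hs t).
  by rewrite !ler_norml => /andP[? ?]; apply/andP; split; lra.
have g2 t : `|- (cos t * cos t / 2) : R| <= 1.
  have := ler_norm_prod (hc t) (hc t).
  by rewrite !ler_norml => /andP[? ?]; apply/andP; split; lra.
have rx r t : `|r - 1| <= 1 / 2 -> `|psi r t - r| <= 5 * ra.
  by move=> /half; exact: ray_shift.
have rl r1 r2 t : `|r1 - 1| <= 1 / 2 -> `|r2 - 1| <= 1 / 2 ->
    `|(psi r1 t - r1) - (psi r2 t - r2)| <= 20 * ra * `|r1 - r2|.
  by move=> /half h1 /half h2; exact: ray_shift_lip.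
have pl r1 r2 t : `|r1 - 1| <= 1 / 2 -> `|r2 - 1| <= 1 / 2 ->
    `|psi r1 t - psi r2 t| <= 4 * `|r1 - r2|.
  by move=> /half h1 /half h2; exact: ray_radius_lip.
have noise (x : R) : `|x| <= 64 -> `|x / L| <= eps / 2.
  move=> hx; apply: le_trans (ler_norm_div L0 (lexx _) hx) _.
  by rewrite ler_pdivrMr//; move: L_eps; lra.
have noiseL (x y : R) : 0 <= y -> `|x| <= 64 * (4 * y) -> `|x / L| <= eps / 2 * y.
  move=> y0' hx; apply: le_trans (ler_norm_div L0 (lexx _) hx) _.
  rewrite ler_pdivrMr//; have := ler_wpM2r y0' L_eps; lra.
have cK (a : kidx d -> R) : continuous (fun u => kostlan_poly a (rescale (x0, y0) h u)).
  have c1 : continuous (fst : R * R -> R) by move=> z; exact: cvg_fst.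
  have c2 : continuous (snd : R * R -> R) by move=> z; exact: cvg_snd.
  have cr : continuous (rescale (x0, y0) h).
    by apply: continuous_pairfun; apply: continuousDfun; try exact: continuous_cstfun;
      apply: continuousMfun => //; exact: continuous_cstfun.
  move=> u; apply: (@continuous_comp _ _ _ (rescale (x0, y0) h) (kostlan_poly a)).
    exact: cr.
  exact: continuous_kostlan_poly.
(* The lower bound on phi degenerates with d; this is harmless, as [persist] accepts any positive
   constant. *)
have c0 : 0 < (1 / 2) ^+ d * L by rewrite mulr_gt0// exprn_gt0// divr_gt0.
have [|||C [lc ne bd]] := @persist (fun u => F (rescale (x0, y0) h u)) phi E1 E2
    ((1 / 2) ^+ d * L) c0 (cK a1) (cK a2).
- move=> r t hr; split.
  + have X : 1 / 2 <= n * (1 + h * tilt x0 y0 t * r).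
      have /andP[hd _] := ray_denominator d2 x01 y01 ra0 ra1 t (half _ hr).
      have hn : 1 <= n := frame_n_ge1 x0 y0.
      by rewrite -[leLHS]mul1r ler_pM// divr_ge0.
    have q2 : 0 <= 1 / 2 :> R by rewrite divr_ge0.
    by rewrite /phi ler_pM2r// lerXn2r ?nnegrE// (le_trans q2).
  + rewrite /F /rescale/= (kostlan_on_ray a1 t (half _ hr)) (appE a1 t1).
    rewrite ray_sumD ray_sumZ t1E /E1 /phi -/(be a1 t1).
    have -> : low_quad (1 / 4) 0 (-1) (- (1 / 4)) (1 / 2) (- (1 / 4))
        (psi r t * cos t) (psi r t * sin t) = quad1 (psi r t * cos t) (psi r t * sin t).
      by rewrite /low_quad /quad1; field.
    by field.
  + rewrite /F /rescale/= (kostlan_on_ray a2 t (half _ hr)) (appE a2 t2).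
    rewrite ray_sumD ray_sumZ t2E /E2 /phi -/(be a2 t2).
    have -> : low_quad 0 1 0 (- (1 / 2)) 0 0
        (psi r t * cos t) (psi r t * sin t) = quad2 (psi r t * cos t) (psi r t * sin t).
      by rewrite /low_quad /quad2; field.
    by field.
- move=> r t hr.
  have r_self : `|(psi r t - r) - (psi r t - r)| <= 20 * ra * `|r - r|.
    by rewrite !subrr normr0 mulr0.
  split.
    have [h1 _] := quadratic_shift (n1 _ (hs t)) (g1 t) (half _ hr) (half _ hr)
      (rx _ t hr) (rx _ t hr) r_self.
    rewrite /E1 q1E; apply: le_trans (ler_normD _ _) _.
    by have := noise _ (N1 (psi r t) t (psib r t hr)); move: ra_eps eps0 h1; lra.
  have [h1 _] := quadratic_shift (hc t) (g2 t) (half _ hr) (half _ hr)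
    (rx _ t hr) (rx _ t hr) r_self.
  rewrite /E2 q2E; apply: le_trans (ler_normD _ _) _.
  by have := noise _ (N2 (psi r t) t (psib r t hr)); move: ra_eps eps0 h1; lra.
- move=> r1 r2 t hr1 hr2 r12.
  have D0 : 0 <= r1 - r2 by rewrite subr_ge0.
  have DE : `|r1 - r2| = r1 - r2 by rewrite ger0_norm.
  have PL := pl _ _ t hr1 hr2; rewrite DE in PL.
  have raD : 200 * ra * (r1 - r2) <= eps * (r1 - r2) by rewrite ler_wpM2r.
  have six4 : (0 : R) <= 64 by [].
  split.
    have [_ h1] := quadratic_shift (n1 _ (hs t)) (g1 t) (half _ hr1) (half _ hr2)
      (rx _ t hr1) (rx _ t hr2) (rl _ _ t hr1 hr2).
    have h2 := noiseL _ _ D0 (le_trans (N1' _ _ t (psib _ t hr1) (psib _ t hr2))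
      (ler_wpM2l six4 PL)).
    rewrite /E1 !q1E opprD addrACA -mulrBl.
    apply: le_trans (ler_normD _ _) _.
    by move: h1 h2 raD; rewrite DE; lra.
  have [_ h1] := quadratic_shift (hc t) (g2 t) (half _ hr1) (half _ hr2)
    (rx _ t hr1) (rx _ t hr2) (rl _ _ t hr1 hr2).
  have h2 := noiseL _ _ D0 (le_trans (N2' _ _ t (psib _ t hr1) (psib _ t hr2))
    (ler_wpM2l six4 PL)).
  rewrite /E2 !q2E opprD addrACA -mulrBl.
  apply: le_trans (ler_normD _ _) _.
  by move: h1 h2 raD; rewrite DE; lra.
exists (rescale (x0, y0) h @` C); split.
- exact: (limit_cycle_rescale h_gt0 lc).
- by case: ne => u Cu; exists (rescale (x0, y0) h u), u.
- move=> _ [u Cu <-]; rewrite /rescale/=.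
  have -> : (x0 + h * u.1 - x0) ^+ 2 + (y0 + h * u.2 - y0) ^+ 2 =
    (u.1 ^+ 2 + u.2 ^+ 2) * h ^+ 2 by ring.
  by rewrite ler_pM2r ?exprn_gt0//; exact: bd.
Qed.

End local_cycle.

(** * Counting the cycles *)

(** Every simple function below f is below g, so the suprema compare. It is applied with g the
    number of limit cycles. *)
Lemma ge0_le_integral_nonmeasurable (d : measure_display) (T : measurableType d)
    (R : realType) (mu : {measure set T -> \bar R}) (f g : T -> \bar R) :
  (forall x, (0 <= f x)%E) -> (forall x, (f x <= g x)%E) ->
  (\int[mu]_x f x <= \int[mu]_x g x)%E.
Proof.
move=> f0 fg; rewrite !ge0_integralTE//; last first.
  by move=> x; exact: le_trans (f0 x) (fg x).
apply: ereal_sup_le => _ [h hf <-]; exists h => // x.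
exact: le_trans (hf x) (fg x).
Qed.

Lemma counting_ge_card (R : realType) (T : choiceType) (A : set T)
    (I : finType) (K : {set I}) (C : I -> T) :
  {in K &, injective C} -> (forall k, k \in K -> A (C k)) ->
  ((#|K|%:R)%:E <= @counting T R A)%E.
Proof.
move=> Cinj CA; rewrite /counting; case: asboolP => finA; last by rewrite leey.
rewrite lee_fin ler_nat cardE -(size_map C); apply: uniq_leq_size.
  by rewrite map_inj_in_uniq ?enum_uniq// => k l; rewrite !mem_enum; exact: Cinj.
move=> _ /mapP[k + ->]; rewrite mem_enum => kK.
by rewrite in_fset_set// mem_set//; exact: CA.
Qed.

Section kostlan_events.
Context {R : realType}.

(** The constants eps, ra, L and V are fixed in this order, before d and the point are chosen; hence
    c1 is uniform. *)
Lemma local_cycle_event : exists ra c1 : R, [/\ 0 < ra, ra <= 1 / 24, 0 < c1 &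
  forall (d : nat) (disp : measure_display) (T : measurableType disp)
      (P : probability T R) (a b : kidx d -> {RV P >-> R}) (x0 y0 : R),
  (2 <= d)%N -> independent_kostlan a b -> 0 <= x0 <= 1 -> 0 <= y0 <= 1 ->
  exists E : set T, [/\ measurable E, (c1%:E <= P E)%E &
    forall w, E w -> exists C,
      [/\ limit_cycle (fun z => (kostlan_poly (fun i => a i w) z,
                                 kostlan_poly (fun i => b i w) z)) C,
      C !=set0 & forall z, C z ->
        (z.1 - x0) ^+ 2 + (z.2 - y0) ^+ 2 <= 4 * (ra / Num.sqrt d%:R) ^+ 2]]].
Proof.
have [eps eps0 persist] := @perturbed_quadratic_limit_cycle R.
have [ra [ra0 ra1 rae]] : exists ra : R, [/\ 0 < ra, ra <= 1 / 24 & 200 * ra <= eps].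
  exists (Order.min (1 / 24) (eps / 200)); split.
  - by rewrite lt_min (divr_gt0 (ltr0Sn R 0) (ltr0Sn R 23)) (divr_gt0 eps0 (ltr0Sn R 199)).
  - by rewrite ge_min lexx.
  - by rewrite mulrC -(ler_pdivlMr _ _ (ltr0Sn R 199)) ge_min lexx orbT.
pose L := 512 / eps.
have L0 : 0 < L := divr_gt0 (ltr0Sn R 511) eps0.
have Le : 512 <= eps * L by rewrite /L mulrC divfK ?gt_eqF.
pose V := 2 * (L ^+ 2 * (6 * (54 * 54) / ra ^+ 4)).
exists ra, (16 * expR V)^-1; split => //.
  by rewrite invr_gt0 mulr_gt0// expR_gt0.
move=> d disp T P a b x0 y0 d2 [indep normal] x01 y01.
have [M [Mf Mr Mc]] := @kostlan_rotation R d _ (@dot3_frame R x0 y0).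
have [v1 [v2 [vV H]]] := kostlan_shift d2 x01 y01 ra0 ra1 Mf Mr Mc eps0 rae L0 Le persist.
pose X (i : kidx d + kidx d) : {RV P >-> R} :=
  match i with inl k => a k | inr k => b k end.
pose v (i : kidx d + kidx d) : R := match i with inl k => v1 k | inr k => v2 k end.
(* Block diagonal, to treat both polynomials in one event. The weights [tau] sum to at most 4 for
   each polynomial, so S = 8 and the threshold 8 S is the 64 of [kostlan_shift]. *)
pose B (j i : kidx d + kidx d) : R :=
  match j, i with
  | inl j, inl i => M j i | inr j, inr i => M j i | _, _ => 0
  end.
pose tau (j : kidx d + kidx d) : R :=
  (1 / 2) ^+ (match j with inl k => kdeg k | inr k => kdeg k end).
have B1 j : \sum_i B j i ^+ 2 = 1.
  have row k : \sum_i M k i ^+ 2 = 1.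
    by under eq_bigr do rewrite expr2; rewrite Mr eqxx.
  have zero : \sum_(i : kidx d) (0 : R) ^+ 2 = 0 by rewrite big1// => i _; rewrite expr0n.
  by rewrite big_sumType; case: j => k /=; rewrite row zero ?addr0 ?add0r.
have tau0 j : 0 <= tau j by rewrite exprn_ge0// divr_ge0.
have tau8 : \sum_j tau j <= 8.
  rewrite big_sumType /=; have := @sum_kidx_half_pow R d; rewrite /tau; lra.
have e8 : 0 < 8 :> R by [].
exists (shift_event X B tau 8 v); split.
- exact: measurable_shift_event.
- apply: le_trans (shift_event_prob indep normal v B1 tau0 e8 tau8).
  rewrite lee_fin lef_pV2 ?posrE ?mulr_gt0 ?expR_gt0// ler_pM2l// ler_expR.
  by rewrite big_sumType.
- move=> w; rewrite /shift_event/= big_sumType/=.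
  have suml k : \sum_i B (inl k) i * (X i w - v i) = \sum_j M k j * (a j w - v1 j).
    rewrite big_sumType/= [X in _ + X]big1 ?addr0// => i _; exact: mul0r.
  have sumr k : \sum_i B (inr k) i * (X i w - v i) = \sum_j M k j * (b j w - v2 j).
    rewrite big_sumType/= [X in X + _]big1 ?add0r// => i _; exact: mul0r.
  under eq_bigr do rewrite suml.
  under [X in _ + X <= _]eq_bigr do rewrite sumr.
  rewrite /tau; set S1 := \sum_i _; set S2 := \sum_i _ => S64.
  have S1p : 0 <= S1 by apply: sumr_ge0 => i _; rewrite mulr_ge0// exprn_ge0// divr_ge0.
  have S2p : 0 <= S2 by apply: sumr_ge0 => i _; rewrite mulr_ge0// exprn_ge0// divr_ge0.
  by apply: H; move: S64 S1p S2p; rewrite /S1 /S2; lra.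
Qed.

(** For the largest n with n^2 <= d one has d < (n + 1)^2 <= 4 n^2. *)
Lemma floor_sqrt (d : nat) : (0 < d)%N ->
  exists n : nat, [/\ (0 < n)%N, (n * n <= d)%N & (d <= 4 * (n * n))%N].
Proof.
move=> d0; have ex : exists n : nat, (n * n <= d)%N && (0 < n)%N by exists 1%N; rewrite mul1n d0.
have bd n : (n * n <= d)%N && (0 < n)%N -> (n <= d)%N.
  by move=> /andP[nd n0]; apply: leq_trans nd; rewrite leq_pmulr.
have [n /andP[nd n0] nmax] := ex_maxnP ex bd.
exists n; split=> //; rewrite leqNgt; apply/negP => H.
have : ((n.+1 * n.+1 <= d)%N && (0 < n.+1)%N).
  by rewrite andbT; nia.
by move=> /nmax; rewrite ltnn.
Qed.

End kostlan_events.

(* For d = 1 the field is affine and has no limit cycle, so the inequality is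
   false there for every c0 > 0.  The integral of a nonnegative function is a
   supremum over measurable simple functions below it, so no measurability of
   the number of limit cycles is presupposed. *)
Theorem theorem1p2 (R : realType) :
  exists2 c0 : R, 0 < c0 &
    forall (d : nat), d <> 1%N ->
    forall (disp : measure_display) (T : measurableType disp)
      (P : probability T R) (a b : kidx d -> {RV P >-> R}),
      independent_kostlan a b ->
      ((c0 * d%:R)%:E <=
        \int[P]_w num_limit_cycles
          (fun z => (kostlan_poly (fun i => a i w) z,
                     kostlan_poly (fun i => b i w) z)))%E.
Proof.
have [ra [c1 [ra0 ra1 c10 event]]] := @local_cycle_event R.
(* The grid has n^2 >= d / 4 points, each with an event of probability at least c1. *)
exists (c1 / 4); first by rewrite divr_gt0.
move=> d d_n1 disp T P a b hab.
set F := fun w z => (kostlan_poly (fun i => a i w) z, kostlan_poly (fun i => b i w) z).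
case: (posnP d) => [d_eq0|d_gt0].
  have -> : d%:R = 0 :> R by rewrite d_eq0.
  rewrite mulr0; apply: integral_ge0 => w _.
  by rewrite /num_limit_cycles /counting; case: ifP => _; rewrite ?lee_fin ?leey.
have d2 : (2 <= d)%N by case: d d_gt0 d_n1 {a b hab F} => [|[|d]].
have [n [n0 nd dn]] := floor_sqrt d_gt0.
have nR0 : 0 < n%:R :> R by rewrite ltr0n.
pose pt (k : 'I_n) : R := k%:R / n%:R.
have pt01 k : 0 <= pt k <= 1.
  by rewrite divr_ge0//= ler_pdivrMr// mul1r ler_nat ltnW.
have /choice[E hE] k : exists E : set T, [/\ measurable E, (c1%:E <= P E)%E &
    forall w, E w -> exists C, [/\ limit_cycle (F w) C, C !=set0 & forall z, C z ->
        (z.1 - pt k.1) ^+ 2 + (z.2 - pt k.2) ^+ 2 <= 4 * (ra / Num.sqrt d%:R) ^+ 2]].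
  exact: event.
pose f w : R := \sum_(k : 'I_n * 'I_n) \1_(E k) w.
have f0 w : 0 <= f w by apply: sumr_ge0 => k _; rewrite indicE.
(* Two grid abscissas within 2 ra / sqrt d of a common x differ by at most 4 ra / sqrt d <= 1 / (6
   sqrt d), less than the spacing 1 / n >= 1 / sqrt d. *)
have sep (i j : 'I_n) (x : R) : (x - pt i) ^+ 2 <= 4 * (ra / Num.sqrt d%:R) ^+ 2 ->
    (x - pt j) ^+ 2 <= 4 * (ra / Num.sqrt d%:R) ^+ 2 -> i = j.
  move=> hi hj; apply/eqP/negPn/negP => ij.
  have dR0 : 0 < d%:R :> R by rewrite ltr0n.
  have h2 : (ra / Num.sqrt d%:R) ^+ 2 * d%:R = ra ^+ 2.
    by rewrite expr_div_n sqr_sqrtr ?ler0n// divfK// gt_eqF.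
  have near_ : (pt i - pt j) ^+ 2 <= 16 * (ra / Num.sqrt d%:R) ^+ 2.
    have := sqr_ge0 ((x - pt i) + (x - pt j)); nra.
  have far : 1 <= (pt i - pt j) ^+ 2 * d%:R.
    have e : (pt i - pt j) ^+ 2 * (n%:R * n%:R) = (i%:R - j%:R) ^+ 2.
      by rewrite /pt; field; rewrite gt_eqF.
    have ij1 : 1 <= (i%:R - j%:R) ^+ 2 :> R.
      have lt1 (p q : nat) : (p < q)%N -> 1 <= (p%:R - q%:R) ^+ 2 :> R.
        by rewrite -(ler_nat R) -natr1 => ?; nra.
      case: (ltngtP i j) => [/lt1//|/lt1|/val_inj/eqP]; last by rewrite (negbTE ij).
      by rewrite -sqrrN opprB.
    rewrite (le_trans ij1)// -e ler_wpM2l ?sqr_ge0// -natrM ler_nat //.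
  have : ra ^+ 2 <= (1 / 24) ^+ 2 by rewrite lerXn2r ?nnegrE ?divr_ge0// ltW.
  have := ler_wpM2r (ltW dR0) near_; rewrite -[16 * _ * _]mulrA h2; lra.
have f_le w : ((f w)%:E <= num_limit_cycles (F w))%E.
  pose K : {set 'I_n * 'I_n} := [set k | w \in E k]%SET.
  have fK : f w = #|K|%:R.
    rewrite /f -sum1_card natr_sum [RHS]big_mkcond /=; apply: eq_bigr => k _.
    by rewrite indicE inE; case: (w \in E k).
  have /choice[C hC] k : exists C, k \in K ->
      [/\ limit_cycle (F w) C, C !=set0 & forall z, C z ->
        (z.1 - pt k.1) ^+ 2 + (z.2 - pt k.2) ^+ 2 <= 4 * (ra / Num.sqrt d%:R) ^+ 2].
    case: (boolP (k \in K)) => [|kK]; last by exists set0.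
    rewrite inE => /set_mem wE; have [_ _ /(_ w wE)[C hC]] := hE k.
    by exists C.
  (* Equal cycles share a point, which by [sep] in each coordinate forces equal grid points; so
     distinct events that occur yield distinct cycles. *)
  rewrite fK; apply: (@counting_ge_card R _ [set D | limit_cycle (F w) D] _ K C) => [k l kK lK Ckl|k /hC[]//].
  have [_ [z Cz] bk] := hC k kK; have [_ _ bl] := hC l lK.
  have {}bk := bk z Cz; have {}bl := bl z; rewrite -Ckl in bl.
  have {}bl := bl Cz.
  have := sqr_ge0 (z.1 - pt k.1); have := sqr_ge0 (z.2 - pt k.2).
  have := sqr_ge0 (z.1 - pt l.1); have := sqr_ge0 (z.2 - pt l.2) => p1 p2 p3 p4.
  rewrite [k]surjective_pairing [l]surjective_pairing; congr (_, _).
    by apply: (sep _ _ z.1); move: bk bl p1 p2 p3 p4; lra.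
  by apply: (sep _ _ z.2); move: bk bl p1 p2 p3 p4; lra.
apply: le_trans (ge0_le_integral_nonmeasurable P _ f_le); last first.
  by move=> w; rewrite lee_fin.
under eq_integral do rewrite /f -sumEFin.
rewrite ge0_integral_sum//; last first.
  by move=> k; apply/measurable_EFinP; apply: measurable_indic; have [] := hE k.
apply: (@le_trans _ _ (\sum_(k : 'I_n * 'I_n) c1%:E)%E); last first.
  apply: lee_sum => k _; have [mE PE _] := hE k.
  by rewrite integral_indic// setIT.
rewrite sumEFin lee_fin sumr_const card_prod card_ord -mulr_natr.
have : d%:R <= 4 * (n * n)%:R :> R by rewrite -natrM ler_nat.
by move=> /(ler_wpM2l (ltW c10)); lra.
Qed.
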